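(* Consider a semi-continuous MDP model $\{\mathbf X,\mathbf A,p\}$ with a fixed initial distribution $\mathsf P_0$. Suppose that the MDP model is absorbing (at $0$) for $\mathsf P_0$. Then the projection mapping $O:\mathcal P\to\mathcal D$ defined by $O(\mathsf P^\pi_{\mathsf P_0}):=\eta^\pi_{\mathsf P_0}$, from the space $\mathcal P$ of strategic measures (endowed with the weak topology) to the space $\mathcal D$ of occupation measures (endowed with the weak topology), is continuous if and only if the MDP model is uniformly absorbing (at $0$) for $\mathsf P_0$.
   Context: MDP model. A topological Borel space is a Borel subset of a completely metrizable separable space. An MDP model $\{\mathbf X,\mathbf A,p\}$ consists of nonempty topological Borel spaces $\mathbf X$ (states) and $\mathbf A$ (actions), with Borel $\sigma$-algebras $\mathcal B(\mathbf X)$, $\mathcal B(\mathbf A)$, and a (measurable) stochastic kernel $p(dy|x,a)$ on $\mathcal B(\mathbf X)$ given $\mathbf X\times\mathbf A$. Strategies and strategic measures. Let $\mathbf H:=\mathbf X\times(\mathbf A\times\mathbf X)^\infty$ with the product topology and $\sigma$-algebra (which is its Borel $\sigma$-algebra), with elements $\omega=(x_0,a_1,x_1,a_2,\dots)$, and coordinate maps $X_t(\omega)=x_t$, $A_{t+1}(\omega)=a_{t+1}$, $t\ge0$. A strategy $\pi=\{\pi_t\}_{t\ge1}$ is a sequence of stochastic kernels $\pi_t(da|x_0,a_1,x_1,\dots,a_{t-1},x_{t-1})$ on $\mathcal B(\mathbf A)$ given $(\mathbf X\times\mathbf A)^{t-1}\times\mathbf X$; $\Delta^{\rm All}$ is the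 set of all strategies. Given an initial distribution (probability measure) $\mathsf P_0$ on $\mathbf X$ and $\pi\in\Delta^{\rm All}$, the strategic measure $\mathsf P^\pi_{\mathsf P_0}$ is the unique probability measure on $\mathbf H$ under which $X_0\sim\mathsf P_0$, $A_{t+1}$ given $(X_0,A_1,\dots,X_t)$ has law $\pi_{t+1}(da|X_0,A_1,\dots,X_t)$, and $X_{t+1}$ given $(X_0,A_1,\dots,X_t,A_{t+1})$ has law $p(dx|X_t,A_{t+1})$, for all $t\ge0$. Its expectation is $\mathsf E^\pi_{\mathsf P_0}$. Put $\mathcal P:=\{\mathsf P^\pi_{\mathsf P_0}:\pi\in\Delta^{\rm All}\}$, with the weak topology (generated by bounded continuous functions on $\mathbf H$). Semi-continuity. The model is semi-continuous (S) if $\mathbf A$ is compact and for each $x\in\mathbf X$ and each bounded measurable $u$ on $\mathbf X$ the function $a\mapsto\int_{\mathbf X}u(y)p(dy|x,a)$ is continuous on $\mathbf A$. It is semi-continuous (W) if $\mathbf A$ is compact and for each bounded continuous $u$ on $\mathbf X$ the function $(x,a)\mapsto\int_{\mathbf X}u(y)p(dy|x,a)$ is continuous on $\mathbf X\times\mathbf A$. It is semi-continuous if it is semi-continuous (S) or semi-continuous (W). Absorbing models. The model is absorbing (at $0$) for $\mathsf P_0$ if there is an isolated point $0\in\mathbf X$ with $p(\{0\}|0,a)=1$ for all $a\in\mathbf A$, and $\mathsf E^\pi_{\mathsf P_0}[T_0]<\infty$ for all $\pi\in\Delta^{\rm All}$, where $T_0:=\inf\{t\ge0:X_t=0\}$ ($\inf\emptyset:=\infty$).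 A model absorbing (at $0$) for $\mathsf P_0$ is uniformly absorbing (at $0$) for $\mathsf P_0$ if $$\lim_{n\to\infty}\sup_{\pi\in\Delta^{\rm All}}\mathsf E^\pi_{\mathsf P_0}\Big[\sum_{t=n}^\infty\mathbb I\{t<T_0\}\Big]=0,$$ where $\mathbb I$ denotes the indicator. Occupation measures. For a model with isolated absorbing state $0$, the occupation measure of $\pi$ for $\mathsf P_0$ is the measure on $(\mathbf X\setminus\{0\})\times\mathbf A$ given by $$\eta^\pi_{\mathsf P_0}(\Gamma^{\mathbf X}\times\Gamma^{\mathbf A}):=\sum_{t=1}^\infty\mathsf P^\pi_{\mathsf P_0}(X_{t-1}\in\Gamma^{\mathbf X},A_t\in\Gamma^{\mathbf A}),\quad \Gamma^{\mathbf X}\in\mathcal B(\mathbf X\setminus\{0\}),\ \Gamma^{\mathbf A}\in\mathcal B(\mathbf A).$$ Put $\mathcal D:=\{\eta^\pi_{\mathsf P_0}:\pi\in\Delta^{\rm All}\}$. If the model is absorbing for $\mathsf P_0$, all elements of $\mathcal D$ are finite measures, and $\mathcal D$ carries the weak topology, i.e. the subspace topology from the space of finite measures on $(\mathbf X\setminus\{0\})\times\mathbf A$ with the coarsest topology making $\eta\mapsto\int g\,d\eta$ continuous for every bounded continuous $g$ on $(\mathbf X\setminus\{0\})\times\mathbf A$. *)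

(* Defs.v *)
From HB Require Import structures.
From mathcomp Require Import all_boot all_order all_algebra.
From mathcomp Require Import all_classical all_reals all_analysis.
From mathcomp Require Import measurable_realfun.

Set Implicit Arguments.
Unset Strict Implicit.
Unset Printing Implicit Defensive.
Import Order.TTheory GRing.Theory Num.Theory.
Import numFieldNormedType.Exports.

Local Open Scope classical_set_scope.
Local Open Scope ring_scope.
Local Open Scope ereal_scope.

Notation borel T := (g_sigma_algebraType (@open T)).

(* [T] is homeomorphic (through [i]) to a Borel subset of a complete separable
   metric space. *)
Definition topological_borel_space (R : realType) (T : topologicalType) : Prop :=
  exists (S : metricType R) (i : T -> S),
    [/\ forall F : set_system S, ProperFilter F -> cauchy F -> exists s : S, F --> s,
        exists2 C : set S, countable C & dense C,
        injective i,
        forall U : set T, open U <-> exists2 V : set S, open V & U = i @^-1` V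
      & <<s @open S >> (range i)].

(* Nonemptiness of the two spaces is carried by [ptopologicalType]. *)
Record mdp (R : realType) := MDP {
  state : ptopologicalType ;
  action : ptopologicalType ;
  state_borel : topological_borel_space R state ;
  action_borel : topological_borel_space R action ;
  trans : R.-pker (borel state * borel action)%type ~> borel state }.

HB.instance Definition _ (T U : ptopologicalType) :=
  Pointed.copy (T * U)%type (T * U)%type.
HB.instance Definition _ (I : Type) (T : I -> ptopologicalType) :=
  Pointed.copy (prod_topology T) (forall i, T i).

Section weak_topology.
Variable R : realType.

Definition bounded_continuous (T : topologicalType) :=
  {g : T -> R | continuous g /\ exists K : R, forall x, (`|g x| <= K)%R}.

Definition probability_integrals (T : ptopologicalType)
    (P : probability (borel T) R) : {ptws bounded_continuous T -> R} :=
  fun g => (\int[P]_x sval g x)%R.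

Definition weak_probability (T : ptopologicalType) := probability (borel T) R.

HB.instance Definition _ (T : ptopologicalType) :=
  Choice.copy (weak_probability T) (probability (borel T) R).
HB.instance Definition _ (T : ptopologicalType) :=
  Topological.copy (weak_probability T)
    (initial_topology (@probability_integrals T)).

(* A finite measure on the subspace [D] is represented by a finite measure on
   the ambient space that vanishes off [D]: [D] may be empty, whereas the
   carriers of [measurableType]s are not. *)
Record finite_measure_on (T : ptopologicalType) (D : set T) := FiniteMeasureOn {
  measure_on :> {finite_measure set (borel T) -> \bar R} ;
  measure_on_off : measure_on (~` D) = 0 }.

Definition bounded_continuous_on (T : topologicalType) (D : set T) :=
  {g : T -> R | {within D, continuous g} /\
                exists K : R, forall x, D x -> (`|g x| <= K)%R}.

Definition measure_integrals (T : ptopologicalType) (D : set T)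
    (mu : finite_measure_on D) : {ptws bounded_continuous_on D -> R} :=
  fun g => (\int[mu]_(x in D) sval g x)%R.

HB.instance Definition _ (T : ptopologicalType) (D : set T) :=
  gen_eqMixin (finite_measure_on D).
HB.instance Definition _ (T : ptopologicalType) (D : set T) :=
  gen_choiceMixin (finite_measure_on D).
HB.instance Definition _ (T : ptopologicalType) (D : set T) :=
  Topological.copy (finite_measure_on D)
    (initial_topology (@measure_integrals T D)).

End weak_topology.

Section mdp_theory.
Variables (R : realType) (M : mdp R).
Local Notation X := (state M).
Local Notation A := (action M).
Local Notation p := (@trans R M).

Definition trajectory : ptopologicalType :=
  (X * prod_topology (fun _ : nat => (A * X)%type))%type.

Definition state_at (t : nat) (w : trajectory) : X :=
  if t is s.+1 then (w.2 s).2 else w.1.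

(* The action following the state of time [t]: $A_{t+1}$. *)
Definition action_after (t : nat) (w : trajectory) : A := (w.2 t).1.

(* $(x_0,(a_1,x_1),\dots,(a_t,x_t))$ *)
Definition history (t : nat) (w : trajectory) :
    (borel X * t.-tuple (borel A * borel X))%type :=
  (w.1, [tuple w.2 i | i < t]).

(* Histories carry the product sigma-algebra; it is the Borel one, the spaces
   being second countable. [pi t] is the kernel $\pi_{t+1}$. *)
Definition strategy := forall t : nat,
  R.-pker (borel X * t.-tuple (borel A * borel X))%type ~> borel A.

(* The last two clauses are the defining identities of the conditional laws of
   $A_{t+1}$ given the history and of $X_{t+1}$ given the history and
   $A_{t+1}$. They determine [P] from [P0] and [pi], and such a [P] always
   exists (Ionescu-Tulcea), so quantifying over strategic measures is the same
   as quantifying over strategies. *)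
Definition is_strategic_measure (P0 : probability (borel X) R) (pi : strategy)
    (P : probability (borel trajectory) R) : Prop :=
  [/\ forall B : set (borel X), measurable B ->
        P (state_at 0 @^-1` B) = P0 B,
      forall t (E : set (borel X * t.-tuple (borel A * borel X)))
          (G : set (borel A)), measurable E -> measurable G ->
        P (history t @^-1` E `&` action_after t @^-1` G) =
        \int[P]_(w in history t @^-1` E) pi t (history t w) G
    & forall t
          (E : set ((borel X * t.-tuple (borel A * borel X)) * borel A))
          (G : set (borel X)), measurable E -> measurable G ->
        let E' := [set w | E (history t w, action_after t w)] in
        P (E' `&` state_at t.+1 @^-1` G) =
        \int[P]_(w in E') p (state_at t w, action_after t w) G].

Definition strategic_measures (P0 : probability (borel X) R) :
    set (weak_probability R trajectory) :=
  [set P | exists pi : strategy, is_strategic_measure P0 pi P].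

Definition semicontinuous_S : Prop :=
  compact [set: A] /\
  forall (x : X) (u : X -> R),
    measurable_fun [set: borel X] u -> (exists K : R, forall y, (`|u y| <= K)%R) ->
    continuous (fun a : A => \int[p (x, a)]_y u y)%R.

Definition semicontinuous_W : Prop :=
  compact [set: A] /\
  forall u : X -> R,
    continuous u -> (exists K : R, forall y, (`|u y| <= K)%R) ->
    continuous (fun xa : X * A => \int[p xa]_y u y)%R.

Definition semicontinuous : Prop := semicontinuous_S \/ semicontinuous_W.

Definition hitting_time (z : X) (w : trajectory) : \bar R :=
  ereal_inf [set t%:R%:E | t in [set t : nat | state_at t w = z]].

Definition absorbing (P0 : probability (borel X) R) (z : X) : Prop :=
  [/\ isolated [set: X] z,
      forall a : A, p (z, a) [set z] = 1
    & forall P, strategic_measures P0 P -> \int[P]_w hitting_time z w < +oo].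

Definition uniformly_absorbing (P0 : probability (borel X) R) (z : X) : Prop :=
  absorbing P0 z /\
  (fun n : nat => ereal_sup
    [set \int[P]_w (\sum_(n <= t <oo) if t%:R%:E < hitting_time z w then 1 else 0)
      | P in strategic_measures P0]) @ \oo --> 0.

Definition state_action (t : nat) (w : trajectory) : (X * A)%type :=
  (state_at t w, action_after t w).

(* $(\mathbf X\setminus\{0\})\times\mathbf A$ *)
Definition transient (z : X) : set (X * A) := [set xa | xa.1 <> z].

(* Summed over the time [t] of the state instead of the time [t.+1] of the
   action. *)
Definition occupation (z : X) (P : probability (borel trajectory) R)
    (G : set (borel (X * A)%type)) : \bar R :=
  \sum_(0 <= t <oo) P (state_action t @^-1` (G `&` transient z)).

Lemma continuous_borel (T U : ptopologicalType) (f : T -> U) :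
  continuous f -> measurable_fun [set: borel T] (f : borel T -> borel U).
Proof.
move=> cf; apply: (@measurability _ _ (borel T) (borel U) _ _ open) => //.
move=> _ [B oB <-]; rewrite setTI; apply: sub_sigma_algebra.
by move/continuousP: cf; exact.
Qed.

Lemma continuous_step t :
  continuous (fun w : trajectory => w.2 t).
Proof.
move=> w; apply: (@continuous_comp _ (prod_topology (fun _ : nat => (A * X)%type)) _ snd
    (@proj nat (fun _ => (A * X)%type) t)); first exact: cvg_snd.
exact: proj_continuous.
Qed.

Lemma continuous_state_at t : continuous (@state_at t).
Proof.
case: t => [|t] w; first exact: cvg_fst.
apply: (@continuous_comp _ _ _ (fun w : trajectory => w.2 t) snd);
  [exact: continuous_step|exact: cvg_snd].
Qed.

Lemma continuous_action_after t : continuous (@action_after t).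
Proof.
move=> w; apply: (@continuous_comp _ _ _ (fun w : trajectory => w.2 t) fst);
  [exact: continuous_step|exact: cvg_fst].
Qed.

Lemma continuous_state_action t : continuous (@state_action t).
Proof.
by move=> w; apply: cvg_pair; [exact: continuous_state_at
                              |exact: continuous_action_after].
Qed.

Lemma state_hausdorff : hausdorff_space X.
Proof.
have [S [i [_ _ injS openX _]]] := state_borel M.
move=> x y xy; apply: injS; apply: (@metric_hausdorff R S) => U V.
rewrite !nbhsE => -[U' [oU' U'x] UU'] [V' [oV' V'y] VV'].
have [||c [U'c V'c]] := xy (i @^-1` U') (i @^-1` V').
- by apply: open_nbhs_nbhs; split=> //; apply/openX; exists U'.
- by apply: open_nbhs_nbhs; split=> //; apply/openX; exists V'.
by exists (i c); split; [exact: UU'|exact: VV'].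
Qed.

Lemma closed_state z : closed [set z : X].
Proof. exact/accessible_closed_set1/hausdorff_accessible/state_hausdorff. Qed.

Lemma measurable_state z : measurable ([set z] : set (borel X)).
Proof.
rewrite -[X in measurable X]setCK; apply: measurableC.
by apply: sub_sigma_algebra; apply: closed_openC; exact: closed_state.
Qed.

Lemma measurable_transient z : measurable (transient z : set (borel (X * A)%type)).
Proof.
have cfst : continuous (fst : X * A -> X) by move=> ?; exact: cvg_fst.
have := continuous_borel cfst; move=> /(_ measurableT _ (measurableC (measurable_state z))).
by rewrite setTI.
Qed.

Lemma measurable_state_action t :
  measurable_fun [set: borel trajectory]
    (@state_action t : borel trajectory -> borel (X * A)%type).
Proof. exact: (continuous_borel (@continuous_state_action t)). Qed.

Lemma measurable_at_state t (G : set (borel X)) : measurable G ->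
  measurable (@state_at t @^-1` G : set (borel trajectory)).
Proof.
move=> mG; have := @continuous_borel _ _ _ (@continuous_state_at t).
by move=> /(_ measurableT _ mG); rewrite setTI.
Qed.

Section occupation_measure.
Variables (z : X) (P : probability (borel trajectory) R).

Let measurable_pre t (G : set (borel (X * A)%type)) : measurable G ->
  measurable (@state_action t @^-1` (G `&` transient z) : set (borel trajectory)).
Proof.
move=> mG; rewrite -[X in measurable X]setTI; apply: measurable_state_action => //.
exact: (measurableI _ _ mG (measurable_transient z)).
Qed.

Let occupation0 : occupation z P set0 = 0.
Proof.
by rewrite /occupation eseries0// => t _ _; rewrite set0I preimage_set0 measure0.
Qed.

Let occupation_ge0 G : 0 <= occupation z P G.
Proof. by apply: nneseries_ge0 => t _ _; exact: measure_ge0. Qed.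

Let occupation_sigma_additive : semi_sigma_additive (occupation z P).
Proof.
move=> F mF tF mUF.
rewrite [X in _ --> X](_ : _ = \sum_(n <oo) occupation z P (F n)).
  exact: is_cvg_ereal_nneg_natsum.
rewrite /occupation nneseries_interchange//.
apply: eq_eseriesr => t _; rewrite setI_bigcupl preimage_bigcup.
rewrite measure_bigcup//.
- by apply: eq_eseriesl => n; rewrite in_setT.
- by move=> n _; exact: measurable_pre.
- apply/trivIsetP => /= m n _ _ mn; rewrite -preimage_setI.
  rewrite setIACA; move/trivIsetP : tF => /(_ _ _ _ _ mn) ->//.
  by rewrite set0I preimage_set0.
Qed.

HB.instance Definition _ := isMeasure.Build _ (borel (X * A)%type) R
  (occupation z P) occupation0 occupation_ge0 occupation_sigma_additive.

Lemma occupation_off : occupation z P (~` transient z) = 0.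
Proof.
by rewrite /occupation eseries0// => t _ _; rewrite setICl preimage_set0 measure0.
Qed.

End occupation_measure.

Section occupation_finite.
Variables (P0 : probability (borel X) R) (z : X).
Hypothesis absorbing_z : absorbing P0 z.

Let last_state t (h : (borel X * t.-tuple (borel A * borel X))%type) : borel X :=
  state_at t (h.1, nth (point, h.1) h.2).

Let last_history t w : last_state (history t w) = state_at t w.
Proof.
case: t => [|t]//=; rewrite /last_state/state_at/=.
by rewrite -[t in LHS]/(val (@ord_max t)) nth_mktuple.
Qed.

Let measurable_last t : measurable_fun setT (@last_state t).
Proof.
case: t => [|t]; first exact: measurable_fst.
rewrite (_ : @last_state t.+1 = snd \o (fun s => tnth s ord_max) \o snd).
  apply: measurableT_comp; last exact: measurable_snd.
  by apply: measurableT_comp; [exact: measurable_snd|exact: measurable_tnth].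
by apply/funext => h; rewrite /last_state/= (tnth_nth (point, h.1)).
Qed.

Let null_complement (mu : {measure set (borel X) -> \bar R}) :
  mu setT = 1 -> mu [set z] = 1 -> mu (~` [set z]) = 0.
Proof.
have mz := measurable_state z; move=> mu1 muz.
have : mu [set: borel X] = mu [set z] + mu (~` [set z]).
  rewrite -(setUv ([set z] : set (borel X))).
  by apply: measureU => //; [exact: measurableC|rewrite setICr].
rewrite mu1 muz; case: (mu _) => [r||]//= [].
by move=> /eqP; rewrite addrC -subr_eq subrr => /eqP <-.
Qed.

Let no_escape P t : strategic_measures P0 P ->
  P (state_at t @^-1` [set z] `&` state_at t.+1 @^-1` (~` [set z])) = 0.
Proof.
case: absorbing_z => _ pz _ [pi [_ _ HP]].
have mz := measurable_state z.
pose E := (@last_state t \o fst) @^-1` [set z] :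
  set ((borel X * t.-tuple (borel A * borel X)) * borel A).
have mE : measurable E.
  rewrite -[X in measurable X]setTI.
  by apply: (measurableT_comp (@measurable_last t) measurable_fst).
have := HP t E _ mE (measurableC mz).
rewrite (_ : [set w | _] = state_at t @^-1` [set z]); last first.
  by apply/funext => w; rewrite /E/= last_history.
move=> /= ->; apply: integral0_eq => w ->.
have p1 : p (z, action_after t w) [set: borel X] = 1 by exact: prob_kernel.
exact: (null_complement p1 (pz _)).
Qed.

Lemma hitting_timeE w : hitting_time z w =
  einfs (fun t => if state_at t w == z then t%:R%:E else +oo) 0%N.
Proof.
apply/eqP; rewrite eq_le; apply/andP; split.
- apply: le_ereal_inf_tmp => _ [t _ <-]; case: eqP => [tz|]; last by rewrite leey.
  by apply: ereal_inf_lbound; exists t.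
- apply: le_ereal_inf_tmp => _ [t /= tz <-].
  by apply: ereal_inf_lbound; exists t => //=; rewrite tz eqxx.
Qed.

Lemma measurable_hitting_time :
  measurable_fun [set: borel trajectory]
    (hitting_time z : borel trajectory -> \bar R).
Proof.
rewrite (funext hitting_timeE); apply: measurable_fun_einfs => t.
apply: measurable_fun_ifT => //.
apply: (measurable_fun_bool true).
rewrite setTI (_ : _ @^-1` _ = state_at t @^-1` [set z]).
  exact: (measurable_at_state t (measurable_state z)).
by apply/funext => w/=; apply/propext; split => [/eqP|->//]; rewrite ?eqxx.
Qed.

Lemma lt_hitting_time t w :
  (t%:R%:E < hitting_time z w) <-> (forall s, (s <= t)%N -> state_at s w <> z).
Proof.
split=> [tT s st sz|tw].
- move: tT; apply/negP; rewrite -leNgt.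
  apply: (@le_trans _ _ s%:R%:E); last by rewrite lee_fin ler_nat.
  by apply: ereal_inf_lbound; exists s.
- apply: (@lt_le_trans _ _ t.+1%:R%:E); first by rewrite lte_fin ltr_nat.
  apply: le_ereal_inf_tmp => _ [s /= sz <-]; rewrite lee_fin ler_nat ltnNge.
  by apply/negP => /tw.
Qed.

Let before t : set (borel trajectory) := [set w | t%:R%:E < hitting_time z w].

Let measurable_before t : measurable (before t).
Proof.
rewrite -[X in measurable X]setTI; apply: emeasurable_fun_o_infty => //.
exact: measurable_hitting_time.
Qed.

Let transient_le P t : strategic_measures P0 P ->
  P (state_at t @^-1` (~` [set z])) <= P (before t).
Proof.
move=> HP; have mz := measurable_state z.
pose escape s : set (borel trajectory) :=
  state_at s @^-1` [set z] `&` state_at s.+1 @^-1` (~` [set z]).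
have mescape s : measurable (escape s).
  apply: measurableI; first exact: (measurable_at_state s mz).
  exact: (measurable_at_state s.+1 (measurableC mz)).
pose N := \bigcup_s escape s.
have mN : measurable N by exact: bigcupT_measurable.
have N0 : P N = 0.
  apply: (measure_negligible mN); apply: negligible_bigcup => s.
  exact: ((negligibleP P (mescape s)).2 (no_escape s HP)).
have sub : state_at t @^-1` (~` [set z]) `<=` before t `|` N.
  move=> w /= wt; have [tT|] := pselect (t%:R%:E < hitting_time z w).
    by left.
  rewrite lt_hitting_time => /existsNP[s /not_implyP[st /contrapT sz]]; right.
  suff [r [rz rz']] : exists r, state_at r w = z /\ state_at r.+1 w <> z.
    by exists r.
  apply/not_existsP => stay; apply: wt.
  rewrite -(subnKC st); elim: (t - s)%N => [|k ih]; first by rewrite addn0.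
  by rewrite addnS; apply: contrapT => kz; apply: (stay (s + k)%N).
apply: (@le_trans _ _ (P (before t `|` N))).
  apply: le_measure; rewrite ?inE//.
  - exact: (measurable_at_state t (measurableC mz)).
  - exact: measurableU.
have -> : P (before t) = P (before t) + P N by rewrite N0 adde0.
exact: measureU2.
Qed.

Let sum_before w :
  \sum_(0 <= t <oo) (\1_(before t) w)%:E <= hitting_time z w :> \bar R.
Proof.
apply: le_ereal_inf_tmp => _ [k /= kz <-].
rewrite (@nneseries_split _ _ 0 k)//.
rewrite add0n eseries0 ?adde0; last first.
  move=> t kt _; rewrite indicE memNset//= => /lt_hitting_time /(_ _ kt).
  exact.
rewrite sumEFin lee_fin (@le_trans _ _ (\sum_(0 <= t < k) 1)%R)//.
  by apply: ler_sum => t _; rewrite indicE lern1 leq_b1.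
by rewrite big_const_nat subn0 iter_addr addr0.
Qed.

Lemma occupation_lty P : strategic_measures P0 P ->
  occupation z P setT < +oo.
Proof.
move=> HP; have [_ _ /(_ P HP)] := absorbing_z; apply: le_lt_trans.
have m1 t : measurable_fun [set: borel trajectory]
    (fun w : borel trajectory => (\1_(before t) w)%:E : \bar R).
  by apply/measurable_EFinP; apply: measurable_indic.
apply: (@le_trans _ _ (\int[P]_w \sum_(t <oo) (\1_(before t) w)%:E)); last first.
  apply: ge0_le_integral => //=.
  - by move=> w _; apply: nneseries_ge0 => t _ _; rewrite lee_fin.
  - by apply: ge0_emeasurable_sum => // t w _ _; rewrite lee_fin.
  - exact: measurable_hitting_time.
rewrite integral_nneseries//.
apply: lee_nneseries => [t _ _|t _]; first exact: measure_ge0.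
rewrite integral_indic// setIT setTI; exact: transient_le.
Qed.

Lemma occupation_fin P : strategic_measures P0 P ->
  fin_num_fun (occupation z P).
Proof.
move=> HP; apply: lty_fin_num_fun; exact: occupation_lty.
Qed.

End occupation_finite.

Section projection.
Variables (P0 : probability (borel X) R) (z : X).
Hypothesis absorbing_z : absorbing P0 z.

(* [occupation] restricted to strategic measures, where it is finite. *)
Definition finite_occupation (P : set_type (strategic_measures P0))
    (G : set (borel (X * A)%type)) : \bar R := occupation z (set_val P) G.

HB.instance Definition _ P := Measure.copy (finite_occupation P)
  (occupation z (set_val P)).

HB.instance Definition _ P := Measure_isFinite.Build _ _ _ (finite_occupation P)
  (occupation_fin absorbing_z (set_valP P)).

Definition occupation_measure (P : set_type (strategic_measures P0)) :
    finite_measure_on R (transient z) :=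
  @FiniteMeasureOn R _ (transient z) (finite_occupation P)
    (occupation_off z (set_val P)).

Definition occupation_measures : set (finite_measure_on R (transient z)) :=
  range occupation_measure.

Definition projection (P : set_type (strategic_measures P0)) :
    set_type occupation_measures :=
  exist _ (occupation_measure P) (mem_set (imageT occupation_measure P)).

End projection.

End mdp_theory.

(* Main.v *)
(* Write [f_n P] for the tail [sum_(t >= n) P (X_t <> z)]; it equals the expected
   tail of the hitting time, and [f_0 P] is the total mass of the occupation
   measure. For [g] bounded continuous, [g] times the indicator of [x <> z] is
   continuous since [z] is isolated, so [P |-> int g d(eta_P)] is the series of
   the weakly continuous maps [P |-> int g(X_t, A_(t+1)) 1_(X_t <> z) dP], with
   remainder at most [sup |g| f_n P]: uniform absorption makes the convergence
   uniform and the projection continuous. Conversely, if [f_n (P_n) > eps] for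
   all [n], let [P_n] converge weakly to a strategic [Q] along an ultrafilter; by
   continuity of the projection every [f_m = f_0 - sum_(t < m) P (X_t <> z)]
   passes to the limit, whence [f_m Q >= eps] for all [m], contradicting
   [f_m Q --> 0].

   The weak compactness used here is obtained by building [Q] one coordinate at a
   time, keeping [Q O <= lim P_n O] for the sets [O] that are open in countably
   many features of the first coordinates. Under (S) the features of the states
   are chosen finer than the topology. A state coordinate is added by the
   transition kernel, semicontinuity being what preserves the inequality. An
   action coordinate is added by a kernel obtained from the limits of [P_n] on
   cells by the Radon-Nikodym theorem, compactness of the action space being what
   allows one to decode its cells. *)
Require Import Defs.
From HB Require Import structures.
From mathcomp Require Import all_boot all_order all_algebra.
From mathcomp Require Import all_classical all_reals all_analysis.
From mathcomp Require Import measurable_realfun lra.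

Set Implicit Arguments.
Unset Strict Implicit.
Unset Printing Implicit Defensive.
Import Order.TTheory GRing.Theory Num.Theory.
Import numFieldNormedType.Exports.

Local Open Scope classical_set_scope.
Local Open Scope ring_scope.
Local Open Scope ereal_scope.

(** * Coin sequences and noise kernels *)

(** A limit of measures along an ultrafilter is only finitely additive, and the state space is not
    compact, so [Q] is not obtained by extending the limits of [P_n]. It is composed of genuine
    kernels, and only the one-sided inequality on open sets is carried along. The induction starts
    from an equality, since all [P_n] share the initial law; this is why state features that are
    merely measurable are admissible, as (S) demands: there the transition law need not be
    continuous in the state. For an action coordinate the inequality must become an equality on
    cells. The levels defining the bits are shifted so that no level of a feature carries [Q]-mass;
    both set functions have total mass 1 and are additive when a cell is split, so one inequality
    per cell forces equality. At the end, the inequality applied to a continuous function and to its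
    complement to 1 yields convergence of integrals. An ultrafilter replaces subsequences, so that
    all the limits involved exist at once. *)

Lemma measurable_preimage d d' (T : measurableType d) (U : measurableType d')
    (f : T -> U) (B : set U) :
  measurable_fun setT f -> measurable B -> measurable (f @^-1` B).
Proof. by move=> mf mB; rewrite -[X in measurable X]setTI; exact: mf. Qed.

Section coin.

(* Words are stored last letter first, so that refining a cylinder conses. *)
Fixpoint prefix_of (b : nat -> bool) (n : nat) : seq bool :=
  if n is m.+1 then b m :: prefix_of b m else [::].

Definition cylinder (s : seq bool) : set (nat -> bool) :=
  [set b | prefix_of b (size s) = s].

Definition coin := g_sigma_algebraType (range cylinder).

Lemma size_prefix_of b n : size (prefix_of b n) = n.
Proof. by elim: n => //= n ->. Qed.

Lemma drop_prefix_of b m n : drop n (prefix_of b (n + m)) = prefix_of b m.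
Proof. by elim: n => [|n ih]; rewrite ?drop0//= ih. Qed.

Lemma prefix_ofP b b' n :
  (forall i, (i < n)%N -> b i = b' i) <-> prefix_of b n = prefix_of b' n.
Proof.
split; elim: n => [//|n ih] bb' /=.
  by rewrite bb'// ih// => i ni; apply: bb'; rewrite ltnS ltnW.
case: bb' => bn /ih bb' i; rewrite ltnS leq_eqVlt => /orP[/eqP->//|]; exact: bb'.
Qed.

Lemma cylinder_prefix_of b n : cylinder (prefix_of b n) b.
Proof. by rewrite /cylinder/= size_prefix_of. Qed.

Lemma cylinder_nil : cylinder [::] = setT.
Proof. by apply/seteqP; split. Qed.

Lemma cylinder_split s : cylinder s = cylinder (false :: s) `|` cylinder (true :: s).
Proof.
apply/seteqP; split => b; rewrite /cylinder/=.
  by move=> e; case bs : (b (size s)); [right|left]; rewrite e.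
by move=> [[_]|[_]].
Qed.

Lemma cylinder_disjoint s : cylinder (false :: s) `&` cylinder (true :: s) = set0.
Proof. by apply/seteqP; split => // b [[/= bf _] [bt _]]; rewrite bf in bt. Qed.

Lemma measurable_cylinder s : measurable (cylinder s : set coin).
Proof. by apply: sub_sigma_algebra; exists s. Qed.

Lemma measurable_prefix n (W : set (seq bool)) :
  measurable ([set b | W (prefix_of b n)] : set coin).
Proof.
rewrite (_ : [set b | _] =
    \bigcup_s (if `[< W s /\ size s = n >] then cylinder s else set0)).
  apply: countable_bigcupT_measurable => [|s]; first exact: countableP.
  by case: ifP => _; [exact: measurable_cylinder|exact: measurable0].
apply/seteqP; split => [b Wb|b [s _]].
  exists (prefix_of b n) => //; rewrite size_prefix_of.
  by case: ifPn => [_|/asboolPn[]//]; exact: cylinder_prefix_of.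
by case: ifPn => // /asboolP[Ws <-]; rewrite /cylinder/= => ->.
Qed.

Lemma measurable_to_coin d (T : measurableType d) (f : T -> coin) :
  (forall s, measurable (f @^-1` cylinder s)) -> measurable_fun setT f.
Proof.
move=> mf; apply: (@measurability _ _ T coin setT f (range cylinder)) => // _ [_ [s _ <-] <-].
by rewrite setTI; exact: mf.
Qed.

Lemma measurable_to_coin_bits d (Z : measurableType d) (f : Z -> coin) :
  (forall n, measurable [set z | f z n]) -> measurable_fun setT f.
Proof.
move=> mf; apply: measurable_to_coin; elim=> [|x s ih].
  by rewrite cylinder_nil preimage_setT.
rewrite (_ : _ @^-1` _ = f @^-1` cylinder s `&`
    (if x then [set y | f y (size s)] else ~` [set y | f y (size s)])); last first.
  apply/seteqP; split => y; rewrite /cylinder/=.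
    by move=> [<- ->]; split => //; case: ifPn => //= /negP.
  by move=> [-> +]; case: x => /= [->//|/negP/negbTE->].
by apply: measurableI => //; case: x => //; exact: measurableC.
Qed.

Lemma measurable_bit d (Z : measurableType d) (f : Z -> coin) n :
  measurable_fun setT f -> measurable [set z | f z n].
Proof.
move=> mf; have := measurable_preimage mf (measurable_prefix n.+1 (fun s => head false s)).
by congr (measurable _); apply/seteqP; split.
Qed.

(** Two cylinders are nested or disjoint, so adding the empty set already gives a pi-system. *)
Lemma setI_cylinder : setI_closed (range cylinder `|` [set set0]).
Proof.
move=> A B; wlog: A B / exists s t, [/\ A = cylinder s, B = cylinder t & (size s <= size t)%N].
  move=> H [[s _ <-]|->]; last by rewrite set0I; right.
  move=> [[t _ <-]|->]; last by rewrite setI0; right.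
  have [st|/ltnW st] := leqP (size s) (size t).
    by apply: H; [exists s, t|left; exists s|left; exists t].
  by rewrite setIC; apply: H; [exists t, s|left; exists t|left; exists s].
move=> [s [t [-> -> st]]] _ _.
have dr b : cylinder t b -> prefix_of b (size s) = drop (size t - size s) t.
  by rewrite /cylinder/= => tb; rewrite -{2}tb -{2}(subnK st) drop_prefix_of.
have [e|e] := eqVneq (drop (size t - size s) t) s.
  left; exists t => //; apply/seteqP; split => b; last by case.
  by move=> tb; split => //; rewrite /cylinder/= dr.
right; apply/seteqP; split => // b [sb /dr tb]; move: e.
by rewrite -tb sb eqxx.
Qed.

Lemma coin_measure_unique (R : realType) (m1 m2 : {measure set coin -> \bar R}) :
  m1 setT < +oo -> (forall s, m1 (cylinder s) = m2 (cylinder s)) ->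
  forall A, measurable A -> m1 A = m2 A.
Proof.
move=> m1oo m12 A mA.
apply: (@g_sigma_algebra_measure_unique _ R coin (range cylinder `|` [set set0]) _
  (fun=> setT)) => //.
- move=> _ [[s _ <-]|->]; [exact: measurable_cylinder|exact: measurable0].
- by move=> _; left; exists [::] => //; exact: cylinder_nil.
- by rewrite bigcup_const//; exists 0%N.
- exact: setI_cylinder.
- by move=> _ [[s _ <-]|->]; rewrite ?measure0.
- by apply: (@sub_sigma_algebra2 _ _ _ (range cylinder)) mA => B; left.
Qed.

End coin.

(* A consistent family of masses [w] cuts [[0, w [::]) into nested half-open
   intervals, one per word; [branch w u] reads off the intervals containing
   [u], so that it carries Lebesgue measure to the measure with masses [w]. *)
Section branch.
Variable R : realType.
Implicit Types (w : seq bool -> R) (u : R) (s : seq bool).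

Fixpoint low w s : R :=
  if s is x :: s' then (low w s' + (if x then w (false :: s') else 0))%R else 0%R.

Fixpoint walk w u (n : nat) : seq bool :=
  if n is m.+1 then (low w (true :: walk w u m) <= u)%R :: walk w u m else [::].

Definition branch w u : coin := fun n => (low w (true :: walk w u n) <= u)%R.

Definition consistent w := (forall s, (0 <= w s)%R) /\
  (forall s, w s = w (false :: s) + w (true :: s))%R.

Lemma prefix_branch w u n : prefix_of (branch w u) n = walk w u n.
Proof. by elim: n => //= n ->. Qed.

(** Each new letter compares [u] with the left end of the [true] half of the current interval, so
    the walk never leaves the interval of its word. *)
Lemma walkP w u s : consistent w -> (0 <= u < w [::])%R ->
  walk w u (size s) = s <-> (low w s <= u < low w s + w s)%R.
Proof.
move=> [w0 wD] u0; elim: s => [|x s ih]; first by rewrite /= add0r u0.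
have wDs := wD s; have wf := w0 (false :: s); have wt := w0 (true :: s).
split => [[+ e]|].
  rewrite e; have /ih := e; move=> /andP[lo hi] /=; rewrite wDs in hi.
  by case: x => h; rewrite ?h/=; rewrite ?addr0 ?lo/= ?ltNge ?h// -ltNge -addrA.
move=> /= /andP[lo hi].
have /ih -> : (low w s <= u < low w s + w s)%R.
  rewrite wDs; case: x lo hi => lo hi; apply/andP; split.
  - by apply: le_trans lo; rewrite lerDl.
  - by rewrite addrA.
  - by rewrite addr0 in lo.
  - by apply: (lt_le_trans hi); rewrite addr0 lerD2l lerDl.
congr cons; case: x lo hi => // lo; rewrite addr0 => hi.
by apply/negbTE; rewrite -ltNge.
Qed.

Lemma branch_cylinder w s : consistent w ->
  [set u | (0 <= u < w [::])%R] `&` branch w @^-1` cylinder s =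
  [set` `[low w s, low w s + w s[%R].
Proof.
move=> cw.
have sub u : (low w s <= u < low w s + w s)%R -> (0 <= u < w [::])%R.
  case: cw => w0 wD; elim: s => [|x s ih]; first by rewrite /= add0r.
  have wDs := wD s; have wf := w0 (false :: s); have wt := w0 (true :: s).
  move=> /= /andP[lo hi]; apply: ih; rewrite wDs; case: x lo hi => lo hi.
    by rewrite (le_trans _ lo)/= ?lerDl// addrA.
  by rewrite addr0 in lo hi; rewrite lo/= (lt_le_trans hi)// lerD2l lerDl.
apply/seteqP; split => u /=; rewrite in_itv/= /cylinder/= prefix_branch.
  by move=> [u0 /walkP]; exact.
by move=> su; have u0 := sub _ su; split => //; apply/walkP.
Qed.

(** Joint measurability in the parameter and the noise is what later makes random branches into
    kernels. *)
Lemma measurable_branch d (Z : measurableType d) (w : Z -> seq bool -> R) :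
  (forall s, measurable_fun setT (w ^~ s)) ->
  measurable_fun setT (fun zu : Z * measurableTypeR R => branch (w zu.1) zu.2).
Proof.
move=> mw; have mlow s : measurable_fun setT (fun z => low (w z) s).
  elim: s => [|x s ih]/=; first exact: measurable_cst.
  by apply: measurable_funD => //; case: x => //; exact: measurable_cst.
apply: measurable_to_coin => s.
rewrite (_ : _ @^-1` _ = [set zu | walk (w zu.1) zu.2 (size s) = s]); last first.
  by apply/seteqP; split => zu /=; rewrite /cylinder/= prefix_branch.
elim: s => [|x s ih]; first by rewrite (_ : mkset _ = setT)//; exact/seteqP.
pose E := [set zu : Z * measurableTypeR R | (low (w zu.1) (true :: s) <= zu.2)%R].
have mE : measurable E.
  rewrite -[E]setTI; apply: (@measurable_fun_ler _ _ _ setT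
    (fun zu : Z * measurableTypeR R => low (w zu.1) (true :: s)) snd _ _ measurableT [set true]) => //.
  exact: (measurableT_comp (mlow (true :: s))).
rewrite (_ : mkset _ = [set zu | walk (w zu.1) zu.2 (size s) = s] `&`
    (if x then E else ~` E)); last first.
  apply/seteqP; split => -[z u] /=.
    move=> [+ e]; rewrite e; split => //.
    by case: x H => [h|/negbT/negP h]; rewrite /E.
  move=> [-> h]; congr cons; case: x h => // /negP/negbTE; exact.
by apply: measurableI => //; case: x => //; exact: measurableC.
Qed.

Lemma measurable_branch1 w : measurable_fun setT (branch w : measurableTypeR R -> coin).
Proof.
have mb := @measurable_branch _ (measurableTypeR R) (fun=> w) (fun s => measurable_cst _).
rewrite (_ : branch w = (fun zu : measurableTypeR R * measurableTypeR R => branch w zu.2) \o (fun u => (u, u)))//.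
by apply: measurableT_comp => //; exact: measurable_fun_pair.
Qed.

Definition unit_below (c : R) : set (measurableTypeR R) := [set` `[0%R, c[].

Lemma measurable_unit_below c : measurable (unit_below c).
Proof. exact: measurable_itv. Qed.

(** The length [c] is left free because limit masses of words define measures on [coin] of total
    mass possibly below 1; the noise of kernels is the case [c = 1]. *)
Definition unit_noise (c : R) : set (measurableTypeR R) -> \bar R :=
  mrestr (@lebesgue_measure R) (measurable_unit_below c).

HB.instance Definition _ c := Measure.copy (unit_noise c)
  (mrestr (@lebesgue_measure R) (measurable_unit_below c)).

Definition branch_law w : set coin -> \bar R :=
  pushforward (unit_noise (w [::])) (branch w).

Let branch_law0 w : branch_law w set0 = 0.
Proof. exact: (measure0 (unit_noise (w [::]))). Qed.

Let branch_law_ge0 w A : 0 <= branch_law w A.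
Proof. exact: (measure_ge0 (unit_noise (w [::]))). Qed.

Let branch_law_sigma_additive w : semi_sigma_additive (branch_law w).
Proof.
have := @measurable_branch1 w; rewrite /branch_law => mb.
exact: (@measure_semi_sigma_additive _ _ _ (pushforward (unit_noise (w [::])) (branch w))).
Qed.

HB.instance Definition _ w := isMeasure.Build _ _ _ (branch_law w)
  (branch_law0 w) (branch_law_ge0 w) (@branch_law_sigma_additive w).

Lemma branch_law_cylinder w s : consistent w -> branch_law w (cylinder s) = (w s)%:E.
Proof.
move=> cw; rewrite /branch_law/pushforward/unit_noise/mrestr.
rewrite setIC (_ : _ `&` _ = [set u | (0 <= u < w [::])%R] `&` branch w @^-1` cylinder s).
  rewrite branch_cylinder// lebesgue_measure_itv/= lte_fin ltrDl.
  case: ltP => [_|]; first by rewrite -EFinB addrAC subrr add0r.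
  by case: cw => + _ => /(_ s) w0 ws; congr EFin; apply/eqP; rewrite eq_le w0.
by congr (_ `&` _); apply/seteqP; split => u; rewrite /unit_below/= in_itv.
Qed.

Let branch_law_fin w : fin_num_fun (branch_law w).
Proof.
move=> A mA; rewrite ge0_fin_numE ?measure_ge0//.
apply: (@le_lt_trans _ _ (lebesgue_measure (unit_below (w [::])))).
  apply: le_measure; [apply/mem_set|apply/mem_set|exact: subIsetr].
    apply: measurableI; last exact: measurable_unit_below.
    exact: (measurable_preimage (@measurable_branch1 w)).
  exact: measurable_unit_below.
rewrite /unit_below lebesgue_measure_itv/=; case: ifP => _; last exact: ltry.
by rewrite -EFinB ltry.
Qed.

HB.instance Definition _ w := Measure_isFinite.Build _ _ _ (branch_law w)
  (@branch_law_fin w).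

Definition unit_uniform := unit_noise 1.

HB.instance Definition _ := Measure.on unit_uniform.

Let unit_uniformT : unit_uniform setT = 1.
Proof.
by rewrite /unit_uniform/unit_noise/mrestr setTI /unit_below lebesgue_measure_itv/=
  lte_fin ltr01 oppr0 adde0.
Qed.

HB.instance Definition _ := Measure_isProbability.Build _ _ _ unit_uniform unit_uniformT.

End branch.

Section noise_kernel.
Context d d' (Z : measurableType d) (T : measurableType d') (R : realType).
Variables (f : Z * measurableTypeR R -> T) (mf : measurable_fun setT f).

Definition noise_kernel (z : Z) (A : set T) : \bar R :=
  @unit_uniform R [set u | A (f (z, u))].

Let kernel0 z : noise_kernel z set0 = 0.
Proof. by rewrite /noise_kernel measure0. Qed.

Let kernel_ge0 z A : 0 <= noise_kernel z A.
Proof. exact: measure_ge0. Qed.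

Let mf1 z : measurable_fun setT (fun u => f (z, u)).
Proof. by apply: (measurableT_comp mf); exact: measurable_pair1. Qed.

Let kernel_sigma_additive z : semi_sigma_additive (noise_kernel z).
Proof.
have := @mf1 z => mz.
exact: (@measure_semi_sigma_additive _ _ _ (pushforward (@unit_uniform R) (fun u => f (z, u)))).
Qed.

HB.instance Definition _ z := isMeasure.Build _ _ _ (noise_kernel z)
  (kernel0 z) (kernel_ge0 z) (@kernel_sigma_additive z).

Definition noise_mkernel : Z -> {measure set T -> \bar R} := noise_kernel.

Let kernel_measurable U : measurable U -> measurable_fun setT (noise_mkernel ^~ U).
Proof.
move=> mU; rewrite /noise_mkernel/noise_kernel/=.
have mfU := measurable_preimage mf mU.
have := measurable_fun_xsection (@unit_uniform R) mfU.
by apply: eq_measurable_fun => z _; congr unit_uniform; apply/seteqP; split => u;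
  rewrite /xsection/= inE.
Qed.

HB.instance Definition _ := isKernel.Build _ _ _ _ _ noise_mkernel kernel_measurable.

Let kernel_setT z : noise_mkernel z setT = 1.
Proof. exact: (@probability_setT _ _ _ (@unit_uniform R)). Qed.

HB.instance Definition _ := Kernel_isProbability.Build _ _ _ _ _ noise_mkernel kernel_setT.

Definition noise_pker : R.-pker Z ~> T := noise_mkernel.

End noise_kernel.

(** * Countable families of features *)

(* A sequence [phi] of [[0,1]]-valued functions on [T] is thought of as an
   embedding into the Hilbert cube; [fopen] is the induced topology. *)
Section features.
Context (R : realType) (T : Type) (phi : nat -> T -> R).
Implicit Types (O : set T) (x y z : T) (M : nat).

(** One index bounds both the number of features compared and the tolerance, so that neighborhoods
    form a sequence. *)
Definition near_by M x : set T :=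
  [set y | forall i, (i < M)%N -> (`|phi i x - phi i y| < M.+1%:R^-1)%R].

Definition fopen O := forall x, O x -> exists M, near_by M x `<=` O.

Lemma near_by_refl M x : near_by M x x.
Proof. by move=> i _; rewrite subrr normr0 invr_gt0 ltr0n. Qed.

Lemma near_by_sym M x y : near_by M x y -> near_by M y x.
Proof. by move=> xy i /xy; rewrite distrC. Qed.

Lemma near_by_le M N x : (M <= N)%N -> near_by N x `<=` near_by M x.
Proof.
move=> MN y xy i iM; apply: (lt_le_trans (xy i (leq_trans iM MN))).
by rewrite lef_pV2 ?posrE ?ltr0n// ler_nat.
Qed.

(** The radius at index [M.*2.+1] is exactly half the radius at index [M]. *)
Lemma near_by_triangle M x y z :
  near_by M.*2.+1 x y -> near_by M.*2.+1 y z -> near_by M x z.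
Proof.
move=> xy yz i iM; have i2M : (i < M.*2.+1)%N.
  by rewrite ltnS ltnW// (leq_trans iM)// -addnn leq_addr.
rewrite -(subrKA (phi i y)) (le_lt_trans (ler_normD _ _))//.
have -> : (M.+1%:R^-1 = M.*2.+2%:R^-1 + M.*2.+2%:R^-1 :> R)%R.
  rewrite (_ : M.*2.+2 = (2 * M.+1)%N); last by rewrite mul2n.
  by rewrite natrM invfM; move: (M.+1%:R^-1 : R)%R => a; lra.
by rewrite ltrD// ?xy ?yz.
Qed.

Lemma fopenT : fopen setT. Proof. by move=> x _; exists 0%N. Qed.

Lemma fopenI O O' : fopen O -> fopen O' -> fopen (O `&` O').
Proof.
move=> oO oO' x [/oO[M MO] /oO'[M' MO']]; exists (maxn M M') => y xy; split.
  by apply/MO/(near_by_le (leq_maxl _ _) xy).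
by apply/MO'/(near_by_le (leq_maxr _ _) xy).
Qed.

Lemma fopen_interior O : fopen [set x | exists M, near_by M x `<=` O].
Proof.
move=> x [M MO]; exists M.*2.+1 => y xy; exists M.*2.+1 => z yz; apply: MO.
exact: near_by_triangle xy yz.
Qed.

(* The shift [delta] lets the levels avoid the atoms of the features. *)
Definition fbits (delta : R) (x : T) : nat -> bool := fun n =>
  if unpickle n is Some (i, q) then (delta + ratr q < phi i x)%R else false.

Hypothesis phi01 : forall i x, (0 <= phi i x <= 1)%R.

(** Values at distance at least [e] are separated by some level of a grid of mesh below [e];
    finitely many levels suffice because features take values in the unit interval. *)
Lemma fbits_separate delta i (e : R) : (0 < e)%R -> exists n, forall x y,
  prefix_of (fbits delta x) n = prefix_of (fbits delta y) n ->
  (`|phi i x - phi i y| < e)%R.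
Proof.
move=> e0.
have [N Ne] : exists N : nat, (N.+1%:R^-1 < e)%R.
  exists (Num.truncn e^-1); rewrite invf_plt ?posrE ?ltr0n//.
  by rewrite truncnS_gt.
(* With this [b] the grid from [-b] to [b], shifted by [delta], still covers the unit interval. *)
have [b bd] : exists b : nat, (`|delta| + 2 < b%:R)%R.
  by exists (Num.truncn (`|delta| + 2)).+1; rewrite truncnS_gt.
pose q (k : nat) : rat := (k%:R / N.+1%:R - b%:R)%R.
have qE k : ratr (q k) = (k%:R / N.+1%:R - b%:R :> R)%R.
  by rewrite rmorphB/= fmorph_div/= !ratr_nat.
pose K := (b * N.+1).*2.
exists (\max_(k < K) pickle (i, q k)).+1.
have key x y : prefix_of (fbits delta x) (\max_(k < K) pickle (i, q k)).+1 =
    prefix_of (fbits delta y) (\max_(k < K) pickle (i, q k)).+1 ->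
    (phi i x - phi i y < e)%R.
  move=> /prefix_ofP xy; rewrite ltNge; apply/negP => exy.
  have [d1 d2] : (- b%:R < delta - 2 /\ delta + 2 < b%:R)%R.
    by have := ler_norm delta; have := ler_norm (- delta)%R; rewrite normrN; lra.
  have /andP[y0 _] := phi01 i y; have /andP[_ x1] := phi01 i x.
  have N0 : (0 < N.+1%:R :> R)%R by rewrite ltr0n.
  (* [t] is the position of [phi i y] on the grid. The next level lies above [phi i y] and, the mesh
     being below [e], below [phi i x]. *)
  pose t := ((phi i y - delta + b%:R) * N.+1%:R)%R.
  have t0 : (0 <= t)%R by rewrite mulr_ge0 ?ler0n//; lra.
  have /andP[kt tk] := truncn_itv t0.
  set k := Num.truncn t in kt tk.
  have tyE : (t / N.+1%:R = phi i y - delta + b%:R)%R by rewrite mulfK// gt_eqF.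
  have h1 : (phi i y < delta + ratr (q k.+1))%R.
    rewrite qE; have : (t / N.+1%:R < k.+1%:R / N.+1%:R)%R by rewrite ltr_pM2r ?invr_gt0.
    by rewrite tyE; move: (k.+1%:R / N.+1%:R)%R => a; lra.
  have h2 : (delta + ratr (q k.+1) < phi i x)%R.
    rewrite qE -natr1 mulrDl mul1r.
    have : (k%:R / N.+1%:R <= t / N.+1%:R)%R by rewrite ler_pM2r ?invr_gt0.
    rewrite tyE; move: (k%:R / N.+1%:R)%R => a.
    by move: (N.+1%:R^-1)%R Ne => c; lra.
  have kK : (k.+1 < K)%N.
    rewrite -(ltr_nat R) /K -addnn natrD natrM -natr1.
    have N1 : (1 <= N.+1%:R :> R)%R by rewrite ler1n.
    have : (t < (b%:R + b%:R - 1) * N.+1%:R)%R by rewrite ltr_pM2r//; lra.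
    move: (N.+1%:R)%R N1 kt => c c1; move: (k%:R)%R => l kt.
    by rewrite mulrBl mulrDl; lra.
  have : fbits delta x (pickle (i, q k.+1)) = fbits delta y (pickle (i, q k.+1)).
    by apply: xy; rewrite ltnS; exact: (@leq_bigmax _ (fun k : 'I_K => pickle (i, q k)) (Ordinal kK)).
  by rewrite /fbits pickleK h2 ltNge (ltW h1).
move=> x y xy; rewrite ltr_norml; apply/andP; split; last exact: key.
by have := key _ _ (esym xy); lra.
Qed.

Lemma fbits_near_by delta M : exists n, forall x y,
  prefix_of (fbits delta x) n = prefix_of (fbits delta y) n -> near_by M x y.
Proof.
have e0 : (0 < M.+1%:R^-1 :> R)%R by rewrite invr_gt0 ltr0n.
have /choice[f fP] := fun i => fbits_separate delta i e0.
exists (\max_(i < M) f i) => x y xy i iM; apply: fP.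
apply/prefix_ofP => j ji; move/prefix_ofP : xy; apply.
apply: (leq_trans ji); exact: (@leq_bigmax _ (fun i : 'I_M => f i) (Ordinal iM)).
Qed.

Lemma fopen_cell delta O x : fopen O -> O x -> exists n,
  forall y, prefix_of (fbits delta x) n = prefix_of (fbits delta y) n -> O y.
Proof.
move=> oO /oO[M MO]; have [n nM] := fbits_near_by delta M.
by exists n => y /nM /MO.
Qed.

End features.

Section measurable_features.
Context d (R : realType) (T : measurableType d) (phi : nat -> T -> R).
Hypothesis phi01 : forall i x, (0 <= phi i x <= 1)%R.
Hypothesis mphi : forall i, measurable_fun setT (phi i).

Lemma measurable_fbits delta : measurable_fun setT (fbits phi delta : T -> coin).
Proof.
apply: measurable_to_coin_bits => n.
rewrite /fbits; case: unpickle => [[i q]|]; last first.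
  by rewrite (_ : mkset _ = set0)//; apply/seteqP; split.
have := measurable_fun_ltr (measurable_cst (delta + ratr q)%R) (mphi i).
by move=> /(_ measurableT [set true] Logic.I); rewrite setTI.
Qed.

(** By [fopen_cell] the set is the union of the bit cells that it contains, and there are only
    countably many words. *)
Lemma measurable_fopen O : fopen phi O -> measurable O.
Proof.
move=> oO; rewrite (_ : O = fbits phi 0 @^-1`
    (\bigcup_s if `[< fbits phi 0 @^-1` cylinder s `<=` O >] then cylinder s else set0)).
  apply: (@measurable_preimage _ _ T coin); first exact: measurable_fbits.
  apply: countable_bigcupT_measurable => [|s]; first exact: countableP.
  by case: ifP => _; [exact: measurable_cylinder|exact: measurable0].
apply/seteqP; split => x.
  move=> Ox; have [n nO] := fopen_cell phi01 0 oO Ox.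
  exists (prefix_of (fbits phi 0 x) n) => //.
  case: ifPn => [_|/asboolP[]]; first exact: cylinder_prefix_of.
  by move=> y; rewrite /cylinder/= size_prefix_of => /esym/nO.
by move=> [s _]; case: ifPn => // /asboolP; exact.
Qed.

(** For a fixed point the bad shifts form a countable set, hence a Lebesgue null set. By Fubini,
    almost every shift is bad only on a [P]-null set of points. *)
Lemma atomless_shift (P : probability T R) : exists delta : R,
  forall i (q : rat), P [set x | phi i x = (delta + ratr q)%R] = 0.
Proof.
pose U := measurableTypeR R.
pose E := \bigcup_(iq : nat * rat)
  [set xd : T * U | phi iq.1 xd.1 = (xd.2 + ratr iq.2)%R].
have mE1 i q : measurable [set xd : T * U | phi i xd.1 = (xd.2 + ratr q)%R].
  have mD : measurable_fun setT (fun xd : T * U => (xd.2 + ratr q)%R : R).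
    by apply: measurable_funD; [exact: measurable_snd|exact: measurable_cst].
  have := measurable_fun_eqr (measurableT_comp (mphi i) (@measurable_fst _ _ T U)) mD.
  move=> /(_ measurableT [set true] Logic.I); rewrite setTI.
  by congr (measurable _); apply/seteqP; split => -[x d']/= /eqP.
have mE : measurable E by apply: countable_bigcupT_measurable => // -[i q]; exact: mE1.
have E0 x : @unit_uniform R (xsection E x) = 0.
  apply/eqP; rewrite eq_le measure_ge0 andbT.
  have cE : countable (xsection E x).
    rewrite (_ : xsection E x = (fun iq : nat * rat => phi iq.1 x - ratr iq.2)%R @` setT).
      exact: sub_countable (card_image_le _ _) (countableP _).
    apply/seteqP; split => [y|_ [[i q] _ <-]]; rewrite /xsection/= inE /E.
      by move=> [[i q] _ /= e]; exists (i, q) => //=; rewrite e addrK.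
    by exists (i, q) => //=; rewrite subrK.
  rewrite -(countable_lebesgue_measure0 cE); apply: le_measure; rewrite ?inE.
  - by apply: measurableI; [exact: measurable_xsection|exact: measurable_unit_below].
  - exact: measurable_xsection.
  - exact: subIsetl.
have := @indic_fubini_tonelli _ _ _ _ _ P (@unit_uniform R) E mE.
rewrite indic_fubini_tonelli_FE// indic_fubini_tonelli_GE//.
rewrite integral0_eq; last by move=> x _ /=; exact: E0.
move=> /esym I0; have mG := measurable_fun_ysection P mE.
have : ae_eq (@unit_uniform R) setT (P \o ysection E) (cst 0).
  apply/ae_eq_integral_abs => //; rewrite -[RHS]I0.
  by apply: eq_integral => y _; rewrite gee0_abs.
move=> [N [mN N0 sN]].
have [d' d'N] : exists d', ~ N d'.
  apply/not_existsP => h; have : @unit_uniform R N = 1.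
    by rewrite -(@probability_setT _ _ _ (@unit_uniform R)); congr unit_uniform;
      apply/seteqP; split => // y _; exact: contrapT (h y).
  by rewrite N0 => /eqP; rewrite eq_sym onee_eq0.
exists d' => i q; apply/eqP; rewrite eq_le measure_ge0 andbT.
have -> : 0 = P (ysection E d').
  by apply/esym; apply: contrapT => h; apply: d'N; apply: sN => /(_ I)/=.
apply: le_measure; rewrite ?inE.
- have := measurable_ysection d' (mE1 i q).
  by congr (measurable _); apply/seteqP; split => x; rewrite /ysection/= inE.
- exact: measurable_ysection.
- by move=> x /= xq; rewrite /ysection/= inE; exists (i, q).
Qed.


End measurable_features.

Section borel_features.
Context (R : realType) (T : ptopologicalType).

Lemma continuous_min1_mdist (S : metricType R) (s : S) :
  continuous (fun x : S => Num.min 1%R (mdist x s) : R).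
Proof.
move=> x; apply/cvgrPdist_lt => e e0; apply/metricType_numDomainType.nbhs_mdistP; exists e => //= y xy.
have h1 := metric_triangle x y s; have h2 := metric_triangle y x s.
rewrite (metric_sym y x) in h2; move: h1 h2 xy => /=.
move: (mdist x s) (mdist y s) (mdist x y) => a b c; rewrite ltr_norml.
by case: (leP 1%R a); case: (leP 1%R b); lra.
Qed.

(** The features are the distances to the points of a countable dense set, truncated at 1. *)
Lemma topological_borel_space_features : topological_borel_space R T ->
  exists phi : nat -> T -> R, [/\ forall i x, (0 <= phi i x <= 1)%R,
    forall i, continuous (phi i) & forall O, open O -> fopen phi O].
Proof.
move=> [S [i [_ [C cC dC] injS openT _]]].
have /countable_injP[f injf] := cC.
have /choice[c cP] : forall n, exists s : S, forall t, C t -> f t = n -> s = t.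
  move=> n; have [[t [Ct ftn]]|h] := pselect (exists t, C t /\ f t = n).
    by exists t => t' Ct' ft'n; apply: injf; rewrite ?inE// ftn ft'n.
  by exists (i point) => t Ct ftn; exfalso; apply: h; exists t.
exists (fun n x => Num.min 1%R (mdist (i x) (c n))); split.
- by move=> n x; rewrite le_min ler01 mdist_ge0/= ge_min lexx.
- move=> n x; apply: (continuous_comp (g := fun y => Num.min 1%R (mdist y (c n)))).
    move: x; apply/continuousP => V oV; apply/openT; exists V => //.
  exact: continuous_min1_mdist.
- move=> O /openT[V oV ->] x Vx.
  have /metricType_numDomainType.nbhs_mdistP[e /= e0 eV] : nbhs (i x) V by exact: open_nbhs_nbhs.
  (* Being at most 1/3, [e'] keeps the distances below the truncation: [s] is within [e'] of [i x],
     its feature puts [i y] within [2 e'] of [s], hence within [e] of [i x]. *)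
  pose e' := (Num.min e 1 / 3)%R.
  have e'0 : (0 < e')%R by rewrite divr_gt0// lt_min e0 ltr01.
  have [s [se Cs]] : (ball (i x) e' `&` C) !=set0.
    have := dC (ball (i x) e')^°; case=> [|/=|s [/interior_subset se Cs]].
    - exists (i x); exact: nbhsx_ballx.
    - exact: open_interior.
    - by exists s.
  rewrite ballEmdist/= in se.
  have csE : c (f s) = s by exact: cP.
  have [N Ne] : exists N : nat, (N.+1%:R^-1 < e')%R.
    exists (Num.truncn e'^-1); rewrite invf_plt ?posrE ?ltr0n//.
    by rewrite truncnS_gt.
  exists (maxn N (f s).+1) => y xy; apply: eV => /=.
  have := xy (f s); rewrite leq_max ltnS leqnn orbT => /(_ isT).
  have : ((maxn N (f s).+1).+1%:R^-1 <= N.+1%:R^-1 :> R)%R.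
    by rewrite lef_pV2 ?posrE ?ltr0n// ler_nat ltnS leq_maxl.
  move: (_.+1%:R^-1)%R => a; move: (N.+1%:R^-1)%R Ne => b be ab.
  rewrite csE ltr_norml => xyb.
  have := metric_triangle (i x) s (i y); rewrite (metric_sym s).
  have : (e' <= e / 3 /\ e' <= 3^-1)%R.
    by rewrite /e' ler_pM2r// ge_min lexx/= -[leRHS]mul1r ler_pM2r// ge_min lexx orbT.
  move: e'0 se be ab xyb.
  move: (mdist (i x) s) (mdist (i y) s) (mdist (i x) (i y)) => u v w.
  by case: (leP 1%R u); case: (leP 1%R v); lra.
Qed.

End borel_features.

(** * Recovering a point from its bits *)

Section decode.
Context (R : realType) (T : ptopologicalType) (phi : nat -> T -> R).
Hypothesis borelT : topological_borel_space R T.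
Hypothesis phi01 : forall i x, (0 <= phi i x <= 1)%R.
Hypothesis phi_open : forall O, open O -> fopen phi O.
Local Notation bits := (fbits phi 0).

Definition cell (s : seq bool) : set T := [set x | prefix_of (bits x) (size s) = s].

Definition cell_rep (s : seq bool) : T := get (cell s).

Lemma cell_repP s : cell s !=set0 -> prefix_of (bits (cell_rep s)) (size s) = s.
Proof. by move=> [x sx]; rewrite /cell_rep; have := getI sx. Qed.

Lemma cell_rep_cvg x : (fun m => cell_rep (prefix_of (bits x) m)) @ \oo --> x.
Proof.
move=> O; rewrite nbhsE => -[V [oV Vx] VO].
have [n nV] := fopen_cell phi01 0%R (phi_open oV) Vx.
exists n => // m /= nm; apply/VO/nV.
have : cell (prefix_of (bits x) m) !=set0 by exists x; rewrite /cell/= size_prefix_of.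
move=> /cell_repP; rewrite size_prefix_of.
move=> /prefix_ofP h; apply/prefix_ofP => j jn.
by rewrite h// (leq_trans jn).
Qed.

(** A code is decoded to the limit of its cell representatives. Completeness of the ambient space
    makes the convergent codes a measurable set, and the Borel range of the embedding makes those
    with a limit in [T] measurable; all other codes go to [point]. *)
Lemma decode_exists : exists2 dec : coin -> borel T, measurable_fun setT dec &
  forall (b : coin) (x : T),
    (fun m => cell_rep (prefix_of b m)) @ \oo --> x -> dec b = x.
Proof.
have [S [i [complS _ injS openT rangeS]]] := borelT.
have ci : continuous i.
  by apply/continuousP => V oV; apply/openT; exists V.
pose r (b : coin) m := i (cell_rep (prefix_of b m)).
(* Cauchy codes are described by countably many conditions on finite prefixes, and by completeness
   they are the codes whose representatives converge in [S]. *)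
pose cau : set coin := [set b | forall k : nat, exists M : nat, forall m m', (M <= m)%N ->
  (M <= m')%N -> (mdist (r b m) (r b m') < k.+1%:R^-1)%R].
have mcau : measurable cau.
  rewrite (_ : cau = \bigcap_k \bigcup_M \bigcap_(m in [set m | (M <= m)%N])
      \bigcap_(m' in [set m | (M <= m)%N])
        [set b | (mdist (r b m) (r b m') < k.+1%:R^-1)%R]).
    apply: bigcap_measurableType => k _; apply: bigcup_measurable => M _.
    apply: bigcap_measurableType => m _; apply: bigcap_measurableType => m' _.
    have := measurable_prefix (m' + m) [set s |
      (mdist (i (cell_rep (drop m' s))) (i (cell_rep (drop m s))) < k.+1%:R^-1)%R].
    congr (measurable _); apply/seteqP; split => b; rewrite /= /r drop_prefix_of;
      by rewrite addnC drop_prefix_of.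
  apply/seteqP; split => [b bc k _|b bc k].
    by have [M MP] := bc k; exists M => // m Mm m' Mm' /=; exact: MP.
  by have [M _ MP] := bc k Logic.I; exists M => m m' Mm Mm'; exact: (MP m Mm m' Mm').
have /choice[f fP] : forall b, exists s : S,
    (cau b -> r b @ \oo --> s) /\ (~ cau b -> s = i point).
  move=> b; have [cb|ncb] := pselect (cau b); last by exists (i point).
  have [|s rs] := complS (r b @ \oo) _; last by exists s.
  apply/cauchy_ballP => e e0.
  have [k ke] : exists k : nat, (k.+1%:R^-1 < e)%R.
    exists (Num.truncn e^-1); rewrite invf_plt ?posrE ?ltr0n//.
    by rewrite truncnS_gt.
  have [M MP] := cb k.
  exists ([set s | exists2 m, (M <= m)%N & s = r b m],
    [set s | exists2 m, (M <= m)%N & s = r b m]) => /=.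
    by split; exists M => // m Mm; exists m.
  move=> [_ _] [/= [m Mm ->] [m' Mm' ->]]; rewrite ballEmdist/=.
  exact: lt_trans (MP _ _ Mm Mm') ke.
have mfo (V : set S) : open V -> measurable (f @^-1` V).
  move=> oV.
  (* The limit lies in the open set [V] iff the representatives eventually stay where a ball of some
     fixed radius fits into [V]; this is again a countable condition on prefixes. *)
  pose V' k : set S := [set s | ball s k.+1%:R^-1 `<=` V].
  rewrite (_ : _ @^-1` _ =
    (cau `&` \bigcup_k \bigcup_M \bigcap_(m in [set m | (M <= m)%N]) [set b | V' k (r b m)])
    `|` (if `[< V (i point) >] then ~` cau else set0)).
    apply: measurableU; last by case: ifP => _; [exact: measurableC|exact: measurable0].
    apply: measurableI => //; apply: bigcup_measurable => k _.
    apply: bigcup_measurable => M _; apply: bigcap_measurableType => m _.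
    exact: (measurable_prefix m [set s | V' k (i (cell_rep s))]).
  apply/seteqP; split => [b /= Vfb|b].
    have [cb|ncb] := pselect (cau b); last first.
      right; rewrite (fP b).2// in Vfb; case: ifPn => //.
      by move=> /asboolP.
    left; split => //.
    have /metricType_numDomainType.nbhs_mdistP[e /= e0 eV] : nbhs (f b) V by exact: open_nbhs_nbhs.
    have [k ke] : exists k : nat, (k.+1%:R^-1 < e / 2)%R.
      exists (Num.truncn (e / 2)^-1); rewrite invf_plt ?posrE ?ltr0n ?divr_gt0//.
      by rewrite truncnS_gt.
    have k0 : (0 < k.+1%:R^-1 :> R)%R by rewrite invr_gt0 ltr0n.
    have [M _ MP] := metricType_numDomainType.cvgr_dist_lt ((fP b).1 cb) k0.
    exists k => //; exists M => // m Mm s; rewrite ballEmdist/= => ms; apply: eV => /=.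
    rewrite (le_lt_trans (metric_triangle _ (r b m) _))//.
    have := MP m Mm => /=; move: (k.+1%:R^-1)%R ke ms => a; lra.
  move=> [[cb [k _ [M _ MP]]]|]; last first.
    case: ifPn => [/asboolP Vp ncb|_ []]//.
    by rewrite /preimage/= (fP b).2.
  have k0 : (0 < k.+1%:R^-1 :> R)%R by rewrite invr_gt0 ltr0n.
  have [N _ NP] := metricType_numDomainType.cvgr_dist_lt ((fP b).1 cb) k0.
  have := MP (maxn M N) (leq_maxl _ _); rewrite /V'/=; apply.
  rewrite ballEmdist/= metric_sym; apply: NP; exact: leq_maxr.
have mf (B : set S) : <<s @open S >> B -> measurable (f @^-1` B).
  move=> sB.
  have : <<s @open S >> `<=` image_set_system setT f (@measurable _ coin).
    apply: smallest_sub; first exact/sigma_algebra_image/sigma_algebra_measurable.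
    by move=> V oV; rewrite /image_set_system/= setTI; exact: mfo.
  by move=> /(_ _ sB); rewrite /image_set_system/= setTI.
have /choice[dec decP] : forall b, exists x : T,
    (forall y, f b = i y -> x = y) /\ (~ range i (f b) -> x = point).
  move=> b; have [[y _ iy]|n] := pselect (range i (f b)).
    exists y; split => [y'|[]]; last by exists y.
    by rewrite -iy; exact: injS.
  by exists point; split => // y fy; exfalso; apply: n; exists y.
exists dec.
  apply: (@measurability _ _ coin (borel T) setT dec (@open T)) => // _ [U oU <-].
  rewrite setTI; have /openT[V oV UV] := oU.
  rewrite (_ : _ @^-1` _ = (f @^-1` (V `&` range i)) `|`
    (if `[< U point >] then f @^-1` (~` range i) else set0)).
    apply: measurableU.
      apply: (measurableI (f @^-1` V) (f @^-1` range i)); [exact: mfo|exact: mf].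
    case: ifP => _; last exact: measurable0.
    by rewrite preimage_setC; exact: (measurableC (mf _ rangeS)).
  apply/seteqP; split => b /=.
    have [[y _ iy]|n] := pselect (range i (f b)).
      rewrite ((decP b).1 y)// UV => Vy; left; split; last by exists y.
      by rewrite -iy.
    rewrite ((decP b).2 n) => Up; right.
    by case: ifPn => [|/asboolP].
  move=> [[Vf [y _ iy]]|]; first by rewrite ((decP b).1 y)// UV/preimage/= iy.
  by case: ifPn => // /asboolP Up n; rewrite ((decP b).2 n).
move=> b x bx; apply: (decP b).1.
have rx : r b @ \oo --> i x by apply: (cvg_comp _ _ bx); exact: ci.
have cb : cau b.
  move=> k; have k0 : (0 < k.+1%:R^-1 / 2 :> R)%R by rewrite divr_gt0// invr_gt0 ltr0n.
  have [M _ MP] := metricType_numDomainType.cvgr_dist_lt rx k0; exists M => m m' Mm Mm'.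
  rewrite (le_lt_trans (metric_triangle _ (i x) _))// metric_sym.
  have := MP m Mm; have := MP m' Mm' => /=; move: (k.+1%:R^-1)%R => a; lra.
exact: (@cvg_unique _ (@metric_hausdorff R S) _ _ _ _ ((fP b).1 cb) rx).
Qed.

End decode.

(** * Ultralimits of probabilities *)

Section ultralimit.
Context (R : realType) (U : set_system nat) {UU : UltraFilter U}.
Local Open Scope ring_scope.
Implicit Types f g : nat -> R.

Definition ulim f : R := lim (f @ U).

Definition bounded_family f := exists K : R, forall i, `|f i| <= K.

(** The image of an ultrafilter is an ultrafilter, and it contains a compact segment. *)
Lemma ulim_cvg f : bounded_family f -> f @ U --> ulim f.
Proof.
move=> [K fK].
have fU : UltraFilter (f @ U).
  split; first exact: fmap_proper_filter.
  move=> G GG fG; apply/seteqP; split => A; last exact: fG.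
  move=> GA; have [//|h] := in_ultra_setVsetC (f @^-1` A) UU.
  have : G (A `&` ~` A) by apply: filterI => //; apply: fG.
  by rewrite setICr => /filter_ex[].
have := @segment_compact R (- K) K; rewrite compact_ultra => /(_ _ fU).
case=> [|l [_ fl]]; last by rewrite /ulim (cvg_lim _ fl).
by apply: (@filterE _ U) => i; rewrite /= in_itv/= -ler_norml.
Qed.

Lemma ulim_unique f l : f @ U --> l -> ulim f = l.
Proof. exact: cvg_lim. Qed.

Lemma ulimD f g : bounded_family f -> bounded_family g ->
  ulim (fun i => f i + g i) = ulim f + ulim g.
Proof. by move=> bf bg; apply: ulim_unique; apply: cvgD; exact: ulim_cvg. Qed.

Lemma ulimZ (c : R) f : bounded_family f -> ulim (fun i => c * f i) = c * ulim f.
Proof. by move=> bf; apply: ulim_unique; apply: cvgM; [exact: cvg_cst|exact: ulim_cvg]. Qed.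

Lemma ulim_cst (c : R) : ulim (fun=> c) = c.
Proof. by apply: ulim_unique; exact: cvg_cst. Qed.

Lemma ulim_le f g : bounded_family f -> bounded_family g ->
  (forall i, f i <= g i) -> ulim f <= ulim g.
Proof.
move=> bf bg fg; apply: (ler_cvg_to (ulim_cvg bf) (ulim_cvg bg)).
by apply: filterE => i; exact: fg.
Qed.

Lemma bounded_sum (J : Type) (r : seq J) (F : J -> nat -> R) :
  (forall j, bounded_family (F j)) -> bounded_family (fun i => \sum_(j <- r) F j i).
Proof.
move=> bF; elim: r => [|j r [K ih]].
  by exists 0 => i; rewrite big_nil normr0.
have [K' jK'] := bF j; exists (K' + K) => i; rewrite big_cons.
by rewrite (le_trans (ler_normD _ _))// lerD.
Qed.

Lemma ulim_sum (J : Type) (r : seq J) (F : J -> nat -> R) :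
  (forall j, bounded_family (F j)) ->
  ulim (fun i => \sum_(j <- r) F j i) = \sum_(j <- r) ulim (F j).
Proof.
move=> bF; elim: r => [|j r ih].
  rewrite big_nil -[RHS]ulim_cst; congr ulim.
  by apply/funext => i; rewrite big_nil.
rewrite big_cons -ih -ulimD//; last exact: bounded_sum.
by congr ulim; apply/funext => i; rewrite big_cons.
Qed.

End ultralimit.

Section real_probability.
Context d (T : measurableType d) (R : realType).
Local Open Scope ring_scope.
Implicit Types (P : probability T R) (E F : set T) (f g : T -> R).

Lemma prE P E : measurable E -> (fine (P E))%:E = P E.
Proof. by move=> mE; rewrite fineK// fin_num_measure. Qed.

Lemma pr_ge0 P E : 0 <= fine (P E).
Proof. exact: fine_ge0. Qed.

Lemma pr_le1 P E : measurable E -> fine (P E) <= 1.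
Proof. by move=> mE; rewrite -lee_fin prE// probability_le1. Qed.

Lemma prT P : fine (P setT) = 1.
Proof. by rewrite probability_setT. Qed.

Lemma pr_le P E F : measurable E -> measurable F -> E `<=` F ->
  fine (P E) <= fine (P F).
Proof.
by move=> mE mF EF; rewrite -lee_fin !prE//; apply: le_measure; rewrite ?inE.
Qed.

Lemma prU P E F : measurable E -> measurable F -> E `&` F = set0 ->
  fine (P (E `|` F)) = fine (P E) + fine (P F).
Proof.
by move=> mE mF EF; rewrite measureU// fineD ?fin_num_measure.
Qed.

Lemma pr_split P E F : measurable E -> measurable F ->
  fine (P E) = fine (P (E `&` F)) + fine (P (E `&` ~` F)).
Proof.
move=> mE mF; rewrite -prU; [|exact: measurableI| |].
- by rewrite -setIUr setUv setIT.
- by apply: measurableI => //; exact: measurableC.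
- by rewrite setIACA setICr setI0.
Qed.

Lemma pr_bounded (P : nat -> probability T R) E : measurable E ->
  bounded_family (fun i => fine (P i E)).
Proof.
by move=> mE; exists 1 => i; rewrite ger0_norm ?pr_le1// pr_ge0.
Qed.

(** Continuity from below, in the form in which bounds on simple sets exhausting an open set are
    passed to that set. *)
Lemma pr_le_bigcup P (F : nat -> set T) c : (forall n, measurable (F n)) ->
  (forall n, F n `<=` F n.+1) -> (forall n, fine (P (F n)) <= c) ->
  fine (P (\bigcup_n F n)) <= c.
Proof.
move=> mF ndF Fc; have mU : measurable (\bigcup_n F n) by exact: bigcupT_measurable.
rewrite -lee_fin prE//.
have ndF' : nondecreasing_seq F.
  apply/nondecreasing_seqP => n; apply/subsetPset; exact: ndF.
have := nondecreasing_cvg_mu (mu := P) mF mU ndF'.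
move=> cvF; rewrite -(cvg_lim _ cvF)//; apply: lime_le.
  by apply/cvg_ex; eexists; exact: cvF.
by apply: nearW => n /=; rewrite -prE// lee_fin.
Qed.

Definition bounded_mfun (g : T -> R) := measurable_fun setT g /\
  exists K : R, forall x, `|g x| <= K.

Lemma bounded_mfun_integrable P g : bounded_mfun g -> P.-integrable setT (EFin \o g).
Proof.
move=> [mg [K gK]]; apply: measurable_bounded_integrable => //.
  by rewrite [ltLHS]probability_setT ltry.
exists K; split; first by rewrite num_real.
by move=> c Kc x _ /=; rewrite (le_trans (gK x))// ltW.
Qed.

Lemma bounded_mfun_cst (c : R) : bounded_mfun (fun=> c).
Proof. by split => //; exists `|c|. Qed.

Lemma bounded_mfun_indic E : measurable E -> bounded_mfun (fun x => (x \in E)%:R).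
Proof.
move=> mE; split; first exact: measurable_indic.
by exists 1 => x; case: (_ \in _); rewrite ?normr1// normr0.
Qed.

Lemma bounded_mfunD f g : bounded_mfun f -> bounded_mfun g ->
  bounded_mfun (fun x => f x + g x).
Proof.
move=> [mf [K fK]] [mg [L gL]]; split; first exact: measurable_funD.
by exists (K + L) => x; rewrite (le_trans (ler_normD _ _))// lerD.
Qed.

Lemma bounded_mfunZ c g : bounded_mfun g -> bounded_mfun (fun x => c * g x).
Proof.
move=> [mg [K gK]]; split; first exact: measurable_funM.
by exists (`|c| * K) => x; rewrite normrM ler_wpM2l.
Qed.

Lemma bounded_mfun_norm g : bounded_mfun g -> bounded_mfun (fun x => `|g x|).
Proof.
move=> [mg [K gK]]; split; first exact: measurableT_comp.
by exists K => x; rewrite normr_id.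
Qed.

Lemma bounded_mfun01 g : measurable_fun setT g -> (forall x, 0 <= g x <= 1) ->
  bounded_mfun g.
Proof.
move=> mg g01; split => //; exists 1 => x.
by have /andP[? ?] := g01 x; rewrite ger0_norm.
Qed.

Lemma bounded_mfun_sum (J : Type) (r : seq J) (F : J -> T -> R) :
  (forall j, bounded_mfun (F j)) -> bounded_mfun (fun x => \sum_(j <- r) F j x).
Proof.
move=> bF; elim: r => [|j r ih].
  by under eq_fun do rewrite big_nil; exact: bounded_mfun_cst.
by under eq_fun do rewrite big_cons; exact: bounded_mfunD.
Qed.

Lemma RintegralDb P f g : bounded_mfun f -> bounded_mfun g ->
  (\int[P]_x (f x + g x) = \int[P]_x f x + \int[P]_x g x)%R.
Proof. by move=> bf bg; rewrite RintegralD//; exact: bounded_mfun_integrable. Qed.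

Lemma RintegralZb P c g : bounded_mfun g ->
  (\int[P]_x (c * g x) = c * \int[P]_x g x)%R.
Proof. by move=> bg; rewrite RintegralZl//; exact: bounded_mfun_integrable. Qed.

Lemma Rintegral_sumb P (J : Type) (r : seq J) (F : J -> T -> R) :
  (forall j, bounded_mfun (F j)) ->
  (\int[P]_x (\sum_(j <- r) F j x) = \sum_(j <- r) \int[P]_x F j x)%R.
Proof.
move=> bF; elim: r => [|j r ih].
  rewrite big_nil; under eq_Rintegral do rewrite big_nil.
  by rewrite Rintegral_cst// mul0r.
under eq_Rintegral do rewrite big_cons.
by rewrite RintegralDb// ?ih ?big_cons//; exact: bounded_mfun_sum.
Qed.

Lemma le_Rintegralb P f g : bounded_mfun f -> bounded_mfun g ->
  (forall x, f x <= g x) -> (\int[P]_x f x <= \int[P]_x g x)%R.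
Proof. by move=> bf bg fg; apply: le_Rintegral => //; exact: bounded_mfun_integrable. Qed.

Lemma Rintegral_cst1 P (c : R) : (\int[P]_x c = c)%R.
Proof. by rewrite Rintegral_cst// prT mulr1. Qed.

Lemma Rintegral_pr P E : measurable E -> (\int[P]_x (x \in E)%:R)%R = fine (P E).
Proof. by move=> mE; rewrite /Rintegral integral_indic// setIT. Qed.

Lemma Rintegral_bounded P g (K : R) : measurable_fun setT g -> (forall x, `|g x| <= K) ->
  `|(\int[P]_x g x)%R| <= K.
Proof.
move=> mg gK; have bg : bounded_mfun g by split => //; exists K.
apply: (le_trans (le_normr_Rintegral _ (bounded_mfun_integrable P bg))) => //.
rewrite -[leRHS](Rintegral_cst1 P); apply: le_Rintegralb => //.
  exact: bounded_mfun_norm.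
exact: bounded_mfun_cst.
Qed.

Lemma Rintegral_bounded_family (P : nat -> probability T R) g :
  bounded_mfun g -> bounded_family (fun i => (\int[P i]_x g x)%R).
Proof. by move=> [mg [K gK]]; exists K => i; exact: Rintegral_bounded. Qed.

End real_probability.

(* Layer cake: [x] is within [1] of the number of integers in [[1, x[]. *)
Lemma sum_level (R : realType) (N : nat) (x : R) : (0 <= x <= N%:R)%R ->
  (x - 1 <= \sum_(k < N) ((k.+1%:R < x)%R)%:R <= x)%R.
Proof.
elim: N => [|N ih] /andP[x0 xN].
  by rewrite big_ord0 x0 andbT; lra.
rewrite big_ord_recr/= ltNge xN/= addr0.
have [xN'|Nx] := leP x N%:R; first by apply: ih; rewrite x0.
rewrite (eq_bigr (fun=> 1%R)); last first.
  move=> k _; rewrite (_ : _ < x)%R//.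
  by apply: le_lt_trans Nx; rewrite ler_nat.
by rewrite sumr_const card_ord; move: xN; rewrite -natr1; lra.
Qed.

Section lower_semicontinuous.
Context (R : realType) (U : set_system nat) {UU : UltraFilter U}.
Context d (T : measurableType d).
Variables (phi : nat -> T -> R) (P : nat -> probability T R).
Hypothesis phi01 : forall i x, (0 <= phi i x <= 1)%R.
Hypothesis mphi : forall i, measurable_fun setT (phi i).
Local Open Scope ring_scope.

Definition plim (E : set T) : R := ulim U (fun i => fine (P i E)).

(* The open-set half of the portmanteau theorem. *)
Definition below_limit (Q : probability T R) :=
  forall O, fopen phi O -> fine (Q O) <= plim O.

Definition flsc (g : T -> R) := forall r, fopen phi [set x | r < g x].

Lemma plimT : plim setT = 1.
Proof. by rewrite /plim; under eq_fun do rewrite prT; exact: ulim_cst. Qed.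

Lemma plim_le E F : measurable E -> measurable F -> E `<=` F -> plim E <= plim F.
Proof.
move=> mE mF EF; apply: ulim_le; [exact: pr_bounded|exact: pr_bounded|].
by move=> i; exact: pr_le.
Qed.

Lemma plim_ge0 E : measurable E -> 0 <= plim E.
Proof.
move=> mE; rewrite -(@ulim_cst R U _ 0); apply: ulim_le.
- by exists 0 => i; rewrite normr0.
- exact: pr_bounded.
- by move=> i; exact: pr_ge0.
Qed.

Lemma plim_split E F : measurable E -> measurable F ->
  plim E = plim (E `&` F) + plim (E `&` ~` F).
Proof.
move=> mE mF; rewrite /plim -ulimD.
- by congr ulim; apply/funext => i; exact: pr_split.
- by apply: pr_bounded; exact: measurableI.
- by apply: pr_bounded; apply: measurableI => //; exact: measurableC.
Qed.

(** [g] is within [1/N] of the average of the indicators of its superlevel sets, which are [fopen],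
    so the inequality on sets adds up. *)
Lemma flsc_integral_le Q (g : T -> R) : below_limit Q -> measurable_fun setT g ->
  (forall x, 0 <= g x <= 1) -> flsc g ->
  (\int[Q]_x g x)%R <= ulim U (fun i => (\int[P i]_x g x)%R).
Proof.
move=> QP mg g01 lg.
have bg := bounded_mfun01 mg g01.
apply/ler_addgt0Pr => e e0.
pose N := (Num.truncn e^-1).+1.
have Ne : (N%:R^-1 <= e).
  by rewrite invf_ple ?posrE ?ltr0n// ltW// truncnS_gt.
have N0 : 0 < N%:R :> R by rewrite ltr0n.
pose L k := [set x | k.+1%:R / N%:R < g x].
have mL k : measurable (L k) by apply: (measurable_fopen phi01) => //; exact: lg.
pose s x := \sum_(k < N) N%:R^-1 * (x \in L k)%:R : R.
have sE x : s x = N%:R^-1 * \sum_(k < N) ((k.+1%:R < N%:R * g x)%R)%:R.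
  rewrite mulr_sumr; apply: eq_bigr => k _; congr (_ * (nat_of_bool _)%:R).
  by apply/idP/idP; rewrite inE /L/= ltr_pdivrMr// mulrC.
have sg x : g x <= s x + N%:R^-1 /\ s x <= g x.
  have /andP[g0 g1] := g01 x.
  have Ng : 0 <= N%:R * g x <= N%:R.
    by rewrite mulr_ge0//= -[leRHS]mulr1 ler_wpM2l.
  have /andP[h1 h2] := sum_level Ng; rewrite sE; split.
    rewrite -(ler_pM2l N0) mulrDr mulrA mulfV ?gt_eqF// mul1r.
    by rewrite -lerBlDr.
  by rewrite -(ler_pM2l N0) mulrA mulfV ?gt_eqF// mul1r.
have bL k : bounded_mfun (fun x => N%:R^-1 * (x \in L k)%:R : R).
  by apply: bounded_mfunZ; exact: bounded_mfun_indic.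
have bs : bounded_mfun s by exact: bounded_mfun_sum.
have ints (Q' : probability T R) :
    (\int[Q']_x s x)%R = \sum_(k < N) N%:R^-1 * fine (Q' (L k)).
  rewrite Rintegral_sumb//; apply: eq_bigr => k _.
  by rewrite RintegralZb ?Rintegral_pr//; exact: bounded_mfun_indic.
apply: (@le_trans _ _ ((\int[Q]_x s x)%R + N%:R^-1)).
  rewrite -[X in _ + X](Rintegral_cst1 Q) -RintegralDb//; last exact: bounded_mfun_cst.
  apply: le_Rintegralb => //; first by apply: bounded_mfunD => //; exact: bounded_mfun_cst.
  by move=> x; case: (sg x).
apply: lerD => //; apply: (@le_trans _ _ (ulim U (fun i => (\int[P i]_x s x)%R))).
  rewrite ints; under [X in ulim _ X]eq_fun do rewrite ints.
  have bk (k : 'I_N) : bounded_family (fun i => N%:R^-1 * fine (P i (L k))).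
    exists (`|N%:R^-1|) => i; rewrite normrM ler_piMr// ger0_norm ?pr_le1//.
    exact: pr_ge0.
  rewrite ulim_sum//; apply: ler_sum => k _; rewrite ulimZ; last exact: pr_bounded.
  by rewrite ler_pM2l ?invr_gt0//; apply: QP; exact: lg.
apply: ulim_le; [exact: Rintegral_bounded_family|exact: Rintegral_bounded_family|].
by move=> i; apply: le_Rintegralb => // x; case: (sg x).
Qed.

End lower_semicontinuous.

(** * Features of the transition kernel *)

Section kernel_probability.
Context d d' (Z : measurableType d) (T : measurableType d') (R : realType).
Variable (k : R.-pker Z ~> T).

(** The measures of [k], registered as probabilities so that the lemmas on real-valued probabilities
    apply to them. *)
Definition kernel_at (z : Z) : set T -> \bar R := k z.

HB.instance Definition _ z := Measure.on (kernel_at z).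

Let kernel_atT z : kernel_at z setT = 1. Proof. exact: prob_kernel. Qed.

HB.instance Definition _ z := Measure_isProbability.Build _ _ _ (kernel_at z) (kernel_atT z).

Lemma measurable_kernel_at B : measurable B ->
  measurable_fun setT (fun z => fine (kernel_at z B)).
Proof. by move=> mB; apply: measurableT_comp => //; exact: measurable_kernel. Qed.

End kernel_probability.

Section continuous_features.
Context (R : realType) (T : ptopologicalType) (phi : nat -> T -> R).
Hypothesis phi01 : forall i x, (0 <= phi i x <= 1)%R.
Hypothesis cphi : forall i, continuous (phi i).
Hypothesis phi_open : forall O, open O -> fopen phi O.
Local Open Scope ring_scope.

Lemma near_by_nbhs M x : nbhs x (near_by phi M x).
Proof.
have h i : \forall y \near x, `|phi i x - phi i y| < M.+1%:R^-1.
  by have /cvgrPdist_lt := @cphi i x; apply; rewrite invr_gt0 ltr0n.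
have : \forall y \near x, forall i : 'I_M, `|phi i x - phi i y| < M.+1%:R^-1.
  by apply: filter_forall => i; exact: h.
by apply: filterS => y xy i iM; exact: (xy (Ordinal iM)).
Qed.

Lemma continuous_measurable_features i : measurable_fun [set: borel T] (phi i).
Proof.
apply: (@measurability _ _ (borel T) R setT (phi i) (@RGenOInfty.G R)).
  exact: RGenOInfty.measurableE.
move=> _ [_ [r ->] <-]; rewrite setTI; apply: sub_sigma_algebra.
have /continuousP := @cphi i; apply; exact: interval_open.
Qed.

(** Bumps centred at the countably many cell representatives play the role of a distance to the
    complement: the bumps living inside [V] are summed, and every point of [V] meets one of them. *)
Lemma fopen_approximation V : fopen phi V -> exists u : nat -> T -> R,
  [/\ forall m, continuous (u m), forall m x, 0 <= u m x <= 1,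
      forall m x, u m x <= u m.+1 x, forall m x, ~ V x -> u m x = 0
    & forall x, V x -> exists m, u m x = 1].
Proof.
move=> oV.
(* A product of tents, positive exactly on [near_by phi M y]. *)
pose h (y : T) M x := \prod_(i < M) Num.max 0 (M.+1%:R^-1 - `|phi i y - phi i x|).
have h0 y M x : 0 <= h y M x by apply: prodr_ge0 => i _; rewrite le_max lexx.
have ch y M : continuous (h y M).
  move=> x; apply: (@cvg_big R _ *%R _ _ (@mul_continuous R)) => i _.
  apply: (@continuous_max _ _ (cst 0) (fun x => M.+1%:R^-1 - `|phi i y - phi i x|)).
    exact: cvg_cst.
  apply: cvgB; first exact: cvg_cst.
  by apply: cvg_norm; apply: cvgB; [exact: cvg_cst|exact: cphi].
have hP y M x : (0 < h y M x) <-> near_by phi M y x.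
  split => [+ i iM|yx].
    move=> h'; rewrite -subr_gt0 ltNge; apply/negP => hi; move: h'.
    rewrite /h (bigD1 (Ordinal iM))//=; move/max_idPl : hi => ->.
    by rewrite mul0r ltxx.
  by apply: prodr_gt0 => i _; rewrite lt_max subr_gt0 yx ?orbT.
pose good n := if unpickle n is Some (s, M) then
  `[< near_by phi M (cell_rep phi s) `<=` V >] else false.
pose f n := if unpickle n is Some (s, M) then
  if good n then h (cell_rep phi s) M else cst 0 else cst 0.
have f0 n x : 0 <= f n x by rewrite /f; case: unpickle => [[s M]|]//; case: ifP.
have cf n : continuous (f n).
  rewrite /f; case: unpickle => [[s M]|]; last by move=> x; exact: cvg_cst.
  by case: ifP => _ //; move=> x; exact: cvg_cst.
have fV n x : 0 < f n x -> V x.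
  rewrite /f /good; case: unpickle => [[s M]|]; last by rewrite ltxx.
  by case: ifPn => [/asboolP sV /hP /sV|_]//; rewrite ltxx.
have Vf x : V x -> exists n, 0 < f n x.
  move=> Vx; have [M MV] := oV x Vx.
  have [n _ nP] := cell_rep_cvg phi01 phi_open (near_by_nbhs M.*2.+1 x).
  pose s := prefix_of (fbits phi 0 x) n.
  have xs : near_by phi M.*2.+1 x (cell_rep phi s) by exact: (nP n (leqnn n)).
  exists (pickle (s, M.*2.+1)); rewrite /f /good pickleK; case: ifPn.
    by move=> _; apply/hP; exact: near_by_sym.
  by case/asboolPn => y sy; apply: MV; exact: near_by_triangle xs sy.
(* The factor [m] pushes the sum beyond 1 eventually wherever some bump is positive; truncation at 1
   then gives the value 1. *)
pose g m x := m%:R * \sum_(n < m) f n x.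
have g0 m x : 0 <= g m x by rewrite mulr_ge0// sumr_ge0.
exists (fun m x => Num.min 1 (g m x)); split.
- move=> m x; apply: (@continuous_min _ _ (cst 1) (g m)); first exact: cvg_cst.
  apply: cvgM; first exact: cvg_cst.
  have cD : continuous (fun z : R * R => z.1 + z.2).
    by move=> z; apply: cvgD; [exact: cvg_fst|exact: cvg_snd].
  by apply: (cvg_big cD) => n _; exact: cf.
- by move=> m x; rewrite le_min ler01 g0 ge_min lexx.
- move=> m x; rewrite le_min !ge_min lexx/= orbC; apply/orP; left.
  rewrite /g big_ord_recr/= ler_pM// ?sumr_ge0 ?ler_nat//.
  by rewrite lerDl.
- move=> m x nVx; rewrite /g big1 ?mulr0; first by apply/min_idPr.
  move=> n _; apply/eqP; rewrite eq_le f0 andbT leNgt.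
  by apply/negP => /fV.
- move=> x /Vf[n fn]; pose m := maxn n.+1 (Num.truncn (f n x)^-1).+1.
  exists m; apply/min_idPl; rewrite -(@mulVf _ (f n x)) ?gt_eqF//.
  apply: ler_pM; [by rewrite invr_ge0|exact: f0| |].
    by rewrite ltW// (lt_le_trans (truncnS_gt _))// ler_nat leq_maxr.
  have nm : (n < m)%N by rewrite leq_maxl.
  by rewrite (bigD1 (Ordinal nm))//= lerDl sumr_ge0.
Qed.

End continuous_features.

Section transition_features.
Context (R : realType) (M : mdp R).
Local Notation X := (state M).
Local Notation A := (action M).
Local Notation p := (kernel_at (@trans R M)).
Local Open Scope ring_scope.

(** Apart from the compactness of the action space, this is the only form in which semicontinuity
    enters the construction of [Q]; it covers (S) and (W) alike. *)
Definition flsc_transition (phi : nat -> X -> R) (psi : nat -> A -> R) :=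
  forall V, fopen phi V -> forall r x a, r < fine (p (x, a) V) ->
  exists N, forall x' a', near_by phi N x x' -> near_by psi N a a' ->
    r < fine (p (x', a') V).

(** [V] is the increasing union of the sets where [u m] reaches 1. One of them already has mass
    above [r], and the integral of [u m], continuous by (W), lies between its mass and that of
    [V]. *)
Lemma semicontinuous_W_flsc (phi : nat -> X -> R) (psi : nat -> A -> R) :
  (forall i x, 0 <= phi i x <= 1) -> (forall i, continuous (phi i)) ->
  (forall O, open O -> fopen phi O) -> (forall O, open O -> fopen psi O) ->
  semicontinuous_W M -> flsc_transition phi psi.
Proof.
move=> phi01 cphi ophi opsi [_ W] V oV r x a rV.
have mphi := continuous_measurable_features cphi.
have mV : measurable (V : set (borel X)) by exact: (@measurable_fopen _ R (borel X) phi).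
have [u [cu u01 uS u0 u1]] := fopen_approximation phi01 cphi ophi oV.
have mu m : measurable_fun [set: borel X] (u m).
  exact: (continuous_measurable_features cu).
have bu m : bounded_mfun (u m : borel X -> R) by exact: bounded_mfun01.
pose F m := [set y : borel X | 1 <= u m y].
have mF m : measurable (F m).
  have := measurable_fun_ler (measurable_cst (1 : R)) (mu m).
  by move=> /(_ measurableT [set true] Logic.I); rewrite setTI.
have VF : V = \bigcup_m F m.
  apply/seteqP; split => [y /u1[m um]|y [m _]]; first by exists m => //=; rewrite /F/= um.
  by rewrite /F/= => um; apply: contrapT => /u0 um0; move: um; rewrite um0 ler10.
have [m rm] : exists m, r < fine (p (x, a) (F m)).
  apply/not_existsP => h; move: rV; apply/negP; rewrite -leNgt VF.
  apply: pr_le_bigcup => [//|m y um|m]; first exact: (le_trans um (uS m y)).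
  by rewrite leNgt; apply/negP; exact: h.
have Fu xa : fine (p xa (F m)) <= (\int[p xa]_y u m y)%R.
  rewrite -Rintegral_pr//; apply: le_Rintegralb; [exact: bounded_mfun_indic|exact: bu|].
  move=> y; case: (boolP (y \in F m)) => [|_]; first by rewrite inE.
  by have /andP[] := u01 m y.
have uV xa : (\int[p xa]_y u m y)%R <= fine (p xa V).
  rewrite -Rintegral_pr//; apply: le_Rintegralb; [exact: bu|exact: bounded_mfun_indic|].
  move=> y; case: (boolP (y \in V)) => [_|]; first by have /andP[] := u01 m y.
  by move=> /negP; rewrite inE => /u0 ->.
have cint := W (u m) (cu m) _.
have /cint/(_ (x, a)) : exists K : R, forall y, `|u m y| <= K.
  by exists 1 => y; have /andP[? ?] := u01 m y; rewrite ger0_norm.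
have rI : r < (\int[p (x, a)]_y u m y)%R by exact: lt_le_trans (Fu _).
move=> /cvgr_gt/(_ _ rI)[[B C] [/= nB nC] BC].
move: nB nC; rewrite !nbhsE => -[B' [oB' B'x] B'B] [C' [oC' C'a] C'C].
have [N1 N1B] := ophi _ oB' _ B'x; have [N2 N2C] := opsi _ oC' _ C'a.
exists (maxn N1 N2) => x' a' xx' aa'; apply: (lt_le_trans _ (uV _)).
apply: (BC (x', a')); split => /=.
  exact/B'B/N1B/(near_by_le (leq_maxl _ _) xx').
exact/C'C/N2C/(near_by_le (leq_maxr _ _) aa').
Qed.

End transition_features.

(** Syntax for the algebra of events refining the topology under (S): the sets are defined in terms
    of one another, and codes show that there are countably many of them. *)
Inductive event_code :=
  | Code_base of nat
  | Code_neg of event_code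
  | Code_and of event_code & event_code
  | Code_lower of event_code & seq bool & nat & rat.

Fixpoint encode_event (c : event_code) : GenTree.tree (nat + seq bool * nat * rat) :=
  match c with
  | Code_base n => GenTree.Node 0 [:: GenTree.Leaf (inl n)]
  | Code_neg c => GenTree.Node 1 [:: encode_event c]
  | Code_and c c' => GenTree.Node 2 [:: encode_event c; encode_event c']
  | Code_lower c s M q => GenTree.Node 3 [:: encode_event c; GenTree.Leaf (inr (s, M, q))]
  end.

Fixpoint decode_event (t : GenTree.tree (nat + seq bool * nat * rat)) : option event_code :=
  match t with
  | GenTree.Node 0 [:: GenTree.Leaf (inl n)] => Some (Code_base n)
  | GenTree.Node 1 [:: t] => omap Code_neg (decode_event t)
  | GenTree.Node 2 [:: t; t'] =>
      if decode_event t is Some c then omap (Code_and c) (decode_event t') else None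
  | GenTree.Node 3 [:: t; GenTree.Leaf (inr (s, M, q))] =>
      omap (fun c => Code_lower c s M q) (decode_event t)
  | _ => None
  end.

Lemma encode_eventK : pcancel encode_event decode_event.
Proof. by elim=> //= [c ->|c -> c' ->|c -> s M q]. Qed.

HB.instance Definition _ := Countable.copy event_code (pcan_type encode_eventK).

(* Under (S) the transition law is continuous in the action only. The topology
   of the state space is refined by countably many measurable sets, closed
   under [Code_lower], so that it becomes lower semicontinuous in both
   arguments. *)
Section strong_features.
Context (R : realType) (M : mdp R).
Local Notation X := (state M).
Local Notation A := (action M).
Local Notation p := (kernel_at (@trans R M)).
Local Open Scope ring_scope.
Variables (phi : nat -> X -> R) (psi : nat -> A -> R).
Hypothesis phi01 : forall i x, 0 <= phi i x <= 1.
Hypothesis cphi : forall i, continuous (phi i).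
Hypothesis ophi : forall O, open O -> fopen phi O.
Hypothesis psi01 : forall i a, 0 <= psi i a <= 1.
Hypothesis cpsi : forall i, continuous (psi i).
Hypothesis opsi : forall O, open O -> fopen psi O.
Hypothesis S : semicontinuous_S M.

(** [Code_lower] bounds the transition probability at cell representatives only, a countable family,
    so that the event is measurable; continuity in the action recovers the bound at all actions. *)
Fixpoint event (c : event_code) : set X :=
  match c with
  | Code_base n => [set x | fbits phi 0 x n]
  | Code_neg c => ~` event c
  | Code_and c c' => event c `&` event c'
  | Code_lower c s N q => [set x | forall s',
      near_by psi N (cell_rep psi s) (cell_rep psi s') ->
      ratr q <= fine (p (x, cell_rep psi s') (event c))]
  end.

Lemma measurable_event c : measurable (event c : set (borel X)).
Proof.
elim: c => [n|c ih|c ih c' ih'|c ih s N q] /=; [|exact: measurableC|exact: measurableI|].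
  rewrite /fbits; case: unpickle => [[i q]|]; last first.
    by rewrite (_ : mkset _ = set0)//; apply/seteqP; split.
  have := measurable_fun_ltr (measurable_cst (0 + ratr q : R))
    (continuous_measurable_features cphi i).
  by move=> /(_ measurableT [set true] Logic.I); rewrite setTI.
rewrite (_ : mkset _ = ~` \bigcup_s' (if `[< near_by psi N (cell_rep psi s)
    (cell_rep psi s') >] then ~` [set x | ratr q <= fine (p (x, cell_rep psi s') (event c))]
    else set0)).
  apply/measurableC/countable_bigcupT_measurable => [|s']; first exact: countableP.
  case: ifP => _ //; apply: measurableC.
  have mp : measurable_fun setT (fun x : borel X => fine (p (x, cell_rep psi s') (event c))).
    apply: (measurableT_comp (f := fun xa => fine (p xa (event c)))).
      exact: measurable_kernel_at.
    exact: measurable_pair2.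
  have := measurable_fun_ler (measurable_cst (ratr q : R)) mp.
  by move=> /(_ measurableT [set true] Logic.I); rewrite setTI.
apply/seteqP; split => [x h [s' _]|x h s' ss'].
  by case: ifPn => // /asboolP ss'; apply; exact: h.
apply: contrapT => h'; apply: h; exists s' => //.
by case: ifPn => // /asboolPn.
Qed.

Definition event_feature (n : nat) (x : X) : R :=
  if unpickle n is Some c then (`[< event c x >])%:R else 0.

Let ef01 i x : 0 <= event_feature i x <= 1.
Proof. by rewrite /event_feature; case: unpickle => [c|]; rewrite ?lexx ?ler01//; case: asbool; rewrite ?lexx ?ler01. Qed.

(** The features take the values 0 and 1, and two such values at distance below 1 agree. *)
Let near_event N x y : near_by event_feature N x y -> forall c, (pickle c < N)%N ->
  event c x <-> event c y.
Proof.
move=> xy c cN; have := xy _ cN; rewrite /event_feature pickleK.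
have N1 : N.+1%:R^-1 <= 1 :> R by rewrite invf_le1 ?ler1n ?ltr0n.
case: (asboolP (event c x)) => cx; case: (asboolP (event c y)) => cy //;
  rewrite ?subr0 ?sub0r ?normrN normr1 => /lt_le_trans => /(_ _ N1); by rewrite ltxx.
Qed.

Let measurable_event_feature i : measurable_fun [set: borel X] (event_feature i).
Proof.
rewrite /event_feature; case: unpickle => [c|]; last exact: measurable_cst.
rewrite (_ : (fun x => _) = \1_(event c)); last first.
  by apply/funext => x; rewrite indicE; congr (nat_of_bool _)%:R; apply/asboolP/idP; rewrite inE.
by apply: measurable_indic; exact: measurable_event.
Qed.

Let event_feature_open O : open O -> fopen event_feature O.
Proof.
move=> oO x Ox; have [n nO] := fopen_cell phi01 0 (ophi oO) Ox.
exists (\max_(i < n) (pickle (Code_base i)).+1) => y /near_event xy; apply: nO.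
apply/prefix_ofP => i ni.
have : (pickle (Code_base i) < \max_(i < n) (pickle (Code_base i)).+1)%N.
  exact: (@leq_bigmax _ (fun i : 'I_n => (pickle (Code_base i)).+1) (Ordinal ni)).
by move=> /xy /= h; apply/idP/idP => /h.
Qed.

(** A basic neighborhood fixes the membership in finitely many events, and the algebra is closed
    under complement and intersection. *)
Let neighborhood_code N x : exists c, event c x /\ event c `<=` near_by event_feature N x.
Proof.
suff [c [cx cN]] : exists c, event c x /\ forall y, event c y ->
    forall i, (i < N)%N -> event_feature i x = event_feature i y.
  exists c; split => // y /cN xy i iN.
  by rewrite xy// subrr normr0 invr_gt0 ltr0n.
elim: N => [|N [c [cx cN]]].
  by exists (Code_neg (Code_and (Code_base 0) (Code_neg (Code_base 0)))); split => //= -[].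
have [c' [c'x c'N]] : exists c', event c' x /\ forall y, event c' y ->
    event_feature N x = event_feature N y.
  rewrite /event_feature; case: unpickle => [c'|]; last by exists c.
  have [c'x|c'x] := pselect (event c' x).
    by exists c'; split => // y c'y; rewrite !asboolT.
  by exists (Code_neg c'); split => // y c'y; rewrite !asboolF.
exists (Code_and c c'); split => // y [cy c'y] i.
by rewrite ltnS leq_eqVlt => /orP[/eqP->|]; [exact: c'N|exact: cN].
Qed.

Let continuous_event c x : continuous (fun a : A => fine (p (x, a) (event c))).
Proof.
have [_ /(_ x (fun y => (y \in event c)%:R))] := S.
have mc := measurable_event c.
move=> /(_ (bounded_mfun_indic R mc).1 (bounded_mfun_indic R mc).2) h a.
have -> : (fun a => fine (p (x, a) (event c))) =
    (fun a => \int[trans M (x, a)]_y (y \in event c)%:R)%R.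
  by apply/funext => b; exact: (esym (Rintegral_pr (p (x, b)) mc)).
exact: h.
Qed.

(** For a rational [q] just above [r], the bound by [q] near [a] is itself an event containing [x].
    Hence it is shared by all states close to [x], and continuity in the action carries it to every
    action close to [a]. *)
Let event_lsc c r x a : r < fine (p (x, a) (event c)) ->
  exists N, forall x' a', near_by event_feature N x x' -> near_by psi N a a' ->
    r < fine (p (x', a') (event c)).
Proof.
move=> rc; have [q /andP[rq qc]] := rat_in_itvoo rc.
have /(cvgr_gt _ (@continuous_event c x a)) := qc.
rewrite nbhsE => -[V [oV Va] Vc].
have [N0 N0V] := opsi oV Va.
(* Two halvings: one to go from [a] through the representative of [s] to nearby representatives, one
   to go from that representative through [a] to [a']. *)
pose N1 := N0.*2.+1; pose N2 := N1.*2.+1.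
have [m _ mP] := cell_rep_cvg psi01 opsi (near_by_nbhs cpsi N2 a).
pose s := prefix_of (fbits psi 0 a) m.
have as_ : near_by psi N2 a (cell_rep psi s) by exact: (mP m (leqnn m)).
pose d := Code_lower c s N1 q.
have dx : event d x.
  move=> s' ss'; apply/ltW/Vc/N0V; apply: near_by_triangle ss'.
  have le2 k : (k <= k.*2.+1)%N by rewrite leqW// -addnn leq_addr.
  exact: (near_by_le (le2 N1) as_).
exists (maxn N2 (pickle d).+1) => x' a' xx' aa'.
have dx' : event d x' by exact: (near_event xx' (leq_maxr N2 (pickle d).+1)).1 dx.
have sa' : near_by psi N1 (cell_rep psi s) a'.
  by apply: near_by_triangle (near_by_sym as_) (near_by_le (leq_maxl _ _) aa').
apply: (lt_le_trans rq).
have cvg_reps := cell_rep_cvg psi01 opsi (x := a').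
(* The probability at [a'] is the limit of those at its cell representatives, which eventually fall
   in the range of the event [d]. *)
have := cvg_comp _ _ cvg_reps (@continuous_event c x' a').
move=> /(cvgr_to_ge (b := ratr q)); apply.
have [N3 N3s] : exists N, near_by psi N a' `<=` near_by psi N1 (cell_rep psi s).
  pose f i := N1.+1%:R^-1 - `|psi i (cell_rep psi s) - psi i a'|.
  have : nbhs a' (near_by psi N1 (cell_rep psi s)).
    have : \forall y \near a', forall i : 'I_N1,
        `|psi i (cell_rep psi s) - psi i y| < N1.+1%:R^-1.
      apply: filter_forall => i.
      have : (fun y => `|psi i (cell_rep psi s) - psi i y|) @ a' -->
          `|psi i (cell_rep psi s) - psi i a'|.
        by apply: cvg_norm; apply: cvgB; [exact: cvg_cst|exact: cpsi].
      by move=> /cvgr_lt; apply; exact: sa'.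
    by apply: filterS => y h i iN; exact: (h (Ordinal iN)).
  rewrite nbhsE => -[W [oW Wa'] Ws].
  by have [N NW] := opsi oW Wa'; exists N => y /NW /Ws.
have near3 : \forall k \near \oo,
    near_by psi N3 a' (cell_rep psi (prefix_of (fbits psi 0 a') k)).
  exact: cvg_reps (near_by_nbhs cpsi N3 a').
by apply: filterS near3 => k /N3s; exact: dx'.
Qed.

Lemma semicontinuous_S_flsc : flsc_transition event_feature psi.
Proof.
move=> V oV r x a rV.
pose good n := if unpickle n is Some c then `[< event c `<=` V >] else false.
pose F n := if unpickle n is Some c then if good n then c else Code_and (Code_base 0) (Code_neg (Code_base 0))
  else Code_and (Code_base 0) (Code_neg (Code_base 0)).
(* Codes of finite unions, written by De Morgan; the contradictory code stands for the empty set. *)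
pose G := fix G n := if n is m.+1 then
  Code_neg (Code_and (Code_neg (G m)) (Code_neg (F m))) else Code_and (Code_base 0) (Code_neg (Code_base 0)).
have FV n : event (F n) `<=` V.
  rewrite /F /good; case: unpickle => [c|]; last by move=> y [].
  by case: ifPn => [/asboolP//|_ y []].
have GS n : event (G n.+1) = event (G n) `|` event (F n).
  by rewrite /= -[RHS]setCK setCU.
have GV n : event (G n) `<=` V.
  elim: n => [y []//|n ih]; rewrite GS => y [/ih//|]; exact: FV.
have VE : V = \bigcup_n event (G n).
  apply/seteqP; split => [y Vy|y [n _ /GV]//].
  have [N NV] := oV y Vy; have [c [cy cN]] := neighborhood_code N y.
  exists (pickle c).+1 => //; rewrite GS; right.
  rewrite /F /good pickleK; case: ifPn => // /asboolPn h; exfalso; apply: h.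
  by move=> z /cN /NV.
have [n rn] : exists n, r < fine (p (x, a) (event (G n))).
  apply/not_existsP => h; move: rV; apply/negP; rewrite -leNgt VE.
  apply: pr_le_bigcup => [n|n|n]; first exact: measurable_event.
    by rewrite GS; exact: subsetUl.
  by rewrite leNgt; apply/negP; exact: h.
have [N NP] := event_lsc rn.
exists N => x' a' xx' aa'; apply: (lt_le_trans (NP _ _ xx' aa')).
apply: pr_le; [exact: measurable_event| |exact: GV].
exact: (@measurable_fopen _ R (borel X) event_feature).
Qed.

Lemma strong_features : exists phi' : nat -> X -> R,
  [/\ forall i x, 0 <= phi' i x <= 1,
      forall i, measurable_fun [set: borel X] (phi' i),
      forall O, open O -> fopen phi' O & flsc_transition phi' psi].
Proof. by exists event_feature; split => //; exact: semicontinuous_S_flsc. Qed.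

End strong_features.

Lemma transition_features (R : realType) (M : mdp R) (psi : nat -> action M -> R) :
  (forall i a, (0 <= psi i a <= 1)%R) -> (forall i, continuous (psi i)) ->
  (forall O, open O -> fopen psi O) -> semicontinuous M ->
  exists phi : nat -> state M -> R,
  [/\ forall i x, (0 <= phi i x <= 1)%R,
      forall i, measurable_fun [set: borel (state M)] (phi i),
      forall O, open O -> fopen phi O & flsc_transition phi psi].
Proof.
move=> psi01 cpsi opsi scM.
have [phi [phi01 cphi ophi]] := topological_borel_space_features (state_borel M).
case: scM => [S|W]; first exact: strong_features S.
exists phi; split => //; first exact: continuous_measurable_features.
exact: semicontinuous_W_flsc.
Qed.

(** * Trajectories *)

Lemma measurable_by_features d (Z : measurableType d) (R : realType)
    (T : ptopologicalType) (phi : nat -> T -> R) (f : Z -> T) :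
  (forall i x, (0 <= phi i x <= 1)%R) -> (forall O, open O -> fopen phi O) ->
  (forall i, measurable_fun setT (fun z => phi i (f z))) ->
  measurable_fun setT (f : Z -> borel T).
Proof.
move=> phi01 ophi mf; apply: (@measurability _ _ Z (borel T) setT f (@open T)) => //.
move=> _ [V oV <-]; rewrite setTI.
apply: (@measurable_fopen _ R Z (fun i z => phi i (f z))) => // z Vz.
by have [N NV] := ophi V oV _ Vz; exists N => z' zz'; apply: NV.
Qed.

Lemma cvg_near_by (R : realType) (T : topologicalType) (phi : nat -> T -> R)
    (u : nat -> T) (x : T) : (forall O, open O -> fopen phi O) ->
  (forall N, exists m, forall k, (m <= k)%N -> near_by phi N x (u k)) -> u @ \oo --> x.
Proof.
move=> ophi ux V; rewrite nbhsE => -[W [oW Wx] WV].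
have [N NW] := ophi W oW x Wx; have [m mN] := ux N.
by exists m => // k /mN/NW/WV.
Qed.

Section trajectories.
Context (R : realType) (M : mdp R).
Local Notation X := (state M).
Local Notation A := (action M).
Local Notation Om := (trajectory M).
Variables (phi : nat -> X -> R) (psi : nat -> A -> R).

(* Coordinate [2 t] of a trajectory is the state of time [t] and coordinate
   [2 t + 1] the action following it. *)
Definition coord_feature (c j : nat) (w : Om) : R :=
  if odd c then psi j (action_after c./2 w) else phi j (state_at c./2 w).

Definition trajectory_feature (n : nat) (w : Om) : R :=
  if unpickle n is Some (c, j) then coord_feature c j w else 0%R.

(** Features of later coordinates are replaced by a constant, so that every level keeps the same
    index set and the same space. *)
Definition level_feature (k n : nat) (w : Om) : R :=
  if unpickle n is Some (c, j) then
    if (c <= k)%N then coord_feature c j w else 0%R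
  else 0%R.

Definition near_coords (k N : nat) (w w' : Om) : Prop :=
  forall c, (c <= k)%N ->
    if odd c then near_by psi N (action_after c./2 w) (action_after c./2 w')
    else near_by phi N (state_at c./2 w) (state_at c./2 w').

Definition trunc_at (k : nat) (w : Om) : Om :=
  (w.1, fun s => (if (s.*2.+1 <= k)%N then (w.2 s).1 else point,
                  if (s.*2.+2 <= k)%N then (w.2 s).2 else point)).

(** Events determined by the coordinates up to [k]. Invariance under truncation expresses this
    without a separate product space for each length. *)
Definition level (k : nat) (E : set (borel Om)) :=
  measurable E /\ trunc_at k @^-1` E = E.

Hypothesis phi01 : forall i x, (0 <= phi i x <= 1)%R.
Hypothesis mphi : forall i, measurable_fun [set: borel X] (phi i).
Hypothesis ophi : forall O, open O -> fopen phi O.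
Hypothesis psi01 : forall i a, (0 <= psi i a <= 1)%R.
Hypothesis mpsi : forall i, measurable_fun [set: borel A] (psi i).
Hypothesis opsi : forall O, open O -> fopen psi O.

Lemma near_coordsP k N w w' : near_coords k N w w' <->
  forall c j, (c <= k)%N -> (j < N)%N ->
    (`|coord_feature c j w - coord_feature c j w'| < N.+1%:R^-1)%R.
Proof.
rewrite /coord_feature; split => [h c j ck jN|h c ck].
  by have := h c ck; case: ifP => _; exact.
by have := h c ^~ ck; case: ifP => _ h' j jN; exact: h'.
Qed.

Lemma near_coords_level k N : exists N', forall w w',
  near_coords k N' w w' -> near_by (level_feature k) N w w'.
Proof.
exists (maxn N (\max_(i < N) (odflt (0, 0)%N (unpickle i)).2.+1)) => w w' /near_coordsP h n nN.
rewrite /level_feature; case un : (unpickle n) => [[c j]|]; last first.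
  by rewrite subrr normr0 invr_gt0 ltr0n.
case: ifPn => ck; last by rewrite subrr normr0 invr_gt0 ltr0n.
apply: (@lt_le_trans _ _ ((maxn N (\max_(i < N) (odflt (0, 0)%N (unpickle i)).2.+1)).+1%:R^-1)%R).
  apply: h => //; rewrite leq_max; apply/orP; right.
  have := @leq_bigmax _ (fun i : 'I_N => (odflt (0, 0)%N (unpickle i : option (nat * nat))).2.+1) (Ordinal nN).
  by rewrite /= un.
by rewrite lef_pV2 ?posrE ?ltr0n// ler_nat ltnS leq_maxl.
Qed.

Lemma level_near_coords k N : exists N', forall w w',
  near_by (level_feature k) N' w w' -> near_coords k N w w'.
Proof.
pose m := \max_(i < k.+1) \max_(j < N) (pickle (nat_of_ord i, nat_of_ord j)).+1.
exists (maxn N m) => w w' h; apply/near_coordsP => c j ck jN.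
have cjm : (pickle (c, j) < m)%N.
  have ck' : (c < k.+1)%N by [].
  apply: leq_trans (@leq_bigmax _ (fun i : 'I_k.+1 =>
    \max_(j < N) (pickle (nat_of_ord i, nat_of_ord j)).+1) (Ordinal ck')).
  exact: (@leq_bigmax _ (fun j : 'I_N => (pickle (c, nat_of_ord j)).+1) (Ordinal jN)).
have := h (pickle (c, j)); rewrite /level_feature pickleK ck.
move=> /(_ (leq_trans cjm (leq_maxr N m))) /lt_le_trans; apply.
by rewrite lef_pV2 ?posrE ?ltr0n// ler_nat ltnS leq_maxl.
Qed.

Lemma fopen_levelP k O : fopen (level_feature k) O <->
  forall w, O w -> exists N, forall w', near_coords k N w w' -> O w'.
Proof.
split => oO w Ow.
  have [N NO] := oO w Ow; have [N' N'P] := near_coords_level k N.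
  by exists N' => w' /N'P/NO.
have [N NO] := oO w Ow; have [N' N'P] := level_near_coords k N.
by exists N' => w' /N'P/NO.
Qed.

Lemma near_coords_refl k N w : near_coords k N w w.
Proof. by move=> c _; case: ifP => _; exact: near_by_refl. Qed.

Lemma near_coords_le k k' N N' w w' : (k <= k')%N -> (N <= N')%N ->
  near_coords k' N' w w' -> near_coords k N w w'.
Proof.
move=> kk' NN' h c ck; have := h c (leq_trans ck kk').
by case: ifP => _; exact: near_by_le.
Qed.

Lemma coord_feature01 c j w : (0 <= coord_feature c j w <= 1)%R.
Proof. by rewrite /coord_feature; case: ifP. Qed.

Lemma trajectory_feature01 n w : (0 <= trajectory_feature n w <= 1)%R.
Proof.
rewrite /trajectory_feature; case: unpickle => [[c j]|]; last by rewrite lexx ler01.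
exact: coord_feature01.
Qed.

Lemma level_feature01 k n w : (0 <= level_feature k n w <= 1)%R.
Proof.
rewrite /level_feature; case: unpickle => [[c j]|]; last by rewrite lexx ler01.
by case: ifP => _; [exact: coord_feature01|rewrite lexx ler01].
Qed.

Lemma measurable_state_at t : measurable_fun setT (@state_at R M t : borel Om -> borel X).
Proof. exact: (continuous_borel (@continuous_state_at _ M t)). Qed.

Lemma measurable_action_after t :
  measurable_fun setT (@action_after R M t : borel Om -> borel A).
Proof. exact: (continuous_borel (@continuous_action_after _ M t)). Qed.

Lemma measurable_coord_feature c j : measurable_fun [set: borel Om] (coord_feature c j).
Proof.
rewrite /coord_feature; case: (odd c).
  exact: (measurableT_comp (mpsi j) (@measurable_action_after _)).
exact: (measurableT_comp (mphi j) (@measurable_state_at _)).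
Qed.

Lemma measurable_level_feature k n : measurable_fun [set: borel Om] (level_feature k n).
Proof.
rewrite /level_feature; case: unpickle => [[c j]|]; last exact: measurable_cst.
by case: (c <= k)%N; [exact: measurable_coord_feature|exact: measurable_cst].
Qed.

Lemma measurable_fopen_level k O : fopen (level_feature k) O ->
  measurable (O : set (borel Om)).
Proof.
apply: (@measurable_fopen _ R (borel Om)) => n; first exact: level_feature01.
exact: measurable_level_feature.
Qed.

(** Otherwise some [v k] outside [O] agrees with [w] up to level and tolerance [k], for each [k];
    these converge to [w] in every coordinate, hence in the product topology. *)
Lemma open_level_nbhs (O : set Om) w : open O -> O w ->
  exists k, forall w', near_coords k k w w' -> O w'.
Proof.
move=> oO Ow; apply: contrapT => /forallNP h.
have /choice[v vP] : forall k, exists w', near_coords k k w w' /\ ~ O w'.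
  by move=> k; have /existsNP[w' /not_implyP] := h k; exists w'.
have vst t : (fun k => state_at t (v k)) @ \oo --> state_at t w.
  apply: (cvg_near_by ophi) => N; exists (maxn N t.*2) => k; rewrite geq_max => /andP[Nk tk].
  have := (vP k).1 _ tk; rewrite odd_double doubleK => h'; exact: (near_by_le Nk h').
have vac t : (fun k => action_after t (v k)) @ \oo --> action_after t w.
  apply: (cvg_near_by opsi) => N; exists (maxn N t.*2.+1) => k; rewrite geq_max => /andP[Nk tk].
  have := (vP k).1 _ tk; rewrite /= odd_double/= uphalf_double => h'; exact: (near_by_le Nk h').
have v2 : (fun k => (v k).2 : prod_topology (fun _ : nat => (A * X)%type)) @ \oo -->
    (w.2 : prod_topology (fun _ : nat => (A * X)%type)).
  apply/cvg_sup => t U [V] [[W] oW <-] Wt WU.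
  have cv : (fun k => (action_after t (v k), state_at t.+1 (v k))) @ \oo -->
      (action_after t w, state_at t.+1 w).
    by apply: cvg_pair; [exact: vac|exact: (vst t.+1)].
  have nW : nbhs (action_after t w, state_at t.+1 w) W.
    apply: open_nbhs_nbhs; split => //.
    by move: Wt; rewrite /proj/= /action_after; case: (w.2 t).
  have nWk : \forall k \near \oo, W (action_after t (v k), state_at t.+1 (v k)) := cv _ nW.
  apply: filterS nWk => k Wk; apply: WU.
  by rewrite /preimage/= /proj/=; move: Wk; rewrite /action_after/=; case: ((v k).2 t).
have vw : v @ \oo --> w.
  have := cvg_pair (vst 0%N : (fun k => (v k).1) @ \oo --> w.1) v2.
  rewrite (_ : (fun k => ((v k).1, (v k).2)) = v); last by apply/funext => k; case: (v k).
  by move=> c V nV; apply: c; move: nV; case: (w) => ? ?.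
have [N _ /(_ N (leqnn N)) ON] := vw _ (open_nbhs_nbhs (conj oO Ow)).
by have [_] := vP N; apply.
Qed.

Lemma open_fopen_trajectory (O : set Om) : open O -> fopen trajectory_feature O.
Proof.
move=> oO w Ow; have [k kO] := open_level_nbhs oO Ow.
have [N NP] := level_near_coords k k; exists N => w' h; apply/kO/NP => n nN.
have := h n nN; rewrite /trajectory_feature /level_feature.
case: unpickle => [[c j]|]//; case: ifP => // _ _.
by rewrite subrr normr0 invr_gt0 ltr0n.
Qed.

(** Open sets of trajectories are [fopen] for countably many features of single coordinates, so
    coordinates generate the Borel sets. *)
Lemma measurable_to_trajectory d (Z : measurableType d) (f : Z -> Om) :
  (forall t, measurable_fun setT (fun z => state_at t (f z) : borel X)) ->
  (forall t, measurable_fun setT (fun z => action_after t (f z) : borel A)) ->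
  measurable_fun setT (f : Z -> borel Om).
Proof.
move=> ms ma; apply: (measurable_by_features trajectory_feature01 open_fopen_trajectory).
move=> n; rewrite /trajectory_feature; case: unpickle => [[c j]|]; last exact: measurable_cst.
rewrite /coord_feature; case: (odd c).
  exact: (measurableT_comp (mpsi j) (ma _)).
exact: (measurableT_comp (mphi j) (ms _)).
Qed.

Lemma measurable_trunc_at k : measurable_fun setT (trunc_at k : borel Om -> borel Om).
Proof.
apply: measurable_to_trajectory => t.
  case: t => [|t]; first exact: (@measurable_state_at 0).
  rewrite /state_at/=; case: (_ <= k)%N; last exact: measurable_cst.
  exact: (@measurable_state_at t.+1).
rewrite /action_after/=; case: (_ <= k)%N; last exact: measurable_cst.
exact: (@measurable_action_after t).
Qed.

Lemma state_at_trunc k t w : (t.*2 <= k)%N -> state_at t (trunc_at k w) = state_at t w.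
Proof. by case: t => [|t]//; rewrite /state_at/= doubleS => ->. Qed.

Lemma action_after_trunc k t w : (t.*2.+1 <= k)%N ->
  action_after t (trunc_at k w) = action_after t w.
Proof. by rewrite /action_after/= => ->. Qed.

Lemma history_trunc k t w : (t.*2 <= k)%N -> history t (trunc_at k w) = history t w.
Proof.
move=> tk; rewrite /history; congr pair; apply: eq_mktuple => i.
have ik : (i.*2.+2 <= k)%N by rewrite (leq_trans _ tk)// -doubleS leq_double.
by rewrite /= ik (ltnW ik); case: (w.2 i).
Qed.

Lemma trunc_trunc k k' w : (k <= k')%N -> trunc_at k (trunc_at k' w) = trunc_at k w.
Proof.
move=> kk'; rewrite /trunc_at/=; congr pair; apply/funext => s.
by congr pair; case: ifP => // sk; rewrite (leq_trans sk kk').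
Qed.

Lemma coord_feature_trunc k c j w : (c <= k)%N ->
  coord_feature c j (trunc_at k w) = coord_feature c j w.
Proof.
move=> ck; rewrite /coord_feature; case: ifP => oc.
  rewrite action_after_trunc//.
  by rewrite -[X in (X.*2.+1 <= _)%N]/c./2 -[(_.*2).+1]/(true + c./2.*2)%N -oc odd_double_half.
rewrite state_at_trunc//; move: (odd_double_half c); rewrite oc add0n => ->.
exact: ck.
Qed.

Lemma level_le k k' E : (k <= k')%N -> level k E -> level k' E.
Proof.
move=> kk' [mE tE]; split => //; apply/funext => w.
have e v : E (trunc_at k v) = E v by exact: (congr1 (@^~ v) tE).
by rewrite /preimage/= -e trunc_trunc// e.
Qed.

Lemma fopen_level_level k O : fopen (level_feature k) O -> level k O.
Proof.
move=> oO; split; first exact: measurable_fopen_level oO.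
move/fopen_levelP : oO => oO.
have h w w' : (forall c j, (c <= k)%N -> coord_feature c j w = coord_feature c j w') ->
    O w -> O w'.
  move=> ww' Ow; have [N NO] := oO w Ow; apply: NO; apply/near_coordsP => c j ck _.
  by rewrite ww'// subrr normr0 invr_gt0 ltr0n.
apply/seteqP; split => w; apply: h => c j ck; by rewrite coord_feature_trunc.
Qed.

Lemma measurable_history t : measurable_fun [set: borel Om] (@history R M t).
Proof.
apply: measurable_fun_pair; first exact: (@measurable_state_at 0).
apply/measurable_fun_tnthP => i; rewrite (_ : _ \o _ = fun w : Om => w.2 i); last first.
  by apply/funext => w /=; rewrite tnth_mktuple.
rewrite (_ : (fun w : Om => w.2 i) = fun w => (action_after i w, state_at i.+1 w)).
  by apply: measurable_fun_pair; [exact: measurable_action_after|exact: (@measurable_state_at i.+1)].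
by apply/funext => w; rewrite /action_after/=; case: (w.2 i).
Qed.

(** Coordinates are overwritten in place. The laws built this way are meaningful only on events of
    the level already reached; later coordinates are arbitrary. *)
Definition put_state t (wy : Om * X) : Om :=
  if t is s.+1 then (wy.1.1, fun r => if r == s then ((wy.1.2 r).1, wy.2) else wy.1.2 r)
  else (wy.2, wy.1.2).

Definition put_action t (wa : Om * A) : Om :=
  (wa.1.1, fun s => if s == t then (wa.2, (wa.1.2 s).2) else wa.1.2 s).

Lemma state_at_put_state t s w y :
  state_at s (put_state t (w, y)) = if s == t then y else state_at s w.
Proof.
by case: t s => [|t] [|s]//=; rewrite eqSS; case: eqP.
Qed.

Lemma action_after_put_state t s w y :
  action_after s (put_state t (w, y)) = action_after s w.
Proof. by case: t => [|t]//=; rewrite /action_after/=; case: eqP. Qed.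

Lemma state_at_put_action t s w a : state_at s (put_action t (w, a)) = state_at s w.
Proof. by case: s => [|s]//=; case: eqP. Qed.

Lemma action_after_put_action t s w a :
  action_after s (put_action t (w, a)) = if s == t then a else action_after s w.
Proof. by rewrite /action_after/=; case: eqP. Qed.

Lemma measurable_put_state t :
  measurable_fun [set: borel Om * borel X] (put_state t : _ -> borel Om).
Proof.
apply: measurable_to_trajectory => s.
  rewrite (_ : (fun _ => _) = (fun wy : borel Om * borel X => if s == t then wy.2 else state_at s wy.1)).
    case: (s == t); first exact: measurable_snd.
    exact: (measurableT_comp (@measurable_state_at s) measurable_fst).
  by apply/funext => -[w y]; rewrite state_at_put_state.
rewrite (_ : (fun _ => _) = (fun wy : borel Om * borel X => action_after s wy.1)).
  exact: (measurableT_comp (@measurable_action_after s) measurable_fst).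
by apply/funext => -[w y]; rewrite action_after_put_state.
Qed.

Lemma measurable_put_action t :
  measurable_fun [set: borel Om * borel A] (put_action t : _ -> borel Om).
Proof.
apply: measurable_to_trajectory => s.
  rewrite (_ : (fun _ => _) = (fun wa : borel Om * borel A => state_at s wa.1)).
    exact: (measurableT_comp (@measurable_state_at s) measurable_fst).
  by apply/funext => -[w a]; rewrite state_at_put_action.
rewrite (_ : (fun _ => _) = (fun wa : borel Om * borel A => if s == t then wa.2 else action_after s wa.1)).
  case: (s == t); first exact: measurable_snd.
  exact: (measurableT_comp (@measurable_action_after s) measurable_fst).
by apply/funext => -[w a]; rewrite action_after_put_action.
Qed.

End trajectories.

(** * Image laws, mixtures and precomposed kernels *)

Lemma rectangle_measure_unique d1 d2 (T1 : measurableType d1) (T2 : measurableType d2)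
    (R : realType) (m1 m2 : {measure set (T1 * T2) -> \bar R}) :
  m1 setT < +oo ->
  (forall A B, measurable A -> measurable B -> m1 (A `*` B) = m2 (A `*` B)) ->
  forall E, measurable E -> m1 E = m2 E.
Proof.
move=> m1oo m12 E mE.
apply: (@g_sigma_algebra_measure_unique _ R (T1 * T2)%type
  [set A `*` B | A in measurable & B in measurable] _ (fun=> setT)) => //.
- by move=> _ [A mA [B mB <-]]; exact: measurableX.
- by move=> _; exists setT => //; exists setT => //; rewrite setXTT.
- by rewrite bigcup_const//; exists 0%N.
- move=> _ _ [A mA [B mB <-]] [C mC [D mD <-]]; exists (A `&` C); first exact: measurableI.
  by exists (B `&` D); [exact: measurableI|rewrite setXI].
- by move=> _ [A mA [B mB <-]]; exact: m12.
- by rewrite -measurable_prod_measurableType.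
Qed.

Section image_law.
Context d1 d2 (Z : measurableType d1) (W : measurableType d2) (R : realType).
Variables (Q : probability Z R) (f : Z -> W) (mf : measurable_fun setT f).

Let image : set W -> \bar R := fun A => Q (f @^-1` A).

Let image0 : image set0 = 0. Proof. exact: measure0. Qed.

Let image_ge0 A : 0 <= image A. Proof. exact: measure_ge0. Qed.

Let image_sigma_additive : semi_sigma_additive image.
Proof. exact: (@measure_semi_sigma_additive _ _ _ (pushforward Q f)). Qed.

HB.instance Definition _ := isMeasure.Build _ _ _ image
  image0 image_ge0 image_sigma_additive.

Let imageT : image setT = 1.
Proof. by rewrite /image preimage_setT probability_setT. Qed.

HB.instance Definition _ := Measure_isProbability.Build _ _ _ image imageT.

Definition image_law : probability W R := image.

End image_law.

Section mixture.
Context d1 d2 d3 (Z : measurableType d1) (Y : measurableType d2) (W : measurableType d3).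
Context (R : realType) (Q : probability Z R) (k : R.-pker Z ~> Y).
Variables (g : Z * Y -> W) (mg : measurable_fun setT g).

(** The law of [g (z, y)] when [z] has law [Q] and [y] has law [k z]. *)
Definition mixture (E : set W) : \bar R := \int[Q]_z k z [set y | E (g (z, y))].

Lemma measurable_mixture_section E z : measurable E -> measurable [set y | E (g (z, y))].
Proof.
move=> mE; apply: (measurable_preimage (f := fun y => g (z, y))) => //.
by apply: (measurableT_comp mg); exact: measurable_pair1.
Qed.

Lemma measurable_mixture_integrand E : measurable E ->
  measurable_fun setT (fun z => k z [set y | E (g (z, y))]).
Proof.
move=> mE; have mgE := measurable_preimage mg mE.
have := measurable_fun_xsection_finite_kernel k (mem_set mgE).
apply: eq_measurable_fun => z _ /=.
rewrite (_ : xsection _ z = [set y | E (g (z, y))])//.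
by apply/seteqP; split => y; rewrite /xsection/= inE.
Qed.

Let mixture0 : mixture set0 = 0.
Proof. by rewrite /mixture integral0_eq// => z _; rewrite (_ : mkset _ = set0) ?measure0//; apply/seteqP; split. Qed.

Let mixture_ge0 E : 0 <= mixture E.
Proof. by apply: integral_ge0 => z _; exact: measure_ge0. Qed.

Let mixture_sigma_additive : semi_sigma_additive mixture.
Proof.
move=> F mF tF mUF; rewrite [X in _ --> X](_ : _ = \sum_(n <oo) mixture (F n)).
  exact: is_cvg_ereal_nneg_natsum.
rewrite /mixture -integral_nneseries//; last by move=> n; exact: measurable_mixture_integrand.
apply: eq_integral => z _.
rewrite (_ : mkset _ = \bigcup_n [set y | F n (g (z, y))]); last first.
  by apply/seteqP; split.
rewrite measure_bigcup//; first by apply: eq_eseriesl => n; rewrite in_setT.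
  by move=> n _; exact: measurable_mixture_section.
apply/trivIsetP => m n _ _ mn; apply/seteqP; split => // y [/= Fm Fn].
by move/trivIsetP : tF => /(_ m n Logic.I Logic.I mn)/seteqP[+ _]; apply; split; [exact: Fm|exact: Fn].
Qed.

HB.instance Definition _ := isMeasure.Build _ _ _ mixture
  mixture0 mixture_ge0 mixture_sigma_additive.

Let mixtureT : mixture setT = 1.
Proof.
rewrite /mixture (_ : (fun z => _) = cst 1); last first.
  by apply/funext => z; exact: prob_kernel.
by rewrite integral_cst// mul1e; exact: probability_setT.
Qed.

HB.instance Definition _ := Measure_isProbability.Build _ _ _ mixture mixtureT.

Definition mixture_law : probability W R := mixture.

Lemma mixture_rectangle (E : set Z) (G : set Y) (F : set W) : measurable E ->
  (forall z y, F (g (z, y)) <-> E z /\ G y) ->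
  mixture F = \int[Q]_(z in E) k z G.
Proof.
move=> mE FEG; rewrite [RHS]integral_mkcond /mixture; apply: eq_integral => z _.
rewrite patchE; case: (boolP (z \in E)) => [|/negP]; rewrite inE => Ez.
  rewrite (_ : [set y | F (g (z, y))] = G)//.
  by apply/seteqP; split => y /=; [move=> /FEG[]|move=> Gy; apply/FEG].
by rewrite (_ : mkset _ = set0) ?measure0//; apply/seteqP; split => // y /FEG[].
Qed.

End mixture.

Section kernel_precomposition.
Context d1 d2 d3 (Z : measurableType d1) (H : measurableType d2) (Y : measurableType d3).
Context (R : realType) (k : R.-pker H ~> Y) (h : Z -> H) (mh : measurable_fun setT h).

Definition kernel_precomp : Z -> {measure set Y -> \bar R} := fun z => k (h z).

Let measurable_kernel_precomp B : measurable B -> measurable_fun setT (kernel_precomp ^~ B).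
Proof. by move=> mB; apply: (measurableT_comp (f := k ^~ B)) => //; exact: measurable_kernel. Qed.

HB.instance Definition _ := isKernel.Build _ _ _ _ _ kernel_precomp measurable_kernel_precomp.

Let kernel_precompT z : kernel_precomp z setT = 1.
Proof. exact: prob_kernel. Qed.

HB.instance Definition _ := Kernel_isProbability.Build _ _ _ _ _ kernel_precomp kernel_precompT.

Definition precomp_pker : R.-pker Z ~> Y := kernel_precomp.

End kernel_precomposition.

(** * Adding a state coordinate *)

Section state_step.
Context (R : realType) (M : mdp R).
Local Notation X := (state M).
Local Notation A := (action M).
Local Notation Om := (trajectory M).
Variables (phi : nat -> X -> R) (psi : nat -> A -> R).
Hypothesis phi01 : forall i x, (0 <= phi i x <= 1)%R.
Hypothesis mphi : forall i, measurable_fun [set: borel X] (phi i).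
Hypothesis ophi : forall O, open O -> fopen phi O.
Hypothesis psi01 : forall i a, (0 <= psi i a <= 1)%R.
Hypothesis mpsi : forall i, measurable_fun [set: borel A] (psi i).
Hypothesis opsi : forall O, open O -> fopen psi O.
Hypothesis lsc : flsc_transition phi psi.
Local Notation p := (kernel_at (@trans R M)).
Local Notation mst := (@measurable_state_at R M).
Local Notation mac := (@measurable_action_after R M).

Let mput_state t := measurable_put_state phi01 mphi ophi psi01 mpsi opsi t.

Let state_action_now t (w : borel Om) : borel X * borel A :=
  (state_at t w, action_after t w).

Let measurable_state_action_now t : measurable_fun setT (state_action_now t).
Proof. by apply: measurable_fun_pair; [exact: mst|exact: mac]. Qed.

Definition state_step (Q : probability (borel Om) R) t : probability (borel Om) R :=
  mixture_law Q (precomp_pker (@trans R M) (@measurable_state_action_now t)) (@mput_state t.+1).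

Lemma trunc_put_state t w y :
  trunc_at t.*2.+1 (put_state t.+1 (w, y)) = trunc_at t.*2.+1 w :> Om.
Proof.
rewrite /trunc_at/=; congr pair; apply/funext => s; case: eqVneq => [->|_]//=.
by rewrite ltnn.
Qed.

Lemma put_state_trunc t w :
  put_state t.+1 (trunc_at t.*2.+1 w, state_at t.+1 w) = trunc_at t.*2.+2 w :> Om.
Proof.
rewrite /trunc_at/=; congr pair; apply/funext => s.
case: eqVneq => [->|st] /=; first by rewrite !leqnn leqnSn.
rewrite !ltnS ltn_double leq_double leq_Sdouble.
by rewrite [(s <= t)%N]leq_eqVlt (negbTE st).
Qed.

Lemma state_step_rectangle Q t (E : set (borel Om)) (G : set (borel X)) :
  level t.*2.+1 E -> measurable G ->
  state_step Q t (E `&` state_at t.+1 @^-1` G) =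
  \int[Q]_(w in E) trans M (state_at t w, action_after t w) G.
Proof.
move=> [mE tE] mG; apply: mixture_rectangle => // w y.
have e v : E (trunc_at t.*2.+1 v) = E v by exact: (congr1 (@^~ v) tE).
have sE : state_at t.+1 (put_state t.+1 (w, y)) = y by rewrite state_at_put_state eqxx.
have eE : E (put_state t.+1 (w, y)) = E w by rewrite -e trunc_put_state e.
by rewrite /setI /preimage /mkset sE eE.
Qed.

Lemma state_step_level Q t (E : set (borel Om)) : level t.*2.+1 E -> state_step Q t E = Q E.
Proof.
move=> lE; have := @state_step_rectangle Q t E setT lE measurableT.
rewrite preimage_setT setIT => ->; have [mE _] := lE.
under eq_integral do rewrite prob_kernel.
by rewrite integral_cst// mul1e.
Qed.

(** An event of level [t.*2.+2] is a preimage under the pair of the truncation at [t.*2.+1] and the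
    next state, and rectangles determine the law of that pair. *)
Lemma state_step_unique (P P' : probability (borel Om) R) t :
  (forall (E : set (borel Om)) (G : set (borel X)), level t.*2.+1 E -> measurable G ->
    P (E `&` state_at t.+1 @^-1` G) = P' (E `&` state_at t.+1 @^-1` G)) ->
  forall E, level t.*2.+2 E -> P E = P' E.
Proof.
move=> PP' E [mE tE].
pose J (w : borel Om) : borel Om * borel X := (trunc_at t.*2.+1 w, state_at t.+1 w).
have mtr := measurable_trunc_at phi01 mphi ophi psi01 mpsi opsi t.*2.+1.
have mJ : measurable_fun setT J by apply: measurable_fun_pair => //; exact: mst.
have EJ : E = J @^-1` (put_state t.+1 @^-1` E).
  rewrite -[LHS]tE; apply/funext => w.
  exact: (congr1 E (esym (put_state_trunc t w))).
have mpE : measurable (put_state t.+1 @^-1` E : set (borel Om * borel X)).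
  exact: (measurable_preimage (@mput_state t.+1)).
rewrite EJ; apply: (@rectangle_measure_unique _ _ _ _ R (pushforward P J) (pushforward P' J)) => //.
  by change (P (J @^-1` setT) < +oo); rewrite preimage_setT probability_setT ltry.
move=> B G mB mG.
change (P (J @^-1` (B `*` G)) = P' (J @^-1` (B `*` G))).
apply: (PP' (trunc_at t.*2.+1 @^-1` B)) => //; split.
  exact: (measurable_preimage mtr mB).
by apply/funext => w; rewrite /preimage/= trunc_trunc.
Qed.

Section lower_section.
Variables (t : nat) (O : set Om) (oO : fopen (level_feature phi psi t.*2.+2) O).

Let g (w : borel Om) : R :=
  fine (p (state_at t w, action_after t w) [set y | O (put_state t.+1 (w, y))]).

Let mO : measurable (O : set (borel Om)) :=
  measurable_fopen_level phi01 mphi psi01 mpsi oO.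

Let mOw w : measurable ([set y | O (put_state t.+1 (w, y))] : set (borel X)).
Proof. exact: (measurable_mixture_section (@mput_state t.+1)). Qed.

Let mg : measurable_fun setT g.
Proof.
apply: measurableT_comp => //; apply: (measurable_mixture_integrand
  (precomp_pker (@trans R M) (@measurable_state_action_now t)) (@mput_state t.+1) mO).
Qed.

Let near_put N (w w' : Om) y y' : near_coords phi psi t.*2.+1 N w w' ->
  near_by phi N y y' ->
  near_coords phi psi t.*2.+2 N (put_state t.+1 (w, y)) (put_state t.+1 (w', y')).
Proof.
move=> ww' yy' c; rewrite leq_eqVlt => /orP[/eqP->|].
  by rewrite -doubleS odd_double doubleK !state_at_put_state eqxx.
rewrite ltnS => ct; have := ww' c ct; case: ifP => oc.
  by rewrite !action_after_put_state.
by rewrite !state_at_put_state; case: eqVneq.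
Qed.

(** The section of [O] at [w] is the increasing union of the [fopen] sets [V m] of states that
    remain in the section at all [w'] close to [w] to order [m]. Some [V m] has mass above [r], and
    lower semicontinuity of the transition keeps this mass near [w]. *)
Lemma section_lsc : flsc (level_feature phi psi t.*2.+1 : nat -> borel Om -> R) g.
Proof.
move=> r; apply/fopen_levelP => w; rewrite /= /g => rw.
pose V m := [set y : X | exists N, forall w' y', near_coords phi psi t.*2.+1 m w w' ->
  near_by phi N y y' -> O (put_state t.+1 (w', y'))].
have oV m : fopen phi (V m).
  move=> y [N NV]; exists N.*2.+1 => y' yy'; exists N.*2.+1 => w' y'' ww' y'y''.
  exact: NV ww' (near_by_triangle yy' y'y'').
have mV m : measurable (V m : set (borel X)).
  exact: (@measurable_fopen _ R (borel X) phi).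
have VO : [set y | O (put_state t.+1 (w, y))] = \bigcup_m V m.
  apply/seteqP; split => [y Oy|y [m _ [N]]].
    move/fopen_levelP : oO => /(_ _ Oy)[N NO].
    by exists N => //; exists N => w' y' ww' yy'; apply: NO; exact: near_put.
  by apply; [exact: near_coords_refl|exact: near_by_refl].
have [m rm] : exists m, (r < fine (p (state_at t w, action_after t w) (V m)))%R.
  apply/not_existsP => h; move: rw; apply/negP; rewrite -leNgt VO.
  apply: pr_le_bigcup => [//|m y [N NV]|m].
    by exists N => w' y' ww'; apply: NV; apply: near_coords_le ww'.
  by rewrite leNgt; apply/negP; exact: h.
have [N NP] := lsc (oV m) rm.
exists (maxn m N) => w' ww'.
have ww'N := near_coords_le (leqnn _) (leq_maxr m N) ww'.
have nx : near_by phi N (state_at t w) (state_at t w').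
  by have := ww'N t.*2 (leqnSn _); rewrite odd_double doubleK.
have na : near_by psi N (action_after t w) (action_after t w').
  by have := ww'N t.*2.+1 (leqnn _); rewrite /= odd_double/= uphalf_double.
apply: (lt_le_trans (NP _ _ nx na)); apply: pr_le => // y [N' NV].
apply: NV; last exact: near_by_refl.
exact: near_coords_le (leqnn _) (leq_maxl m N) ww'.
Qed.

Lemma state_stepE (Q : probability (borel Om) R) :
  fine (state_step Q t O) = (\int[Q]_w g w)%R.
Proof.
congr fine; apply: eq_integral => w _.
by rewrite /g prE//; exact: mOw.
Qed.

Lemma section01 w : (0 <= g w <= 1)%R.
Proof. by rewrite /g pr_ge0 pr_le1//; exact: mOw. Qed.

(** Both [P i O] and the new mass of [O] are integrals of the same lower semicontinuous function,
    against [P i] and against [Q]. *)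
Lemma state_step_below_limit_at (U : set_system nat) {UU : UltraFilter U}
    (P : nat -> probability (borel Om) R) (Q : probability (borel Om) R) :
  (forall i E, level t.*2.+2 E -> P i E = state_step (P i) t E) ->
  below_limit U (level_feature phi psi t.*2.+1 : nat -> borel Om -> R) P Q ->
  (fine (state_step Q t O) <= plim U P O)%R.
Proof.
move=> PE QP; rewrite state_stepE.
have lO : level t.*2.+2 O by exact: (fopen_level_level phi01 mphi psi01 mpsi oO).
have -> : plim U P O = ulim U (fun i => (\int[P i]_w g w)%R).
  by congr ulim; apply/funext => i; rewrite -state_stepE -PE.
apply: (flsc_integral_le _ _ QP mg section01 section_lsc).
- by move=> i w; exact: level_feature01.
- by move=> i; exact: measurable_level_feature.
Qed.

End lower_section.

End state_step.

(** * Ultralimits of conditional laws *)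

(** The common ground between probabilities and their ultralimits, which are only finitely
    additive. *)
Definition additive_on d (Z : measurableType d) (R : realType) (m : set Z -> R) :=
  forall E F, measurable E -> measurable F -> m E = (m (E `&` F) + m (E `&` ~` F))%R.

Lemma additive_on_pr d (Z : measurableType d) (R : realType) (P : probability Z R) :
  additive_on (fun E => fine (P E)).
Proof. by move=> E F; exact: pr_split. Qed.

Lemma additive_on_plim d (Z : measurableType d) (R : realType) (U : set_system nat)
    {UU : UltraFilter U} (P : nat -> probability Z R) : additive_on (plim U P).
Proof. by move=> E F; exact: plim_split. Qed.

Lemma preimage_cylinder_cons (Z : Type) (f : Z -> coin) (E : set Z) s :
  E `&` f @^-1` cylinder s `&` [set z | f z (size s)] = E `&` f @^-1` cylinder (true :: s) /\
  E `&` f @^-1` cylinder s `&` ~` [set z | f z (size s)] = E `&` f @^-1` cylinder (false :: s).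
Proof.
split; apply/seteqP; split => z; rewrite /cylinder/=.
- by move=> [[Ez ->] ->].
- by move=> [Ez [-> ->]].
- by move=> [[Ez ->] /negP/negbTE ->].
- by move=> [Ez [h hs]]; split; [split|rewrite h].
Qed.

Lemma measurable_prefix_section d (Z : measurableType d) (f : Z -> coin) n
    (V : seq bool -> set Z) : measurable_fun setT f -> (forall s, measurable (V s)) ->
  measurable [set z | V (prefix_of (f z) n) z].
Proof.
move=> mf mV; rewrite (_ : mkset _ = \bigcup_s (V s `&`
    f @^-1` [set b | prefix_of b n = s])).
  apply: countable_bigcupT_measurable => [|s]; first exact: countableP.
  by apply: measurableI => //; apply: (measurable_preimage mf);
    exact: (measurable_prefix n [set t | t = s]).
apply/seteqP; split => [z Vz|z [s _ [Vz /= sz]]]; first by exists (prefix_of (f z) n).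
by rewrite /= sz.
Qed.

(** Conditioning on the first [n] bits splits both events into finitely many pieces, so finite
    additivity suffices; the induction is on the number of bits still to be read. *)
Lemma additive_prefix_eq d d' (Z : measurableType d) (Z' : measurableType d') (R : realType)
    (m : set Z -> R) (m' : set Z' -> R) (f : Z -> coin) (f' : Z' -> coin) (n : nat)
    (V : seq bool -> set Z) (V' : seq bool -> set Z') :
  additive_on m -> additive_on m' -> measurable_fun setT f -> measurable_fun setT f' ->
  (forall s, measurable (V s)) -> (forall s, measurable (V' s)) ->
  (forall s, size s = n -> m (V s `&` f @^-1` cylinder s) = m' (V' s `&` f' @^-1` cylinder s)) ->
  m [set z | V (prefix_of (f z) n) z] = m' [set z | V' (prefix_of (f' z) n) z].
Proof.
move=> am am' mf mf' mV mV' mm'.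
pose E := [set z | V (prefix_of (f z) n) z].
pose E' := [set z | V' (prefix_of (f' z) n) z].
have mE : measurable E by exact: measurable_prefix_section.
have mE' : measurable E' by exact: measurable_prefix_section.
suff H j s : (size s + j = n)%N ->
    m (E `&` f @^-1` cylinder s) = m' (E' `&` f' @^-1` cylinder s).
  by have := H n [::] (add0n n); rewrite cylinder_nil !preimage_setT !setIT.
elim: j s => [|j ih] s sj.
  rewrite addn0 in sj; rewrite (_ : E `&` _ = V s `&` f @^-1` cylinder s).
    rewrite (_ : E' `&` _ = V' s `&` f' @^-1` cylinder s); first exact: mm'.
    by apply/seteqP; split => z [Ez sz]; split => //; move: Ez sz;
      rewrite /E' /cylinder/= -sj => Ez sz; rewrite ?sz in Ez *.
  by apply/seteqP; split => z [Ez sz]; split => //; move: Ez sz;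
    rewrite /E /cylinder/= -sj => Ez sz; rewrite ?sz in Ez *.
have mc s' : measurable (f @^-1` cylinder s').
  by apply: measurable_preimage => //; exact: measurable_cylinder.
have mc' s' : measurable (f' @^-1` cylinder s').
  by apply: measurable_preimage => //; exact: measurable_cylinder.
rewrite (am _ [set z | f z (size s)]); [|exact: measurableI|exact: measurable_bit].
rewrite (am' _ [set z | f' z (size s)]); [|exact: measurableI|exact: measurable_bit].
have [-> ->] := preimage_cylinder_cons f E s; have [-> ->] := preimage_cylinder_cons f' E' s.
by rewrite !ih//= addSnnS.
Qed.

(** The product of [Q] with the uniform law on the unit interval. *)
Definition noise_extension d (Z : measurableType d) (R : realType) (Q : probability Z R) :
    probability (Z * measurableTypeR R)%type R :=
  mixture_law Q (noise_pker (@measurable_snd _ _ Z (measurableTypeR R)))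
    (@measurable_id _ (Z * measurableTypeR R)%type setT).

(* The ultralimit of the joint law of the feature bits and of [d_] is
   disintegrated as [Q] followed by a random branch: for every word [s] the limit
   mass of [d_] starting with [s] has a density [r ^~ s] with respect to the law
   of the bits under [Q]. *)
Section limit_kernel.
Context d (Z : measurableType d) (R : realType).
Context (U : set_system nat) {UU : UltraFilter U}.
Variables (P : nat -> probability Z R) (Q : probability Z R) (theta : nat -> Z -> R).
Hypothesis theta01 : forall i z, (0 <= theta i z <= 1)%R.
Hypothesis mtheta : forall i, measurable_fun setT (theta i).
Hypothesis QP : below_limit U theta P Q.
Variables (d_ : Z -> coin) (md : measurable_fun setT d_).
Local Open Scope ring_scope.

Let fopen_gt i (r : R) : fopen theta [set z | r < theta i z].
Proof.
move=> z /= rz; have [N Ne] : exists N : nat, N.+1%:R^-1 < theta i z - r.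
  exists (Num.truncn (theta i z - r)^-1).
  by rewrite invf_plt ?posrE ?subr_gt0// truncnS_gt.
exists (maxn N i.+1) => z' zz' /=.
have := zz' i; rewrite leq_max ltnS leqnn orbT => /(_ isT).
have : (maxn N i.+1).+1%:R^-1 <= N.+1%:R^-1 :> R.
  by rewrite lef_pV2 ?posrE ?ltr0n// ler_nat ltnS leq_maxl.
move: (_.+1%:R^-1) => a; move: (N.+1%:R^-1) Ne => b; rewrite ltr_norml; lra.
Qed.

Let fopen_lt i (r : R) : fopen theta [set z | theta i z < r].
Proof.
move=> z /= rz; have [N Ne] : exists N : nat, N.+1%:R^-1 < r - theta i z.
  exists (Num.truncn (r - theta i z)^-1).
  by rewrite invf_plt ?posrE ?subr_gt0// truncnS_gt.
exists (maxn N i.+1) => z' zz' /=.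
have := zz' i; rewrite leq_max ltnS leqnn orbT => /(_ isT).
have : (maxn N i.+1).+1%:R^-1 <= N.+1%:R^-1 :> R.
  by rewrite lef_pV2 ?posrE ?ltr0n// ler_nat ltnS leq_maxl.
move: (_.+1%:R^-1) => a; move: (N.+1%:R^-1) Ne => b; rewrite ltr_norml; lra.
Qed.

Section shift.
Variable delta : R.
Hypothesis atomless : forall i (q : rat), Q [set z | theta i z = delta + ratr q] = 0%E.
Local Notation e := (fbits theta delta).

Let me : measurable_fun setT (e : Z -> coin).
Proof. exact: measurable_fbits. Qed.

Let C s : set Z := e @^-1` cylinder s.
Let D s : set Z := d_ @^-1` cylinder s.

Let mC s : measurable (C s).
Proof. exact: (measurable_preimage me (measurable_cylinder s)). Qed.

Let mD s : measurable (D s).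
Proof. exact: (measurable_preimage md (measurable_cylinder s)). Qed.

(** The cell of a word with strict inequalities on both sides: it is [fopen], so [below_limit]
    applies, and it differs from the cell by a [Q]-null set of levels. Indices that code no level
    have bit [false]. *)
Fixpoint inner_cell (s : seq bool) : set Z :=
  if s is x :: s' then inner_cell s' `&`
    (if unpickle (size s') is Some (i, q) then
       if x then [set z | delta + ratr q < theta i z]
       else [set z | theta i z < delta + ratr q]
     else if x then set0 else setT)
  else setT.

Let fopen_inner_cell s : fopen theta (inner_cell s).
Proof.
elim: s => [|x s ih]; first exact: fopenT.
apply: fopenI => //; case: unpickle => [[i q]|].
  by case: x; [exact: fopen_gt|exact: fopen_lt].
by case: x; [move=> z []|exact: fopenT].
Qed.

Let null_levels : set Z := \bigcup_(iq : nat * rat) [set z | theta iq.1 z = delta + ratr iq.2].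

Let inner_cell_sub s : inner_cell s `<=` C s.
Proof.
rewrite /C; elim: s => [|x s ih] z; first by rewrite cylinder_nil.
move=> /= [/ih sz]; rewrite /cylinder/= /preimage/= => h; congr cons; last exact: sz.
move: h; rewrite /fbits; case: unpickle => [[i q]|]; last by case: x.
by case: x => //= lt; apply/negbTE; rewrite -leNgt ltW.
Qed.

Let cell_sub_inner s : C s `<=` inner_cell s `|` null_levels.
Proof.
rewrite /C; elim: s => [|x s ih] z; first by left.
rewrite /preimage/= /cylinder/= => -[bz /ih[sz|]]; last by right.
have [nz|nz] := pselect (null_levels z); first by right.
left; split => //; move: bz; rewrite /fbits; case un : unpickle => [[i q]|]; last by move=> <-.
case: x => //= /negbT; rewrite -leNgt le_eqVlt => /orP[/eqP h|//].
by exfalso; apply: nz; exists (i, q).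
Qed.

Let Q_null_levels : Q null_levels = 0%E.
Proof.
have mN iq : measurable [set z | theta iq.1 z = delta + ratr iq.2].
  have := measurable_fun_eqr (mtheta iq.1) (measurable_cst (delta + ratr iq.2)).
  move=> /(_ measurableT [set true] Logic.I); rewrite setTI.
  by congr (measurable _); apply/seteqP; split => z /= /eqP.
pose F n := if unpickle n is Some iq then [set z | theta iq.1 z = delta + ratr iq.2] else set0.
have -> : null_levels = \bigcup_n F n.
  apply/seteqP; split => [z [iq _ ziq]|z [n _]].
    by exists (pickle iq) => //; rewrite /F pickleK.
  by rewrite /F; case: unpickle => // iq ziq; exists iq.
apply: measure_negligible.
  by apply: bigcupT_measurable => n; rewrite /F; case: unpickle.
apply: negligible_bigcup => n; rewrite /F; case: unpickle => [iq|]; last exact: negligible_set0.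
exact: ((negligibleP Q (mN iq)).2 (atomless _ _)).
Qed.

(** The inner cells give an inequality for every word. When a cell with equal masses is split, two
    inequalities with equal sums must be equalities; the induction starts from total mass 1. *)
Lemma plim_cell s : plim U P (C s) = fine (Q (C s)).
Proof.
have le s' : fine (Q (C s')) <= plim U P (C s').
  have mI : measurable (inner_cell s') by exact: (measurable_fopen theta01).
  have mN : measurable null_levels.
    apply: countable_bigcupT_measurable => // iq.
    have := measurable_fun_eqr (mtheta iq.1) (measurable_cst (delta + ratr iq.2)).
    move=> /(_ measurableT [set true] Logic.I); rewrite setTI.
    by congr (measurable _); apply/seteqP; split => z /= /eqP.
  apply: (@le_trans _ _ (fine (Q (inner_cell s')))).
    rewrite -lee_fin !prE//.
    apply: (le_trans (le_measure _ _ _ (@cell_sub_inner s'))); rewrite ?inE//.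
      exact: measurableU.
    apply: (le_trans (measureU2 Q mI mN)).
    by rewrite [X in _ + X]Q_null_levels adde0.
  apply: (@le_trans _ _ (plim U P (inner_cell s'))); first exact: QP.
  by apply: plim_le => //; exact: inner_cell_sub.
elim: s => [|x s ih].
  by rewrite /C cylinder_nil preimage_setT plimT prT.
have mb : measurable [set z | e z (size s)] by exact: (measurable_bit (f := e)).
have hP := @plim_split R U UU _ Z P _ _ (mC s) mb; have hQ := pr_split Q (mC s) mb.
have [] := preimage_cylinder_cons e setT s; rewrite !setTI => eT eF.
rewrite -/(C s) in eT eF; rewrite eT eF in hP hQ.
have := le (true :: s); have := le (false :: s); move: ih hP hQ; rewrite -/(C _).
case: x; rewrite /C; lra.
Qed.

Let W s sg : R := plim U P (D s `&` C sg).

Let mCD s sg : measurable (D s `&` C sg).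
Proof. exact: measurableI. Qed.

Let W_consistent s : consistent (W s).
Proof.
split => [sg|sg]; first exact: plim_ge0.
have mb : measurable [set z | e z (size sg)] by exact: (measurable_bit (f := e)).
rewrite /W (@plim_split R U UU _ Z P _ _ (@mCD s sg) mb) addrC.
by have [eT eF] := preimage_cylinder_cons e (D s) sg; rewrite /C eT eF.
Qed.

Let W_split s sg : W s sg = W (false :: s) sg + W (true :: s) sg.
Proof.
have mb : measurable [set z | d_ z (size s)] by exact: measurable_bit.
rewrite /W (@plim_split R U UU _ Z P _ _ (@mCD s sg) mb) addrC.
have [eT eF] := preimage_cylinder_cons d_ (C sg) s.
by rewrite [D s `&` _]setIC /D eT eF ![C sg `&` _]setIC.
Qed.

(** The ultralimit is only finitely additive, but consistent masses on words are all that
    [branch_law] needs to give a countably additive measure. *)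
Let lam s : {finite_measure set coin -> \bar R} := branch_law (W s).

Let lamE s sg : lam s (cylinder sg) = (W s sg)%:E.
Proof. exact: branch_law_cylinder. Qed.

Let lamT s : (lam s setT < +oo)%E.
Proof. by have := lamE s [::]; rewrite cylinder_nil => ->; rewrite ltry. Qed.

Let nu : probability coin R := image_law Q me.

Let lam_nil A : measurable A -> lam [::] A = nu A.
Proof.
move=> mA; apply: (@coin_measure_unique R (lam [::]) nu) => //; first exact: lamT.
move=> sg; apply: (eq_trans (lamE [::] sg)); rewrite /W /D cylinder_nil preimage_setT setTI plim_cell; exact: prE.
Qed.

Let lam_split s A : measurable A ->
  lam s A = (lam (false :: s) A + lam (true :: s) A)%E.
Proof.
move=> mA; rewrite -measure_addE.
apply: (@coin_measure_unique R (lam s) (measure_add (lam (false :: s)) (lam (true :: s)))) => //; first exact: lamT.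
move=> sg; apply: (eq_trans (lamE s sg)); rewrite W_split EFinD.
rewrite -(lamE (false :: s)) -(lamE (true :: s)); apply/esym.
exact: (measure_addE (lam (false :: s)) (lam (true :: s)) (cylinder sg)).
Qed.

(** Each letter of [s] can only decrease the measure, and the empty word gives [nu]; this provides
    the absolute continuity for Radon-Nikodym. *)
Let lam_le s A : measurable A -> (lam s A <= nu A)%E.
Proof.
move=> mA; elim: s => [|x s ih]; first by rewrite lam_nil.
apply: le_trans ih; rewrite (lam_split s mA).
by case: x; [exact: leeDr|exact: leeDl].
Qed.

Let density_exists s : exists f : coin -> R, [/\ measurable_fun setT f,
  forall c, 0 <= f c & forall A, measurable A -> lam s A = (\int[nu]_(c in A) (f c)%:E)%E].
Proof.
have dom : lam s `<< nu.
  apply/null_content_dominatesP => A mA nA0; apply/eqP.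
  by rewrite eq_le measure_ge0 andbT -nA0; exact: lam_le.
have [f [f0 ffin intf fE]] := radon_nikodym_sigma_finite dom.
exists (fine \o f); split.
- by apply: measurableT_comp => //; exact: measurable_int intf.
- by move=> c; exact: fine_ge0.
- by move=> A mA; rewrite fE//; apply: eq_integral => c _; rewrite /= fineK.
Qed.

(** Densities are consistent only almost everywhere, but there are countably many words, so a single
    null set of codes has to be repaired. *)
Lemma limit_weights_exist : exists r : coin -> seq bool -> R,
  [/\ forall s, measurable_fun setT (r ^~ s),
      forall c, consistent (r c) /\ r c [::] = 1 &
      forall s sg, (\int[nu]_(c in cylinder sg) (r c s)%:E)%E = (W s sg)%:E].
Proof.
have /choice[rho rhoP] := density_exists.
have mrho s : measurable_fun setT (rho s) by have [] := rhoP s.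
have rho0 s c : 0 <= rho s c by have [_] := rhoP s.
have rhoE s A : measurable A -> lam s A = (\int[nu]_(c in A) (rho s c)%:E)%E.
  by have [_ _] := rhoP s; exact.
have irho s : nu.-integrable setT (fun c => (rho s c)%:E).
  apply/integrableP; split; first exact/measurable_EFinP.
  under eq_integral do rewrite gee0_abs ?lee_fin//.
  by rewrite -rhoE//; exact: lamT.
have mE s : measurable [set c | rho s c = rho (false :: s) c + rho (true :: s) c].
  have := measurable_fun_eqr (mrho s) (measurable_funD (mrho (false :: s)) (mrho (true :: s))).
  move=> /(_ measurableT [set true] Logic.I); rewrite setTI.
  by congr (measurable _); apply/seteqP; split => c /= /eqP.
have mE1 : measurable [set c | rho [::] c = 1].
  have := measurable_fun_eqr (mrho [::]) (measurable_cst (1 : R)).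
  move=> /(_ measurableT [set true] Logic.I); rewrite setTI.
  by congr (measurable _); apply/seteqP; split => c /= /eqP.
pose Gd : set coin := [set c | rho [::] c = 1] `&`
  ~` \bigcup_s ~` [set c | rho s c = rho (false :: s) c + rho (true :: s) c].
have mGd : measurable Gd.
  apply: measurableI => //; apply: measurableC.
  apply: countable_bigcupT_measurable => [|s]; first exact: countableP.
  exact: measurableC.
have nGd : nu.-negligible (~` Gd).
  rewrite setCI setCK; apply: negligibleU.
    have : ae_eq nu setT (fun c => (rho [::] c)%:E) (cst 1%E).
      apply: integral_ae_eq => // A _ mA; rewrite -rhoE// lam_nil//.
      by rewrite integral_cst// mul1e.
    move=> [N [mN N0 sN]]; exists N; split => // c c1; apply: sN => /= h; apply: c1.
    by have [] := h Logic.I.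
  have -> : \bigcup_s ~` [set c | rho s c = rho (false :: s) c + rho (true :: s) c] =
     \bigcup_n (fun s => ~` [set c | rho s c = rho (false :: s) c + rho (true :: s) c])
       (odflt [::] (unpickle n)).
    apply/seteqP; split => [c [s _ cs]|c [n _ cn]].
      by exists (pickle s) => //; rewrite pickleK.
    by exists (odflt [::] (unpickle n)).
  apply: negligible_bigcup => n; move: (odflt _ _) => s.
  have : ae_eq nu setT (fun c => (rho s c)%:E)
      (fun c => (rho (false :: s) c + rho (true :: s) c)%:E).
    apply: integral_ae_eq => //.
      by apply/measurable_EFinP; exact: measurable_funD.
    move=> A _ mA; rewrite -rhoE// lam_split// !rhoE// -ge0_integralD//.
    - by move=> c _; rewrite lee_fin.
    - by apply: measurable_funTS; apply/measurable_EFinP; exact: mrho.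
    - by move=> c _; rewrite lee_fin.
    - by apply: measurable_funTS; apply/measurable_EFinP; exact: mrho.
  move=> [N [mN N0 sN]]; exists N; split => // c cs; apply: sN => /= h; apply: cs.
  by have [] := h Logic.I.
(* The weights of the point mass at the all-[false] sequence: a consistent choice of total mass 1 on
   the exceptional codes. *)
pose dflt (s : seq bool) : R := (s == nseq (size s) false)%:R.
exists (fun c s => if c \in Gd then rho s c else dflt s); split.
- move=> s; apply: measurable_fun_ifT; [|exact: mrho|exact: measurable_cst].
  apply: (measurable_fun_bool true); rewrite setTI.
  by rewrite (_ : _ @^-1` _ = Gd)//; apply/seteqP; split => c; [exact: set_mem|exact: mem_set].
- move=> c; case: ifPn => [|_]; last first.
    split; last by rewrite /dflt eqxx.
    split => s; first by rewrite /dflt ler0n.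
    by rewrite /dflt/= !eqseq_cons eqxx/= addr0.
  rewrite inE => -[c1 cG]; split => //; split => // s.
  by apply: contrapT => cs; apply: cG; exists s.
- move=> s sg; rewrite -lamE rhoE; last exact: measurable_cylinder.
  apply: ge0_ae_eq_integral; first exact: measurable_cylinder.
  + apply: measurable_funTS; apply/measurable_EFinP.
    apply: measurable_fun_ifT; [|exact: mrho|exact: measurable_cst].
    apply: (measurable_fun_bool true); rewrite setTI.
    by rewrite (_ : _ @^-1` _ = Gd)//; apply/seteqP; split => c; [exact: set_mem|exact: mem_set].
  + by apply: measurable_funTS; apply/measurable_EFinP; exact: mrho.
  + by move=> c _; rewrite lee_fin; case: ifP => // _; rewrite /dflt ler0n.
  + by move=> c _; rewrite lee_fin.
  + move: nGd => [N [mN N0 sN]]; exists N; split => // c /= h; apply: sN => /= cG.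
    by apply: h => _; rewrite mem_set.
Qed.

(** Splitting along the bits [e] and then along the branch reduces the claim to pairs of cylinders,
    where it is the defining identity of the densities. It is stated for events on finite prefixes
    because [plim] is not countably additive. *)
Lemma limit_branch : exists r : coin -> seq bool -> R,
  [/\ forall s, measurable_fun setT (r ^~ s),
      forall c, consistent (r c) /\ r c [::] = 1 &
      forall n (V : seq bool -> seq bool -> Prop),
      fine (noise_extension Q [set zu | V (prefix_of (e zu.1) n)
        (prefix_of (branch (r (e zu.1)) zu.2) n)]) =
      plim U P [set z | V (prefix_of (e z) n) (prefix_of (d_ z) n)]].
Proof.
have [r [mr cr rW]] := limit_weights_exist.
exists r; split => // n V.
pose f (zu : Z * measurableTypeR R) : coin := e zu.1.
have mf : measurable_fun setT f by exact: (measurableT_comp me measurable_fst).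
pose g (zu : Z * measurableTypeR R) : coin := branch (r (e zu.1)) zu.2.
have mg : measurable_fun setT g.
  apply: (measurable_branch (w := fun z => r (e z))) => s.
  exact: (measurableT_comp (mr s) me).
have mVg sg : measurable [set zu | V sg (prefix_of (g zu) n)].
  exact: (measurable_preimage mg (measurable_prefix n (V sg))).
have mVd sg : measurable [set z | V sg (prefix_of (d_ z) n)].
  exact: (measurable_preimage md (measurable_prefix n (V sg))).
apply: (@additive_prefix_eq _ _ _ _ R (fun E => fine (noise_extension Q E)) (plim U P) f e n
  (fun sg => [set zu | V sg (prefix_of (g zu) n)])
  (fun sg => [set z | V sg (prefix_of (d_ z) n)])) => //.
- exact: additive_on_pr.
- exact: additive_on_plim.
move=> sg _.
pose A s := [set zu : Z * measurableTypeR R | V sg s /\ cylinder sg (f zu)].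
pose B s := [set z | V sg s /\ C sg z].
have -> : [set zu | V sg (prefix_of (g zu) n)] `&` f @^-1` cylinder sg =
    [set zu | A (prefix_of (g zu) n) zu] by apply/seteqP; split.
have -> : [set z | V sg (prefix_of (d_ z) n)] `&` e @^-1` cylinder sg =
    [set z | B (prefix_of (d_ z) n) z] by apply/seteqP; split.
have mfs : measurable (f @^-1` cylinder sg).
  exact: (measurable_preimage mf (measurable_cylinder sg)).
apply: (@additive_prefix_eq _ _ _ _ R (fun E => fine (noise_extension Q E)) (plim U P) g d_ n A B) => //.
- exact: additive_on_pr.
- exact: additive_on_plim.
- move=> s; rewrite /A; have [Vs|Vs] := pselect (V sg s).
    by rewrite (_ : mkset _ = f @^-1` cylinder sg)//; apply/seteqP; split => // zu [].
  by rewrite (_ : mkset _ = set0)//; apply/seteqP; split => // zu [].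
- move=> s; rewrite /B; have [Vs|Vs] := pselect (V sg s).
    by rewrite (_ : mkset _ = C sg)//; apply/seteqP; split => // z [].
  by rewrite (_ : mkset _ = set0)//; apply/seteqP; split => // z [].
move=> s _; have [Vs|Vs] := pselect (V sg s); last first.
  rewrite (_ : A s `&` _ = set0); last by apply/seteqP; split => // zu [[]].
  rewrite (_ : B s `&` _ = set0); last by apply/seteqP; split => // z [[]].
  by rewrite measure0 /plim; under eq_fun do rewrite measure0; rewrite ulim_cst.
have -> : B s `&` d_ @^-1` cylinder s = D s `&` C sg.
  by apply/seteqP; split => [z [[_ Cz] Dz]|z [Dz Cz]].
rewrite -/(W s sg); have /= <- := congr1 fine (rW s sg).
congr fine; rewrite /noise_extension.
rewrite (_ : (\int[nu]_(c in cylinder sg) _)%E =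
    (\int[Q]_(z in C sg) (r (e z) s)%:E)%E); last first.
  apply: ge0_integral_pushforward => //; first exact: measurable_cylinder.
    by apply: measurable_funTS; apply/measurable_EFinP; exact: mr.
  by move=> c _; rewrite lee_fin; have [[]] := cr c.
rewrite [RHS]integral_mkcond; apply: eq_integral => z _; rewrite patchE.
case: ifPn => [|/negP]; rewrite inE => zs.
  have [crz crz1] := cr (e z).
  rewrite -(branch_law_cylinder s crz) /branch_law crz1 /pushforward.
  by congr unit_uniform; apply/seteqP; split => [u [[]]|u].
by rewrite (_ : mkset _ = set0) ?measure0//; apply/seteqP; split => // u [[_ /zs]].
Qed.

End shift.

Lemma limit_kernel : exists delta (r : coin -> seq bool -> R),
  [/\ forall s, measurable_fun setT (r ^~ s),
      forall c, consistent (r c) /\ r c [::] = 1 &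
      forall n (V : seq bool -> seq bool -> Prop),
      fine (noise_extension Q [set zu | V (prefix_of (fbits theta delta zu.1) n)
        (prefix_of (branch (r (fbits theta delta zu.1)) zu.2) n)]) =
      plim U P [set z | V (prefix_of (fbits theta delta z) n) (prefix_of (d_ z) n)]].
Proof.
by have [delta /limit_branch[r rP]] := atomless_shift mtheta Q; exists delta, r.
Qed.

End limit_kernel.

Section compact_decode.
Context (R : realType) (T : ptopologicalType) (psi : nat -> T -> R).
Hypothesis psi01 : forall i a, (0 <= psi i a <= 1)%R.
Hypothesis cpsi : forall i, continuous (psi i).
Hypothesis opsi : forall O, open O -> fopen psi O.
Hypothesis compactT : compact [set: T].
Variable dec : coin -> T.
Hypothesis decP : forall (b : coin) (x : T),
  (fun m => cell_rep psi (prefix_of b m)) @ \oo --> x -> dec b = x.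

(** Representatives of longer prefixes agree on more and more bits, so their cluster point, given by
    compactness, is their limit. The code [b] need not be the code of that limit, which is why the
    conclusion is about nearness and not about bits. *)
Lemma compact_decode (b : coin) : (forall m, cell psi (prefix_of b m) !=set0) ->
  forall N, exists n, forall a, prefix_of (fbits psi 0 a) n = prefix_of b n ->
  near_by psi N (dec b) a.
Proof.
move=> b0; pose s m := cell_rep psi (prefix_of b m).
have [a [_ sa]] := compactT (F := s @ \oo) _ filterT.
have sb m n : (n <= m)%N -> prefix_of (fbits psi 0 (s m)) n = prefix_of b n.
  move=> nm; have := cell_repP (b0 m); rewrite size_prefix_of => /prefix_ofP h.
  by apply/prefix_ofP => j jn; rewrite h// (leq_trans jn).
have key N : exists n, forall a', prefix_of (fbits psi 0 a') n = prefix_of b n ->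
    near_by psi N a a'.
  have [n nN] := fbits_near_by psi01 0%R N.*2.+1.
  exists n => a' a'b.
  have sn : (s @ \oo) [set x | exists2 m, (n <= m)%N & x = s m].
    by exists n => // m /= nm; exists m.
  have [x [[m nm ->] am]] := sa _ _ sn (near_by_nbhs cpsi N.*2.+1 a).
  by apply: near_by_triangle am _; apply: nN; rewrite a'b sb.
have -> : dec b = a.
  apply: decP; apply: (cvg_near_by opsi) => N; have [n nP] := key N.
  by exists n => k nk; apply: nP; exact: sb.
exact: key.
Qed.

End compact_decode.

(** * Adding an action coordinate *)

Section action_step.
Context (R : realType) (M : mdp R).
Local Notation X := (state M).
Local Notation A := (action M).
Local Notation Om := (trajectory M).
Variables (phi : nat -> X -> R) (psi : nat -> A -> R).
Hypothesis phi01 : forall i x, (0 <= phi i x <= 1)%R.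
Hypothesis mphi : forall i, measurable_fun [set: borel X] (phi i).
Hypothesis ophi : forall O, open O -> fopen phi O.
Hypothesis psi01 : forall i a, (0 <= psi i a <= 1)%R.
Hypothesis cpsi : forall i, continuous (psi i).
Hypothesis opsi : forall O, open O -> fopen psi O.
Local Notation mst := (@measurable_state_at R M).
Local Notation mac := (@measurable_action_after R M).
Let mpsi : forall i, measurable_fun [set: borel A] (psi i) :=
  continuous_measurable_features cpsi.

Let mput_action t := measurable_put_action phi01 mphi ophi psi01 mpsi opsi t.

Local Notation hist t := (borel X * t.-tuple (borel A * borel X))%type.

Definition action_step (Q : probability (borel Om) R) t (k : R.-pker (hist t) ~> borel A) :
    probability (borel Om) R :=
  mixture_law Q (precomp_pker k (@measurable_history R M t)) (@mput_action t).

(** Padding with [point] lets a kernel on histories be defined through features of whole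
    trajectories. *)
Definition extend_history t (h : hist t) : Om := (h.1, nth (point, point) h.2).

Lemma measurable_extend_history t :
  measurable_fun setT (@extend_history t : hist t -> borel Om).
Proof.
have mnth s : measurable_fun setT (fun h : hist t => nth (point, point) h.2 s : borel A * borel X).
  have [st|ts] := ltnP s t.
    rewrite (_ : (fun h => _) = (fun h : hist t => tnth h.2 (Ordinal st))).
      apply: (measurableT_comp (f := fun h : t.-tuple (borel A * borel X) => tnth h (Ordinal st))).
        exact: measurable_tnth.
      exact: measurable_snd.
    by apply/funext => h; rewrite (tnth_nth (point, point)).
  rewrite (_ : (fun h => _) = cst (point, point)); first exact: measurable_cst.
  by apply/funext => h; rewrite nth_default// size_tuple.
apply: (measurable_to_trajectory phi01 mphi ophi psi01 mpsi opsi) => s.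
  case: s => [|s]; first exact: measurable_fst.
  exact: (measurableT_comp measurable_snd (mnth s)).
exact: (measurableT_comp measurable_fst (mnth s)).
Qed.

Lemma trunc_extend_history t (w : Om) :
  trunc_at t.*2 (extend_history (history t w)) = trunc_at t.*2 w.
Proof.
have nE s : (s < t)%N -> (extend_history (history t w)).2 s = w.2 s.
  move=> st; rewrite /extend_history/history /snd.
  by rewrite -[s in LHS]/(val (Ordinal st)) nth_mktuple.
rewrite /trunc_at; congr pair; apply/funext => s.
have [st|ts] := ltnP s t; first by rewrite nE.
by rewrite ltnNge leq_double ts [(s.*2.+1 < _)%N]ltnNge leq_Sdouble ts.
Qed.

Lemma fbits_trunc k delta (w : Om) :
  fbits (level_feature phi psi k) delta (trunc_at k w) =
  fbits (level_feature phi psi k) delta w.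
Proof.
apply/funext => n; rewrite /fbits; case: unpickle => [[i q]|]//.
rewrite /level_feature; case: unpickle => [[c j]|]//.
by case: ifP => // ck; rewrite coord_feature_trunc.
Qed.

Lemma action_step_rectangle Q t (k : R.-pker (hist t) ~> borel A)
    (E : set (borel Om)) (G : set (borel A)) :
  level t.*2 E -> measurable G ->
  action_step Q k (E `&` @action_after R M t @^-1` G) = \int[Q]_(w in E) k (history t w) G.
Proof.
move=> [mE tE] mG; apply: mixture_rectangle => // w a.
have e v : E (trunc_at t.*2 v) = E v by exact: (congr1 (@^~ v) tE).
have aE : action_after t (put_action t (w, a)) = a by rewrite action_after_put_action eqxx.
have pE : trunc_at t.*2 (put_action t (w, a)) = trunc_at t.*2 w :> Om.
  rewrite /trunc_at/=; congr pair; apply/funext => s; case: eqVneq => [->|_]//=.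
  by rewrite ltnn ltnNge leqnSn.
have eE : E (put_action t (w, a)) = E w by rewrite -e pE e.
by rewrite /setI /preimage /mkset aE eE.
Qed.

Lemma action_step_level Q t (k : R.-pker (hist t) ~> borel A) (E : set (borel Om)) :
  level t.*2 E -> action_step Q k E = Q E.
Proof.
move=> lE; have := @action_step_rectangle Q t k E setT lE measurableT.
rewrite preimage_setT setIT => ->; have [mE _] := lE.
under eq_integral do rewrite prob_kernel.
by rewrite integral_cst// mul1e.
Qed.

Hypothesis compactA : compact [set: A].

(** The kernel reads the bits of the history, draws a branch with the limit conditional weights and
    decodes it to an action. Membership in [O] is then exhausted from inside by events on finite
    prefixes, whose mass is a limit of masses under the [P i]. *)
Lemma action_step_exists (U : set_system nat) {UU : UltraFilter U}
    (P : nat -> probability (borel Om) R) (Q : probability (borel Om) R) t :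
  below_limit U (level_feature phi psi t.*2 : nat -> borel Om -> R) P Q ->
  exists k : R.-pker (hist t) ~> borel A,
    below_limit U (level_feature phi psi t.*2.+1 : nat -> borel Om -> R) P (action_step Q k).
Proof.
move=> QP.
have [dec mdec decP] := decode_exists psi (action_borel M).
pose d (w : borel Om) : coin := fbits psi 0 (action_after t w).
have md : measurable_fun setT d.
  exact: (measurableT_comp (measurable_fbits mpsi 0) (mac t)).
have lf01 : forall i w, (0 <= level_feature phi psi t.*2 i w <= 1)%R.
  by move=> i w; exact: level_feature01.
have mlf : forall i, measurable_fun [set: borel Om] (level_feature phi psi t.*2 i).
  by move=> i; exact: measurable_level_feature.
have [delta [r [mr cr rP]]] :=
  @limit_kernel _ (borel Om) R U UU P Q (level_feature phi psi t.*2) lf01 mlf QP d md.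
pose e := fbits (level_feature phi psi t.*2) delta.
have me : measurable_fun setT (e : borel Om -> coin) by exact: measurable_fbits.
pose f (hu : hist t * measurableTypeR R) : borel A :=
  dec (branch (r (e (extend_history hu.1))) hu.2).
have mf : measurable_fun setT f.
  apply: (measurableT_comp mdec).
  apply: (measurable_branch (w := fun h : hist t => r (e (extend_history h)))) => s.
  exact: (measurableT_comp (mr s) (measurableT_comp me (@measurable_extend_history t))).
have eE w : e (extend_history (history t w)) = e w.
  by rewrite /e -fbits_trunc trunc_extend_history fbits_trunc.
exists (noise_pker mf) => O oO.
pose g (wu : borel Om * measurableTypeR R) : coin := branch (r (e wu.1)) wu.2.
have mg : measurable_fun setT g.
  apply: (measurable_branch (w := fun w : borel Om => r (e w))) => s.
  exact: (measurableT_comp (mr s) me).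
have mO : measurable (O : set (borel Om)) by exact: (measurable_fopen_level phi01 mphi psi01 mpsi oO).
pose B := [set wu : borel Om * measurableTypeR R | O (put_action t (wu.1, dec (g wu)))].
have mB : measurable B.
  apply: (measurable_preimage (f := fun wu => put_action t (wu.1, dec (g wu)) : borel Om)) mO.
  apply: (measurableT_comp (@mput_action t)).
  apply: measurable_fun_pair; first exact: measurable_fst.
  exact: (measurableT_comp mdec mg).
have -> : action_step Q (noise_pker mf) O = noise_extension Q B.
  apply: eq_integral => w _ /=.
  rewrite /kernel_precomp /noise_mkernel /noise_kernel.
  by congr unit_uniform; apply/seteqP; split => u; rewrite /= /f/= eE.
(* Pairs whose first [n] bits of history and of branch already force membership in [O]: a prefix
   event, so its mass is known from [rP]. *)
pose G n := [set wu : borel Om * measurableTypeR R |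
  forall w', prefix_of (e w') n = prefix_of (e wu.1) n ->
    prefix_of (d w') n = prefix_of (g wu) n -> O w'].
pose good n (s s' : seq bool) :=
  forall w', prefix_of (e w') n = s -> prefix_of (d w') n = s' -> O w'.
have GE n : G n = [set wu | good n (prefix_of (e wu.1) n) (prefix_of (g wu) n)] by [].
have mG n : measurable (G n).
  have mfst : measurable_fun setT (fun wu : borel Om * measurableTypeR R => e wu.1 : coin).
    exact: (measurableT_comp me measurable_fst).
  apply: (@measurable_prefix_section _ _ (fun wu : borel Om * measurableTypeR R => e wu.1) n
    (fun s => [set wu | good n s (prefix_of (g wu) n)])) => // s.
  exact: (measurable_preimage mg (measurable_prefix n (good n s))).
(* The branches that pass through a word of an empty cell. No trajectory has an action with such a
   prefix, so the limit mass is 0; off [N] the lemma [compact_decode] applies. *)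
pose N := \bigcup_s (if `[< cell psi s !=set0 >] then set0
  else [set wu : borel Om * measurableTypeR R | prefix_of (g wu) (size s) = s]).
have mNs s : measurable [set wu : borel Om * measurableTypeR R | prefix_of (g wu) (size s) = s].
  exact: (measurable_preimage mg (measurable_cylinder s)).
have mN : measurable N.
  apply: countable_bigcupT_measurable => [|s]; first exact: countableP.
  by case: ifP.
have N0 : noise_extension Q N = 0.
  apply: measure_negligible => //.
  have -> : N = \bigcup_n (fun s => if `[< cell psi s !=set0 >] then set0
      else [set wu : borel Om * measurableTypeR R | prefix_of (g wu) (size s) = s])
      (odflt [::] (unpickle n)).
    apply/seteqP; split => [wu [s _ sN]|wu [n _ nN]].
      by exists (pickle s) => //; rewrite pickleK.
    by exists (odflt [::] (unpickle n)).
  apply: negligible_bigcup => n; move: (odflt _ _) => s.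
  case: ifPn => [_|/asboolPn s0]; first exact: negligible_set0.
  apply/(negligibleP _ (mNs s)); rewrite -[LHS]fineK ?fin_num_measure//; congr EFin.
  have -> := rP (size s) (fun _ s' => s' = s).
  rewrite (_ : mkset _ = set0).
    by rewrite /plim; under eq_fun do rewrite measure0; rewrite ulim_cst.
  apply/seteqP; split => // w /= ws; apply: s0.
  by exists (action_after t w).
have BNG : B `<=` N `|` \bigcup_n G n.
  move=> [w u]; rewrite /B /= => Ow.
  have [nN|Nw] := pselect (~ N (w, u)); last by left; exact: contrapT.
  right; have b0 m : cell psi (prefix_of (g (w, u)) m) !=set0.
    apply: contrapT => h; apply: nN; exists (prefix_of (g (w, u)) m) => //.
    by case: ifPn => [/asboolP//|_]; rewrite /= size_prefix_of.
  have [k kO] := (fopen_levelP _ _ _ _).1 oO _ Ow.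
  have [k1 k1P] := level_near_coords phi psi t.*2 k.
  have [n1 n1P] := fbits_near_by lf01 delta k1.
  have [n2 n2P] := compact_decode psi01 cpsi opsi compactA decP b0 k.
  (* [n1] controls the coordinates of the history and [n2] the decoded action. *)
  exists (maxn n1 n2) => // w' /prefix_ofP ww' /prefix_ofP dw'; apply: kO.
  have nc : near_coords phi psi t.*2 k w w'.
    apply/k1P/n1P/prefix_ofP => i iN; exact: esym (ww' i (leq_trans iN (leq_maxl _ _))).
  have na : near_by psi k (dec (g (w, u))) (action_after t w').
    apply/n2P/prefix_ofP => i iN; exact: (dw' i (leq_trans iN (leq_maxr _ _))).
  move=> c; rewrite leq_eqVlt => /orP[/eqP->|].
    by rewrite /= odd_double/= uphalf_double action_after_put_action eqxx.
  rewrite ltnS => ct; have := nc c ct; case: ifP => oc; last by rewrite state_at_put_action.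
  rewrite action_after_put_action; case: eqVneq => // ec.
  by move: ct; rewrite -[c in (c <= _)%N]odd_double_half oc ec ltnn.
have QG n : (fine (noise_extension Q (G n)) <= plim U P O)%R.
  rewrite GE rP; apply: plim_le => //; last by move=> w /= h; exact: h.
  have := @measurable_prefix_section _ (borel Om) e n
    (fun s => [set w | good n s (prefix_of (d w) n)]) me.
  by apply => s; exact: (measurable_preimage md (measurable_prefix n (good n s))).
have GS n : G n `<=` G n.+1.
  move=> [w u] h w' /= [_ ww'] [_ dw']; exact: h.
have mUG : measurable (\bigcup_n G n) by exact: bigcupT_measurable.
apply: (@le_trans _ _ (fine (noise_extension Q (\bigcup_n G n)))); last exact: pr_le_bigcup.
apply: (le_trans (pr_le _ mB (measurableU _ _ mN mUG) BNG)).
rewrite -lee_fin !prE//; last exact: measurableU.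
rewrite -[leRHS]add0e -N0; exact: measureU2.
Qed.

End action_step.

(** * Construction of the limit law *)

Section limit_chain.
Context (R : realType) (M : mdp R).
Local Notation X := (state M).
Local Notation A := (action M).
Local Notation Om := (trajectory M).
Variables (phi : nat -> X -> R) (psi : nat -> A -> R).
Hypothesis phi01 : forall i x, (0 <= phi i x <= 1)%R.
Hypothesis mphi : forall i, measurable_fun [set: borel X] (phi i).
Hypothesis ophi : forall O, open O -> fopen phi O.
Hypothesis psi01 : forall i a, (0 <= psi i a <= 1)%R.
Hypothesis cpsi : forall i, continuous (psi i).
Hypothesis opsi : forall O, open O -> fopen psi O.
Hypothesis lsc : flsc_transition phi psi.
Hypothesis compactA : compact [set: A].
Local Notation mst := (@measurable_state_at R M).
Local Notation mac := (@measurable_action_after R M).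
Let mpsi : forall i, measurable_fun [set: borel A] (psi i) :=
  continuous_measurable_features cpsi.
Local Notation hist t := (borel X * t.-tuple (borel A * borel X))%type.
Local Notation next_state Q t := (state_step phi01 mphi ophi psi01 mpsi opsi Q t).
Local Notation next_action Q k := (action_step phi01 mphi ophi psi01 cpsi opsi Q k).

Lemma trunc_put_action_history t (w : Om) :
  trunc_at t.*2.+1 (put_action t (extend_history (history t w), action_after t w)) =
  trunc_at t.*2.+1 w.
Proof.
have := trunc_extend_history t w; rewrite /trunc_at/= => -[e].
congr pair; apply/funext => s; have := congr1 (@^~ s) e => /=.
have [->|st] := eqVneq s t.
  by rewrite ltnSn !ltnn.
have -> : (s.*2.+1 < t.*2)%N = (s < t)%N by exact: (leq_double s.+1).
have -> : (s.*2 < t.*2.+1)%N = (s < t)%N by rewrite ltnS leq_double ltn_neqAle st.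
by rewrite ltnS ltn_double.
Qed.

(** The transition identity of a strategic measure speaks of histories; padding and truncation turn
    any event of level [t.*2.+1] into one of that form. *)
Lemma strategic_state_step (P0 : probability (borel X) R) pi
    (P : probability (borel Om) R) t (E : set (borel Om)) :
  is_strategic_measure P0 pi P -> level t.*2.+2 E -> P E = next_state P t E.
Proof.
move=> [_ _ HP]; apply: state_step_unique => // {}E G lE mG.
rewrite state_step_rectangle//; have [mE tE] := lE.
pose E1 := [set ha : hist t * borel A | E (put_action t (extend_history ha.1, ha.2))].
have mE1 : measurable E1.
  apply: (measurable_preimage (f := fun ha : hist t * borel A =>
    put_action t (extend_history ha.1, ha.2) : borel Om)) mE.
  apply: (measurableT_comp (measurable_put_action phi01 mphi ophi psi01 mpsi opsi t)).
  apply: measurable_fun_pair => //.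
  exact: (measurableT_comp (measurable_extend_history phi01 mphi ophi psi01 cpsi opsi (t := t))).
have := HP t E1 G mE1 mG; rewrite (_ : [set w | _] = E)//.
have e v : E (trunc_at t.*2.+1 v) = E v by exact: (congr1 (@^~ v) tE).
by apply/funext => w; rewrite /E1/= -[RHS]e -[LHS]e trunc_put_action_history.
Qed.

Let start (x : borel X) : borel Om := (x, fun=> (point, point)).

Let measurable_start : measurable_fun setT start.
Proof.
apply: (measurable_to_trajectory phi01 mphi ophi psi01 mpsi opsi) => t.
  by case: t => [|t]; [exact: measurable_id|exact: measurable_cst].
exact: measurable_cst.
Qed.

Definition start_law (P0 : probability (borel X) R) : probability (borel Om) R :=
  image_law P0 measurable_start.

Lemma start_lawE (P0 : probability (borel X) R) (P : probability (borel Om) R) (E : set (borel Om)) :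
  (forall B : set (borel X), measurable B -> P (state_at 0 @^-1` B) = P0 B) ->
  level 0 E -> start_law P0 E = P E.
Proof.
move=> PP0 [mE tE].
have mB : measurable (start @^-1` E) by exact: (measurable_preimage measurable_start).
rewrite -[LHS](PP0 _ mB); congr (P _); rewrite -[RHS]tE.
by apply/seteqP; split.
Qed.

Lemma limit_chain_exists (U : set_system nat) {UU : UltraFilter U}
    (P0 : probability (borel X) R) (P : nat -> probability (borel Om) R) :
  (forall i, exists pi, is_strategic_measure P0 pi (P i)) ->
  exists (S : nat -> probability (borel Om) R) (k : strategy M),
    [/\ S 0%N = start_law P0,
        forall t, S t.+1 = next_state (next_action (S t) (k t)) t
      & forall t, below_limit U (level_feature phi psi t.*2 : nat -> borel Om -> R) P (S t)].
Proof.
move=> sP.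
(* Each law is bundled with its inequality, since the next kernel is chosen from that inequality. *)
pose B t := {Q : probability (borel Om) R |
  below_limit U (level_feature phi psi t.*2 : nat -> borel Om -> R) P Q}.
pose K t (Q : B t) := cid (action_step_exists phi01 mphi ophi psi01 cpsi opsi compactA (UU := UU) (svalP Q)).
have nextP t (Q : B t) : below_limit U (level_feature phi psi t.+1.*2 : nat -> borel Om -> R) P
    (next_state (next_action (sval Q) (sval (K t Q))) t).
  move=> O oO; have QP : below_limit U (level_feature phi psi t.*2.+1 : nat -> borel Om -> R) P
      (next_action (sval Q) (sval (K t Q))) := svalP (K t Q).
  have PE i E : level t.*2.+2 E -> P i E = next_state (P i) t E.
    by have [pi sPi] := sP i; exact: (strategic_state_step sPi).
  exact: (state_step_below_limit_at lsc oO PE QP).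
(* All [P i] have initial law [P0], so equality holds at level 0, however fine the state features
   are. *)
have startP : below_limit U (level_feature phi psi 0 : nat -> borel Om -> R) P (start_law P0).
  move=> O oO; rewrite /plim.
  have lO := fopen_level_level phi01 mphi psi01 mpsi oO.
  rewrite -[leLHS](@ulim_cst R U) le_eqVlt; apply/orP; left; apply/eqP; congr ulim.
  apply/funext => i; congr fine; apply: start_lawE => //.
  by have [pi []] := sP i.
pose S := nat_rect B (exist _ _ startP) (fun t Q => exist _ _ (nextP t Q)).
by exists (fun t => sval (S t)), (fun t => sval (K t (S t))); split => // t; exact: svalP.
Qed.

Lemma limit_chain_level (S : nat -> probability (borel Om) R) (k : strategy M) :
  (forall t, S t.+1 = next_state (next_action (S t) (k t)) t) ->
  forall s t E, (s <= t)%N -> level s.*2 E -> S t E = S s E.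
Proof.
move=> SE s t E /subnKC <- lE; elim: (t - s)%N => [|n ih]; first by rewrite addn0.
rewrite addnS SE.
have le : (s.*2 <= (s + n).*2)%N by rewrite leq_double leq_addr.
rewrite state_step_level; last by apply: level_le lE; rewrite (leq_trans le).
by rewrite action_step_level//; exact: level_le lE.
Qed.

End limit_chain.

(** * From laws of finite levels to a law on trajectories *)

Section projective_limit.
Context (R : realType) (M : mdp R).
Local Notation X := (state M).
Local Notation A := (action M).
Local Notation Om := (trajectory M).
Variables (phi : nat -> X -> R) (psi : nat -> A -> R).
Hypothesis phi01 : forall i x, (0 <= phi i x <= 1)%R.
Hypothesis mphi : forall i, measurable_fun [set: borel X] (phi i).
Hypothesis ophi : forall O, open O -> fopen phi O.
Hypothesis psi01 : forall i a, (0 <= psi i a <= 1)%R.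
Hypothesis mpsi : forall i, measurable_fun [set: borel A] (psi i).
Hypothesis opsi : forall O, open O -> fopen psi O.

Let e : borel Om -> coin := fbits (trajectory_feature phi psi) 0%R.

Let me : measurable_fun setT e.
Proof.
apply: (@measurable_fbits _ R (borel Om)) => n; rewrite /trajectory_feature.
case: unpickle => [[c j]|]; last exact: measurable_cst.
exact: measurable_coord_feature.
Qed.

(** Extracts from the code of a trajectory the code of its coordinate [c]. *)
Definition coord_bits (c : nat) (b : coin) : coin := fun m =>
  if unpickle m is Some (j, q) then b (pickle (pickle (c, j : nat), q : rat)) else false.

Let eE c j (q : rat) w :
  e w (pickle (pickle (c, j : nat), q)) = (0 + ratr q < coord_feature phi psi c j w)%R.
Proof. by rewrite /e /fbits pickleK /trajectory_feature pickleK. Qed.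

Let coord_bits_state c w : odd c = false -> coord_bits c (e w) = fbits phi 0%R (state_at c./2 w).
Proof.
move=> oc; apply/funext => m; rewrite /coord_bits [RHS]/fbits.
by case: (unpickle m) => [[j q]|]; [rewrite eE /coord_feature oc|].
Qed.

Let coord_bits_action c w : odd c -> coord_bits c (e w) = fbits psi 0%R (action_after c./2 w).
Proof.
move=> oc; apply/funext => m; rewrite /coord_bits [RHS]/fbits.
by case: (unpickle m) => [[j q]|]; [rewrite eE /coord_feature oc|].
Qed.

Definition bit_coord (n : nat) : nat :=
  if unpickle n : option (nat * rat) is Some (i, _) then
    if unpickle i : option (nat * nat) is Some (c, _) then c else 0%N
  else 0%N.

Let idle : Om := (point, fun=> (point, point)).

(** The counterpart of [trunc_at] on codes: bits of later coordinates are replaced by those of the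
    trajectory constantly equal to [point]. *)
Definition cut_bits (k : nat) (b : coin) : coin := fun n =>
  if (bit_coord n <= k)%N then b n else e idle n.

Let coord_bits_cut k c b :
  coord_bits c (cut_bits k b) = if (c <= k)%N then coord_bits c b else coord_bits c (e idle).
Proof.
transitivity (fun m => if (c <= k)%N then coord_bits c b m else coord_bits c (e idle) m).
  apply/funext => m; rewrite /coord_bits; case: (unpickle m) => [[j q]|]; last first.
    by case: (c <= k)%N.
  by rewrite /cut_bits /bit_coord !pickleK; case: (c <= k)%N.
by case: (c <= k)%N.
Qed.

Let coord_feature_idle k c j w : (k < c)%N ->
  coord_feature phi psi c j (trunc_at k w) = coord_feature phi psi c j idle.
Proof.
move=> kc; rewrite /coord_feature; case: (boolP (odd c)) => oc.
  rewrite /action_after/=.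
  have -> : c./2.*2.+1 = c by rewrite -[RHS]odd_double_half oc.
  by rewrite leqNgt kc.
have cE : c./2.*2 = c by rewrite -[RHS]odd_double_half (negbTE oc).
case ch : (c./2) cE => [|t] cE; first by rewrite -cE in kc.
by rewrite /state_at/= -doubleS cE leqNgt kc.
Qed.

Let cut_e k w : cut_bits k (e w) = e (trunc_at k w).
Proof.
apply/funext => n; rewrite /cut_bits /bit_coord /e /fbits.
case: (unpickle n) => [[i q]|]; last by case: (_ <= _)%N.
rewrite /trajectory_feature; case: (unpickle i) => [[c j]|]; last by case: (_ <= _)%N.
by case: leqP => ck; [rewrite coord_feature_trunc|rewrite coord_feature_idle].
Qed.

Let measurable_coord_bits c : measurable_fun setT (coord_bits c).
Proof.
apply: measurable_to_coin_bits => m; rewrite /coord_bits.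
case: (unpickle m) => [[j q]|]; first exact: (@measurable_bit _ coin id _ (@measurable_id _ _ _)).
by rewrite (_ : mkset _ = set0)//; apply/seteqP; split.
Qed.

Let measurable_cut_bits k : measurable_fun setT (cut_bits k).
Proof.
apply: measurable_to_coin_bits => m; rewrite /cut_bits.
case: (_ <= _)%N; first exact: (@measurable_bit _ coin id _ (@measurable_id _ _ _)).
by case: (e idle m); [rewrite (_ : mkset _ = setT)|rewrite (_ : mkset _ = set0)]
  => //; apply/seteqP; split.
Qed.

Let cut_prefix k b b' n : prefix_of b n = prefix_of b' n ->
  prefix_of (cut_bits k b) n = prefix_of (cut_bits k b') n.
Proof.
move=> /prefix_ofP h; apply/prefix_ofP => i iN; rewrite /cut_bits.
by case: (_ <= _)%N => //; exact: h.
Qed.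

Let depth n := \max_(i < n) bit_coord i.

Let depth_le m n : (m <= n)%N -> (depth m <= depth n)%N.
Proof.
move=> mn; apply/bigmax_leqP => i _.
exact: (@leq_bigmax _ (fun i : 'I_n => bit_coord i) (widen_ord mn i)).
Qed.

(** The first [n] bits involve coordinates up to [depth n]; the doubling only fits the even levels
    at which the laws are indexed. *)
Let level_prefix n (V : set (seq bool)) :
  level (depth n).*2 [set w | V (prefix_of (e w) n)].
Proof.
split; first exact: (measurable_preimage me (measurable_prefix n V)).
apply/seteqP; split => w; rewrite /preimage /mkset -cut_e;
  rewrite (_ : prefix_of (cut_bits _ _) n = prefix_of (e w) n)//;
  apply/prefix_ofP => i iN; rewrite /cut_bits ifT//;
  rewrite -addnn (leq_trans _ (leq_addr _ _))//;
  exact: (@leq_bigmax _ (fun i : 'I_n => bit_coord i) (Ordinal iN)).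
Qed.

(* The limit masses on words need not be carried by codes of trajectories, so
   laws are compared through the last identity instead of inverting [dec]. *)
Lemma trajectory_decode_exists : exists2 dec : coin -> borel Om, measurable_fun setT dec &
  (forall w, dec (e w) = w) /\ (forall k b, dec (cut_bits k b) = trunc_at k (dec b)).
Proof.
have [decX mX decXP] := decode_exists phi (state_borel M).
have [decA mA decAP] := decode_exists psi (action_borel M).
have XE c w : odd c = false -> decX (coord_bits c (e w)) = state_at c./2 w.
  by move=> oc; rewrite coord_bits_state//; apply: decXP; exact: cell_rep_cvg.
have AE c w : odd c -> decA (coord_bits c (e w)) = action_after c./2 w.
  by move=> oc; rewrite coord_bits_action//; apply: decAP; exact: cell_rep_cvg.
pose dec b : Om := (decX (coord_bits 0 b),
  fun s => (decA (coord_bits s.*2.+1 b), decX (coord_bits s.*2.+2 b))).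
have o1 s : odd s.*2.+1 by rewrite /= odd_double.
have o2 s : odd s.*2.+2 = false by rewrite /= odd_double.
have h1 s : s.*2.+1./2 = s by rewrite /= uphalf_double.
have h2 s : s.*2.+2./2 = s.+1 by rewrite /= doubleK.
have s_at t b : state_at t (dec b) = decX (coord_bits t.*2 b) by case: t.
exists dec.
  apply: (measurable_to_trajectory phi01 mphi ophi psi01 mpsi opsi) => t.
    apply: (eq_measurable_fun (fun b : coin => decX (coord_bits t.*2 b))).
      by move=> b _; rewrite -s_at.
    exact: (measurableT_comp mX (measurable_coord_bits _)).
  exact: (measurableT_comp mA (measurable_coord_bits _)).
split=> [w|k b].
  rewrite /dec XE// ; case: w => x s /=; congr pair; apply/funext => i.
  by rewrite XE// AE// h1 h2/= /action_after/=; case: (s i).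
rewrite /dec /trunc_at coord_bits_cut leq0n; congr pair; apply/funext => i /=.
congr pair; rewrite coord_bits_cut; case: (_ <= _)%N => //.
  by rewrite AE.
by rewrite XE// h2.
Qed.

(** The extension is made on codes, where consistent masses on words suffice, and then transported
    by decoding. *)
Lemma projective_limit_exists (S : nat -> probability (borel Om) R) :
  (forall s t E, (s <= t)%N -> level s.*2 E -> S t E = S s E) ->
  exists P : probability (borel Om) R, forall t E, level t.*2 E -> P E = S t E.
Proof.
move=> SS; have [dec mdec [dec_e dec_cut]] := trajectory_decode_exists.
(* The mass of a word is read in a law deep enough to know all its bits; consistency makes deeper
   laws agree. *)
pose wt s := fine (S (depth (size s)) (e @^-1` cylinder s)).
have mc s : measurable (e @^-1` cylinder s).
  exact: (measurable_preimage me (measurable_cylinder s)).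
have lc s : level (depth (size s)).*2 (e @^-1` cylinder s).
  exact: (level_prefix (size s) [set s]).
have wtE s t : (depth (size s) <= t)%N -> wt s = fine (S t (e @^-1` cylinder s)).
  by move=> st; rewrite /wt (SS _ _ _ st).
have wt1 : wt [::] = 1%R by rewrite /wt cylinder_nil preimage_setT prT.
have cwt : consistent wt.
  split => s; first exact: pr_ge0.
  rewrite (wtE s (depth (size s).+1)) ?depth_le// /wt -prU//.
    by rewrite -preimage_setU -cylinder_split.
  by rewrite -preimage_setI cylinder_disjoint preimage_set0.
pose L : probability coin R := image_law (@unit_uniform R) (@measurable_branch1 R wt).
have LE s : fine (L (cylinder s)) = wt s.
  by have := branch_law_cylinder s cwt; rewrite /branch_law wt1 => /(congr1 fine).
exists (image_law L mdec) => t E [mE tE].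
have mcut := measurable_cut_bits t.*2.
pose m1 : probability coin R := image_law L mcut.
pose m2 : probability coin R := image_law (S t) (measurableT_comp mcut me).
(* [E] depends only on coordinates up to [t.*2] and decoding commutes with cutting, so the laws of
   the cut codes are all that matters. *)
suff m12 : m1 (dec @^-1` E) = m2 (dec @^-1` E).
  transitivity (m1 (dec @^-1` E)).
    congr (L _); rewrite -[in LHS]tE; apply/seteqP; split => b /=; by rewrite dec_cut.
  rewrite m12; congr (S t _); rewrite -[in RHS]tE.
  by apply/seteqP; split => w /=; rewrite dec_cut dec_e.
apply: coin_measure_unique; last exact: (measurable_preimage mdec).
  by rewrite [ltLHS]probability_setT ltry.
move=> s; pose n := size s.
(* Cutting acts on each bit separately, so the first [n] bits decide whether the cut code starts
   with [s]; such an event can be compared word by word. *)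
pose good r := forall b, prefix_of b n = r -> prefix_of (cut_bits t.*2 b) n = s.
have goodE b : good (prefix_of b n) <-> cylinder s (cut_bits t.*2 b).
  by split => [h|h b' /(cut_prefix t.*2) ->//]; exact: h.
have [n' tn] : exists n', (t <= n')%N /\ (depth n <= n')%N.
  by exists (maxn t (depth n)); rewrite leq_maxl leq_maxr.
have lcut : level t.*2 ((cut_bits t.*2 \o e) @^-1` cylinder s).
  split; first exact: (measurable_preimage (measurableT_comp mcut me) (measurable_cylinder s)).
  apply/seteqP; split => w; rewrite /preimage /mkset /comp !cut_e trunc_trunc//.
transitivity (S n' ((cut_bits t.*2 \o e) @^-1` cylinder s)); last first.
  by rewrite (SS t n' _ tn.1 lcut).
have m1c : measurable (cut_bits t.*2 @^-1` cylinder s).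
  exact: (measurable_preimage mcut (measurable_cylinder s)).
rewrite -[RHS]prE; last by case: lcut.
transitivity (fine (L (cut_bits t.*2 @^-1` cylinder s)))%:E; first by rewrite prE.
congr EFin.
have -> : cut_bits t.*2 @^-1` cylinder s = [set b | [set _ | good (prefix_of b n)] b].
  by apply/seteqP; split => b /=; rewrite goodE.
have -> : (cut_bits t.*2 \o e) @^-1` cylinder s = [set w | [set _ | good (prefix_of (e w) n)] w].
  by apply/seteqP; split => w /=; rewrite goodE.
have mcst d (Z : measurableType d) (p : Prop) : measurable [set z : Z | p].
  have [hp|hp] := pselect p; first by rewrite (_ : mkset _ = setT)//; apply/seteqP; split.
  by rewrite (_ : mkset _ = set0)//; apply/seteqP; split.
apply: (@additive_prefix_eq _ _ coin (borel Om) R (fun E => fine (L E)) (fun E => fine (S n' E))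
  id e n (fun r => [set _ | good r]) (fun r => [set _ | good r])) => //.
- exact: additive_on_pr.
- exact: additive_on_pr.
move=> r rn; have [gr|gr] := pselect (good r); last first.
  have s0 T : [set _ : T | good r] = set0 by apply/seteqP; split.
  by rewrite (s0 coin) (s0 (borel Om)) !set0I !measure0.
have sT T : [set _ : T | good r] = setT by apply/seteqP; split.
by rewrite (sT coin) (sT (borel Om)) !setTI LE (wtE r n')// rn; case: tn.
Qed.

End projective_limit.

Section strategic_limit.
Context (R : realType) (M : mdp R).
Local Notation X := (state M).
Local Notation A := (action M).
Local Notation Om := (trajectory M).
Variables (phi : nat -> X -> R) (psi : nat -> A -> R).
Hypothesis phi01 : forall i x, (0 <= phi i x <= 1)%R.
Hypothesis mphi : forall i, measurable_fun [set: borel X] (phi i).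
Hypothesis ophi : forall O, open O -> fopen phi O.
Hypothesis psi01 : forall i a, (0 <= psi i a <= 1)%R.
Hypothesis cpsi : forall i, continuous (psi i).
Hypothesis opsi : forall O, open O -> fopen psi O.
Local Notation mst := (@measurable_state_at R M).
Local Notation mac := (@measurable_action_after R M).
Let mpsi : forall i, measurable_fun [set: borel A] (psi i) :=
  continuous_measurable_features cpsi.
Local Notation hist t := (borel X * t.-tuple (borel A * borel X))%type.
Local Notation next_state Q t := (state_step phi01 mphi ophi psi01 mpsi opsi Q t).
Local Notation next_action Q k := (action_step phi01 mphi ophi psi01 cpsi opsi Q k).

(** Both integrals are integrals against the law of the truncation, which is the same under [P] and
    [Q]. *)
Lemma integral_level (P Q : probability (borel Om) R) k (E : set (borel Om))
    (f : borel Om -> \bar R) :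
  (forall F, level k F -> P F = Q F) -> level k E -> measurable_fun setT f ->
  (forall w, 0 <= f w) -> (forall w, f (trunc_at k w) = f w) ->
  \int[P]_(w in E) f w = \int[Q]_(w in E) f w.
Proof.
move=> PQ [mE tE] mf f0 ft.
have mtr := measurable_trunc_at phi01 mphi ophi psi01 mpsi opsi k.
have toI (P' : probability (borel Om) R) :
    \int[P']_(w in E) f w = \int[image_law P' mtr]_(w in E) f w.
  rewrite -[in LHS]tE; under eq_integral do rewrite -ft.
  rewrite -[LHS](@ge0_integral_pushforward _ _ _ _ _ _ mtr P' E f)//.
  exact: measurable_funTS.
rewrite (toI P) (toI Q); apply: eq_measure_integral => B mB _.
apply: (PQ (trunc_at k @^-1` B)); split; first exact: (measurable_preimage mtr).
by apply/funext => w; rewrite /preimage/= trunc_trunc.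
Qed.

Lemma level_history t (E : set (hist t)) : measurable E -> level t.*2 (history t @^-1` E).
Proof.
move=> mE; split; first exact: (measurable_preimage (@measurable_history R M t)).
by apply/funext => w; rewrite /preimage/= history_trunc.
Qed.

Lemma level_state t (B : set (borel X)) : measurable B -> level t.*2 (@state_at R M t @^-1` B).
Proof.
move=> mB; split; first exact: (measurable_preimage (mst t)).
by apply/funext => w; rewrite /preimage/= state_at_trunc.
Qed.

Lemma level_action t (B : set (borel A)) :
  measurable B -> level t.*2.+1 (@action_after R M t @^-1` B).
Proof.
move=> mB; split; first exact: (measurable_preimage (mac t)).
by apply/funext => w; rewrite /preimage/= action_after_trunc.
Qed.

Lemma level_history_action t (E : set (hist t * borel A)) : measurable E ->
  level t.*2.+1 [set w | E (history t w, action_after t w)].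
Proof.
move=> mE; split.
  apply: (@measurable_preimage _ _ (borel Om) (hist t * borel A)%type
    (fun w => (history t w, action_after t w)) E _ mE).
  by apply: measurable_fun_pair; [exact: measurable_history|exact: mac].
by apply/funext => w; rewrite /preimage/= history_trunc// action_after_trunc.
Qed.

Lemma levelI k (E F : set (borel Om)) : level k E -> level k F -> level k (E `&` F).
Proof.
by move=> [mE tE] [mF tF]; split; [exact: measurableI|rewrite preimage_setI tE tF].
Qed.

(** Later steps do not change events of the levels already reached, so each conditional law can be
    checked right after the step that creates it. *)
Lemma chain_strategic (P0 : probability (borel X) R) (P : probability (borel Om) R)
    (S : nat -> probability (borel Om) R) (k : strategy M) :
  S 0%N = start_law phi01 mphi ophi psi01 cpsi opsi P0 ->
  (forall t, S t.+1 = next_state (next_action (S t) (k t)) t) ->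
  (forall t E, level t.*2 E -> P E = S t E) ->
  is_strategic_measure P0 k P.
Proof.
move=> S0 SS PS; split=> [B mB|t E G mE mG|t E G mE mG].
- by rewrite (PS 0%N) ?S0//; exact: (@level_state 0).
- have lE := level_history mE.
  have lEG : level t.*2.+1 (history t @^-1` E `&` action_after t @^-1` G).
    by apply: levelI; [exact: level_le lE|exact: level_action].
  rewrite (PS t.+1); last exact: level_le lEG.
  rewrite SS state_step_level// action_step_rectangle//.
  apply: (integral_level (k := t.*2)) => //.
  + by move=> F /PS.
  + apply: (measurableT_comp (f := k t ^~ G)); last exact: measurable_history.
    exact: measurable_kernel.
  + by move=> w; rewrite history_trunc.
- move=> E'; have lE : level t.*2.+1 E' by exact: level_history_action.
  have lEG : level t.+1.*2 (E' `&` state_at t.+1 @^-1` G).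
    by apply: levelI; [exact: level_le lE|exact: (@level_state t.+1)].
  rewrite (PS t.+1)// SS state_step_rectangle//.
  apply: (integral_level (k := t.*2.+1)) => //.
  + move=> F lF; rewrite (PS t.+1); last exact: level_le lF.
    by rewrite SS state_step_level.
  + apply: (measurableT_comp (f := @trans R M ^~ G)); first exact: measurable_kernel.
    by apply: measurable_fun_pair; [exact: mst|exact: mac].
  + by move=> w; rewrite state_at_trunc ?action_after_trunc.
Qed.

Context (U : set_system nat) {UU : UltraFilter U}.
Variables (P : nat -> probability (borel Om) R) (Q : probability (borel Om) R).

(** An open set is the increasing union of its interiors at finite levels, for each of which the
    inequality is known; here the refined features give way to the original topology. *)
Lemma open_le_plim (S : nat -> probability (borel Om) R) :
  (forall t, below_limit U (level_feature phi psi t.*2 : nat -> borel Om -> R) P (S t)) ->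
  (forall t E, level t.*2 E -> Q E = S t E) ->
  forall O : set Om, open O -> (fine (Q O) <= plim U P O)%R.
Proof.
move=> SP QS O oO.
pose G t := [set w | exists N, forall w', near_coords phi psi t.*2 N w w' -> O w'].
have oG t : fopen (level_feature phi psi t.*2) (G t).
  rewrite (_ : G t = [set w | exists N, near_by (level_feature phi psi t.*2) N w `<=` O]).
    exact: fopen_interior.
  apply/seteqP; split => w [N NO].
    by have [N' N'P] := level_near_coords phi psi t.*2 N; exists N' => w' /N'P/NO.
  by have [N' N'P] := near_coords_level phi psi t.*2 N; exists N' => w' /N'P/NO.
have lG t : level t.*2 (G t) by exact: (fopen_level_level phi01 mphi psi01 mpsi (oG t)).
have mO : measurable (O : set (borel Om)) by exact: sub_sigma_algebra.
have -> : O = \bigcup_t G t.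
  apply/seteqP; split => [w Ow|w [t _ [N NO]]]; last by apply: NO; exact: near_coords_refl.
  have [k kO] := open_level_nbhs ophi opsi oO Ow; exists k => //; exists k => w' h.
  by apply: kO; apply: near_coords_le h; rewrite // -addnn leq_addr.
apply: pr_le_bigcup.
- by move=> t; case: (lG t).
- move=> t w [N NO]; exists N => w' h; apply: NO; apply: near_coords_le h => //.
  by rewrite leq_double.
- move=> t; rewrite (QS t)//; apply: (le_trans (SP t _ (oG t))).
  apply: plim_le; [by case: (lG t)| |by move=> w Gw; exists t].
  by apply: bigcupT_measurable => s; case: (lG s).
Qed.

Hypothesis QP : forall O : set Om, open O -> (fine (Q O) <= plim U P O)%R.

Let integral_le (g : Om -> R) : continuous g -> (forall w, (0 <= g w <= 1)%R) ->
  (\int[Q]_w g w <= ulim U (fun i => \int[P i]_w g w))%R.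
Proof.
move=> cg g01.
have mg : measurable_fun [set: borel Om] g.
  exact: (@continuous_measurable_features R Om (fun=> g) (fun=> cg) 0%N).
(* The feature family is constantly [g]: its [fopen] sets are open, and [g] is lower semicontinuous
   for itself. *)
apply: (@flsc_integral_le R U UU _ (borel Om) (fun=> g)) => //.
  move=> O oO; apply: QP; rewrite openE => w Ow; have [N NO] := oO w Ow.
  apply: filterS NO _; exact: (@near_by_nbhs R Om (fun=> g) (fun=> cg)).
move=> r w /= rw; exists (Num.truncn (g w - r)^-1).+1 => w' /(_ 0%N isT).
have gr : (0 < g w - r)%R by rewrite subr_gt0.
have := truncnS_gt (g w - r)^-1; set n := (Num.truncn _).+1 => nP.
have : (n.+1%:R^-1 < g w - r)%R.
  rewrite invf_plt ?posrE ?ltr0n//; apply: (lt_trans nP); by rewrite ltr_nat.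
rewrite /= ltr_norml => nr /andP[_]; move: (_^-1)%R (g w) (g w') nr => a b c; lra.
Qed.

Lemma integral_cvg (g : Om -> R) : continuous g -> (exists K : R, forall w, (`|g w| <= K)%R) ->
  (fun i => \int[P i]_w g w)%R @ U --> (\int[Q]_w g w)%R.
Proof.
have mc (h : Om -> R) : continuous h -> measurable_fun [set: borel Om] h.
  by move=> ch; exact: (@continuous_measurable_features R Om (fun=> h) (fun=> ch) 0%N).
have bc (h : Om -> R) : continuous h -> (forall w, (0 <= h w <= 1)%R) ->
    @bounded_mfun _ (borel Om) R h.
  by move=> ch h01; apply: bounded_mfun01 => //; exact: mc.
have base (h : Om -> R) : continuous h -> (forall w, (0 <= h w <= 1)%R) ->
    ulim U (fun i => \int[P i]_w h w)%R = (\int[Q]_w h w)%R.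
  move=> ch h01; apply/eqP; rewrite eq_le integral_le// andbT.
  (* Applying the inequality to [1 - h] gives the reverse bound for [h]. *)
  pose h' w := (1 + (-1) * h w)%R.
  have h'01 w : (0 <= h' w <= 1)%R by rewrite /h'; have := h01 w; lra.
  have ch' : continuous h'.
    move=> w; apply: cvgD; first exact: cvg_cst.
    by apply: cvgM; [exact: cvg_cst|exact: ch].
  have inth' (P' : probability (borel Om) R) : (\int[P']_w h' w = 1 + (-1) * \int[P']_w h w)%R.
    rewrite RintegralDb ?Rintegral_cst1 ?RintegralZb//; [exact: bc|exact: bounded_mfun_cst|].
    by apply: bounded_mfunZ; exact: bc.
  have := integral_le ch' h'01; rewrite inth'.
  under [X in ulim _ X]eq_fun do rewrite inth'.
  have bh : bounded_family (fun i => \int[P i]_w h w)%R.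
    by apply: Rintegral_bounded_family; exact: bc.
  rewrite ulimD ?ulim_cst ?ulimZ//; first lra.
  - by exists 1%R => i; rewrite normr1.
  - by case: bh => K hK; exists K => i; rewrite mulN1r normrN.
move=> cg [K gK].
have K0 : (0 <= K)%R by apply: le_trans (gK point).
(* Affine rescaling into the unit interval; [K + 1] keeps [c] positive when [K] is 0. *)
pose c := (2 * (K + 1))%R; have c0 : (0 < c)%R by rewrite /c; lra.
pose h w := (c^-1 * (g w + (K + 1)))%R.
have ch : continuous h.
  move=> w; apply: cvgM; first exact: cvg_cst.
  by apply: cvgD; [exact: cg|exact: cvg_cst].
have h01 w : (0 <= h w <= 1)%R.
  have := gK w; rewrite ler_norml /h => /andP[g1 g2].
  rewrite mulr_ge0 ?invr_ge0 ?(ltW c0)//=; last lra.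
  by rewrite mulrC ler_pdivrMr// mul1r /c; lra.
have gE (P' : probability (borel Om) R) :
    (\int[P']_w g w = c * \int[P']_w h w + (- (K + 1)))%R.
  have bh := bc h ch h01; have bK := @bounded_mfun_cst _ (borel Om) R (- (K + 1))%R.
  rewrite -(RintegralZb P' c bh) -[X in (_ + X)%R](Rintegral_cst1 P').
  rewrite -(RintegralDb P' (bounded_mfunZ c bh) bK).
  by apply: eq_Rintegral => w _; rewrite /h mulrA mulfV ?gt_eqF// mul1r addrK.
rewrite gE; under eq_fun do rewrite gE.
apply: cvgD; last exact: cvg_cst.
apply: cvgM; first exact: cvg_cst.
rewrite -base//; apply: ulim_cvg; apply: Rintegral_bounded_family; exact: bc.
Qed.

End strategic_limit.

Lemma strategic_limit_exists (R : realType) (M : mdp R) (P0 : probability (borel (state M)) R)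
    (U : set_system nat) {UU : UltraFilter U}
    (P : nat -> probability (borel (trajectory M)) R) :
  semicontinuous M -> (forall i, strategic_measures P0 (P i)) ->
  exists2 Q : probability (borel (trajectory M)) R, strategic_measures P0 Q &
    forall g : trajectory M -> R, continuous g -> (exists K : R, forall w, (`|g w| <= K)%R) ->
    (fun i => \int[P i]_w g w)%R @ U --> (\int[Q]_w g w)%R.
Proof.
move=> scM sP.
have cA : compact [set: action M] by case: scM => -[].
have [psi [psi01 cpsi opsi]] := topological_borel_space_features (action_borel M).
have [phi [phi01 mphi ophi lsc]] := transition_features psi01 cpsi opsi scM.
have [S [k [S0 SS SP]]] :=
  limit_chain_exists phi01 mphi ophi psi01 cpsi opsi lsc cA (UU := UU) sP.
have [Q QS] := projective_limit_exists phi01 mphi ophi psi01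
  (continuous_measurable_features cpsi) opsi (limit_chain_level SS).
exists Q; first by exists k; exact: (chain_strategic S0 SS QS).
move=> g cg bg; apply: integral_cvg => //.
exact: (open_le_plim phi01 mphi ophi psi01 cpsi opsi SP QS).
Qed.

(** * Occupation measures and the projection *)

Lemma cvg_initialP (S : choiceType) (T : topologicalType) (f : S -> T) (F : set_system S)
    (s : S) : Filter F ->
  F --> (s : initial_topology f) <-> f @ F --> f s.
Proof.
move=> FF; split => [Fs V nV|fF V].
  exact: (Fs _ (@initial_continuous _ _ f s V nV)).
rewrite nbhsE => -[W [[B oB BW] Ws] WV].
apply: (filterS WV); rewrite -BW; apply: fF.
by apply: open_nbhs_nbhs; split => //; rewrite -BW in Ws.
Qed.

Lemma cvg_ptwsP (I : Type) (T : topologicalType) (F : set_system {ptws I -> T})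
    (f : {ptws I -> T}) : Filter F ->
  F --> f <-> forall i, (fun h : {ptws I -> T} => h i) @ F --> f i.
Proof.
move=> FF; split => [Ff i|Ff]; first by move/cvg_sup/(_ i)/cvg_initialP : Ff.
by apply/cvg_sup => i; exact/cvg_initialP.
Qed.

Section weak_convergence.
Context (R : realType) (M : mdp R) (P0 : probability (borel (state M)) R) (z : state M).
Local Notation strategic := (set_type (strategic_measures P0)).

(** The weak topology is unfolded through three initial topologies: the subtype, the map to
    integrals and the pointwise topology. *)
Lemma strategic_cvgP (F : set_system strategic) (P : strategic) : Filter F ->
  F --> P <-> forall g : trajectory M -> R, continuous g ->
    (exists K : R, forall w, (`|g w| <= K)%R) ->
    (fun Q : strategic => \int[set_val Q : probability (borel (trajectory M)) R]_w g w)%R @ F -->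
    (\int[set_val P : probability (borel (trajectory M)) R]_w g w)%R.
Proof.
move=> FF; have e1 := @cvg_initialP strategic _ set_val F P FF.
have FF1 : Filter (set_val @ F) by exact: fmap_filter.
have e2 := @cvg_initialP (weak_probability R (trajectory M)) _
  (@probability_integrals R (trajectory M)) (set_val @ F) (set_val P) FF1.
have FF2 : Filter (@probability_integrals R (trajectory M) @ (set_val @ F)) by exact: fmap_filter.
have e3 := @cvg_ptwsP (bounded_continuous R (trajectory M)) R _
  (@probability_integrals R (trajectory M) (set_val P)) FF2.
split => [/e1/e2/e3 h g cg bg|h]; first exact: (h (exist _ g (conj cg bg))).
by apply/e1/e2/e3 => -[g [cg bg]]; exact: h.
Qed.

Hypothesis absorbing_z : absorbing P0 z.

Lemma projection_cvgP (F : set_system strategic) (P : strategic) : Filter F ->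
  projection absorbing_z @ F --> projection absorbing_z P <->
  forall g : state M * action M -> R, {within transient z, continuous g} ->
    (exists K : R, forall x, transient z x -> (`|g x| <= K)%R) ->
    (fun Q : strategic =>
      \int[occupation_measure absorbing_z Q]_(x in transient z) g x)%R @ F -->
    (\int[occupation_measure absorbing_z P]_(x in transient z) g x)%R.
Proof.
move=> FF; have FF0 : Filter (projection absorbing_z @ F) by exact: fmap_filter.
have e1 := @cvg_initialP (set_type (occupation_measures absorbing_z)) _ set_val
  (projection absorbing_z @ F) (projection absorbing_z P) FF0.
have FF1 : Filter (set_val @ (projection absorbing_z @ F)) by exact: fmap_filter.
have e2 := @cvg_initialP (finite_measure_on R (transient z)) _
  (@measure_integrals R _ (transient z)) (set_val @ (projection absorbing_z @ F))
  (set_val (projection absorbing_z P)) FF1.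
have FF2 : Filter (@measure_integrals R _ (transient z) @ (set_val @ (projection absorbing_z @ F))).
  exact: fmap_filter.
have e3 := @cvg_ptwsP (bounded_continuous_on R (transient z)) R _
  (@measure_integrals R _ (transient z) (set_val (projection absorbing_z P))) FF2.
split => [/e1/e2/e3 h g cg bg|h]; first exact: (h (exist _ g (conj cg bg))).
by apply/e1/e2/e3 => -[g [cg bg]]; exact: h.
Qed.

End weak_convergence.

Section transient_times.
Context (R : realType) (M : mdp R) (P0 : probability (borel (state M)) R) (z : state M).
Local Notation X := (state M).
Local Notation A := (action M).
Local Notation Om := (trajectory M).
Hypothesis absorbing_z : absorbing P0 z.

Definition transient_at t : set (borel Om) := state_at t @^-1` (~` [set z]).

Definition unabsorbed t : set (borel Om) := [set w | t%:R%:E < hitting_time z w].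

Lemma measurable_transient_at t : measurable (transient_at t).
Proof. exact: (measurable_at_state t (measurableC (measurable_state z))). Qed.

Lemma measurable_unabsorbed t : measurable (unabsorbed t).
Proof.
rewrite -[X in measurable X]setTI; apply: emeasurable_fun_o_infty => //.
exact: measurable_hitting_time.
Qed.

Lemma unabsorbed_transient t : unabsorbed t `<=` transient_at t.
Proof. by move=> w /lt_hitting_time; exact. Qed.

Lemma escape_null P t : strategic_measures P0 P ->
  P (~` transient_at t `&` transient_at t.+1) = 0.
Proof.
have [_ pz _] := absorbing_z; move=> [pi [_ _ HP]].
have [phi [phi01 cphi ophi]] := topological_borel_space_features (state_borel M).
have [psi [psi01 cpsi opsi]] := topological_borel_space_features (action_borel M).
have mext := @measurable_extend_history R M phi psi phi01
  (continuous_measurable_features cphi) ophi psi01 cpsi opsi t.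
have mz := measurable_state z.
pose E := [set ha : (borel X * t.-tuple (borel A * borel X)) * borel A |
  state_at t (extend_history ha.1) = z].
have mE : measurable E.
  apply: (@measurable_preimage _ _ _ (borel X)
    (fun ha : (borel X * t.-tuple (borel A * borel X)) * borel A =>
      state_at t (extend_history ha.1)) [set z] _ mz).
  apply: (measurableT_comp (@measurable_state_at R M t)).
  exact: (measurableT_comp mext measurable_fst).
have := HP t E _ mE (measurableC mz).
rewrite (_ : [set w | _] = ~` transient_at t); last first.
  rewrite /transient_at preimage_setC setCK; apply/funext => w; rewrite /E/=.
  by rewrite -(state_at_trunc _ (leqnn t.*2)) trunc_extend_history state_at_trunc.
move=> /= ->; apply: integral0_eq => w; rewrite /transient_at preimage_setC setCK => ->.
set mu := trans M _.
have muT : mu setT = 1 by exact: prob_kernel.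
have mu1 : mu [set z] = 1 := pz _.
have : mu setT = mu [set z] + mu (~` [set z]).
  rewrite -(setUv ([set z] : set (borel X))) measureU//; first exact: measurableC.
  exact: setICr.
rewrite muT mu1; case: (mu _) => [r||]//= [] /eqP.
by rewrite addrC -subr_eq subrr => /eqP <-.
Qed.

(** A trajectory that is away from [z] at time [t] after having visited it must have escaped from
    [z] in between, which has probability 0. *)
Lemma unabsorbedE P t : strategic_measures P0 P -> P (unabsorbed t) = P (transient_at t).
Proof.
move=> sP; have mT := measurable_transient_at; have mU := measurable_unabsorbed.
have mD s : measurable (transient_at s `\` unabsorbed s) by exact: measurableD.
suff h : P (transient_at t `\` unabsorbed t) = 0.
  transitivity (P (unabsorbed t `|` transient_at t `\` unabsorbed t)); last first.
    by rewrite (setDUK (@unabsorbed_transient t)).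
  rewrite -[LHS]adde0 -h; apply/esym/measureU => //; by rewrite setDE setICA setICr setI0.
elim: t => [|t ih].
  rewrite (_ : _ `\` _ = set0) ?measure0//; apply/seteqP; split => // w [/= w0].
  by case; apply/lt_hitting_time => s; rewrite leqn0 => /eqP ->.
have mesc : measurable (~` transient_at t `&` transient_at t.+1).
  by apply: measurableI => //; exact: measurableC.
have nul : P.-negligible ((~` transient_at t `&` transient_at t.+1) `|`
    (transient_at t `\` unabsorbed t)).
  apply: negligibleU; first exact: ((negligibleP P mesc).2 (escape_null t sP)).
  exact: ((negligibleP P (mD t)).2 ih).
apply: (measure_negligible (mD _)); apply: negligibleS nul => w [wt1 /= uw].
have [wt|] := pselect (transient_at t w); last by left.
right; split => // /lt_hitting_time h; apply: uw; apply/lt_hitting_time => s.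
by rewrite leq_eqVlt => /orP[/eqP -> //|]; exact: h.
Qed.

Definition transient_tail (P : probability (borel Om) R) (n : nat) : \bar R :=
  \sum_(n <= t <oo) P (transient_at t).

Lemma transient_tail_split P m n : (m <= n)%N ->
  transient_tail P m = \sum_(m <= t < n) P (transient_at t) + transient_tail P n.
Proof.
by move=> /subnKC <-; rewrite /transient_tail; apply: nneseries_split.
Qed.

Lemma transient_tail_le P m n : (m <= n)%N -> transient_tail P n <= transient_tail P m.
Proof.
by move=> mn; rewrite (transient_tail_split P mn) leeDr// sume_ge0.
Qed.

Lemma transient_tail_ge0 P n : 0 <= transient_tail P n.
Proof. by apply: nneseries_ge0 => t _ _; exact: measure_ge0. Qed.

Lemma occupation_setT P : occupation z P setT = transient_tail P 0.
Proof. by rewrite /occupation setTI. Qed.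

Lemma transient_tail_fin P n : strategic_measures P0 P -> transient_tail P n \is a fin_num.
Proof.
move=> sP; rewrite ge0_fin_numE; last exact: transient_tail_ge0.
apply: le_lt_trans (occupation_lty absorbing_z sP).
by rewrite occupation_setT transient_tail_le.
Qed.

Lemma hitting_tail P n : strategic_measures P0 P ->
  \int[P]_w (\sum_(n <= t <oo) if t%:R%:E < hitting_time z w then 1 else 0) =
  transient_tail P n.
Proof.
move=> sP; pose f t (w : borel Om) : \bar R :=
  if (n <= t)%N then (\1_(unabsorbed t) w)%:E else 0.
have mf t : measurable_fun setT (f t).
  rewrite /f; case: (n <= t)%N; last exact: measurable_cst.
  apply/measurable_EFinP; apply: measurable_indic; exact: measurable_unabsorbed.
transitivity (\int[P]_w \sum_(t <oo) f t w).
  apply: eq_integral => w _; rewrite [LHS]eseries_cond/= eseries_mkcond.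
  apply: eq_eseriesr => t _; rewrite /f; case: (n <= t)%N => //.
  by rewrite indicE; case: ifPn => [h|/negP h]; [rewrite mem_set|rewrite memNset].
rewrite integral_nneseries//; last first.
  by move=> t w _; rewrite /f; case: (n <= t)%N; rewrite ?lee_fin.
rewrite /transient_tail [RHS]eseries_cond/= [RHS]eseries_mkcond.
apply: eq_eseriesr => t _; rewrite /f; case: (n <= t)%N; last exact: integral0.
rewrite integral_indic ?setIT; [exact: unabsorbedE|by []|exact: measurable_unabsorbed].
Qed.

(** The occupation measure is the sum of the laws of the state-action pairs. The first [n] are
    peeled off one at a time, and what remains has mass [transient_tail] on the transient set. *)
Lemma occupation_integral_near (Q : set_type (strategic_measures P0)) (n : nat)
    (h : X * A -> R) (K : R) :
  measurable_fun [set: borel (X * A)%type] h -> (forall x, (`|h x| <= K)%R) ->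
  (forall x, ~ transient z x -> h x = 0%R) ->
  (`| \int[occupation_measure absorbing_z Q]_(x in transient z) h x -
     \sum_(t < n) \int[set_val Q : probability (borel Om) R]_w h (state_action t w) | <=
   K * fine (transient_tail (set_val Q) n))%R.
Proof.
move=> mh hK h0; set P : probability (borel Om) R := set_val Q.
have sP : strategic_measures P0 P by exact: set_valP.
pose nu t : probability (borel (X * A)%type) R := image_law P (@measurable_state_action R M t).
pose D : set (borel (X * A)%type) := transient z.
have mD : measurable D by exact: measurable_transient.
pose rho n := mseries nu n.
have rhoD k : rho k D = transient_tail P k by [].
have fin (m : {measure set (borel (X * A)%type) -> \bar R}) : m D < +oo ->
    m.-integrable D (EFin \o h).
  move=> mfin; apply: measurable_bounded_integrable => //; first exact: measurable_funTS.
  by exists K; split; [rewrite num_real|move=> c Kc x _ /=; rewrite (le_trans (hK x))// ltW].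
have nuD t : nu t D < +oo by apply: le_lt_trans (probability_le1 _ mD) _; rewrite ltry.
have rfin k : rho k D < +oo by rewrite rhoD -ge0_fin_numE ?transient_tail_fin ?transient_tail_ge0.
have step k : (\int[rho k]_(x in D) h x = \int[nu k]_(x in D) h x + \int[rho k.+1]_(x in D) h x)%R.
  rewrite /Rintegral -fineD; [|exact: integrable_fin_num (fin _ (nuD k))|
    exact: integrable_fin_num (fin _ (rfin k.+1))].
  congr fine; rewrite -[RHS](integral_measure_add mD (fin _ (nuD k)) (fin _ (rfin k.+1))).
  apply: eq_measure_integral => B mB _; rewrite [RHS]measure_addE.
  have := @nneseries_split _ (fun t => nu t B) k 1 (fun t _ => measure_ge0 (nu t) B).
  rewrite addn1 big_nat1; exact.
have nuE t : (\int[nu t]_(x in D) h x = \int[P]_w h (state_action t w))%R.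
  congr fine; transitivity (\int[nu t]_x (h x)%:E).
    rewrite integral_mkcond; apply: eq_integral => x _; rewrite patchE.
    by case: ifPn => // /negP; rewrite inE => /h0 ->.
  rewrite [LHS](@integral_pushforward _ _ _ _ _ _ (@measurable_state_action R M t) P setT (EFin \o h))//.
  - exact/measurable_EFinP.
  - rewrite preimage_setT; apply: measurable_bounded_integrable => //.
    + by rewrite [ltLHS]probability_setT ltry.
    + exact: (measurableT_comp mh (@measurable_state_action R M t)).
    + by exists K; split; [rewrite num_real|move=> c Kc x _ /=; rewrite (le_trans (hK _))// ltW].
have -> : (\int[occupation_measure absorbing_z Q]_(x in transient z) h x =
    \int[rho 0%N]_(x in D) h x)%R.
  congr fine; apply: eq_measure_integral => B mB BD.
  by rewrite /= /finite_occupation /occupation /rho /mseries (setIidl BD).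
have -> : (\int[rho 0%N]_(x in D) h x = \sum_(t < n) \int[P]_w h (state_action t w) +
    \int[rho n]_(x in D) h x)%R.
  elim: n => [|k ih]; first by rewrite big_ord0 add0r.
  by rewrite ih big_ord_recr/= -addrA -nuE -step.
rewrite addrC addKr -rhoD.
have ih := fin _ (rfin n).
apply: (le_trans (le_normr_Rintegral mD ih)); rewrite -Rintegral_cst//.
apply: le_Rintegral => //; first exact: (integrable_norm ih).
apply: (measurable_bounded_integrable mD (rfin n)); first exact: measurable_cst.
by exists `|K|%R; split; [rewrite num_real|move=> c Kc x _ /=; exact: ltW].
Qed.

End transient_times.

Lemma cvg_sum_ord (R : realType) (T : Type) (F : set_system T) {FF : Filter F} (n : nat)
    (f : nat -> T -> R) (l : nat -> R) :
  (forall t, f t @ F --> l t) ->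
  (fun x => \sum_(t < n) f t x)%R @ F --> (\sum_(t < n) l t)%R.
Proof.
move=> fl; have cD : continuous (fun z : R * R => z.1 + z.2)%R.
  by move=> z; apply: cvgD; [exact: cvg_fst|exact: cvg_snd].
by apply: (cvg_big cD) => t _; exact: fl.
Qed.

(** * The two implications *)

Section continuity.
Context (R : realType) (M : mdp R) (P0 : probability (borel (state M)) R) (z : state M).
Local Notation X := (state M).
Local Notation A := (action M).
Local Notation Om := (trajectory M).
Local Notation strategic := (set_type (strategic_measures P0)).

(** Keeps the suprema in the definition of uniform absorption nonnegative. The witness always plays
    the action [point]. *)
Lemma strategic_measures_nonempty : strategic_measures P0 !=set0.
Proof.
have [phi [phi01 cphi ophi]] := topological_borel_space_features (state_borel M).
have [psi [psi01 cpsi opsi]] := topological_borel_space_features (action_borel M).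
have mphi := continuous_measurable_features cphi.
pose k : strategy M := fun t => @noise_pker _ _ _ _ R (fun=> point) (measurable_cst point).
pose S := nat_rect (fun=> probability (borel Om) R)
  (start_law phi01 mphi ophi psi01 cpsi opsi P0)
  (fun t Q => state_step phi01 mphi ophi psi01 (continuous_measurable_features cpsi) opsi
    (action_step phi01 mphi ophi psi01 cpsi opsi Q (k t)) t).
have SS := @limit_chain_level _ _ _ _ phi01 mphi ophi psi01 cpsi opsi S k (fun t => erefl).
have [Q QS] := projective_limit_exists phi01 mphi ophi psi01
  (continuous_measurable_features cpsi) opsi SS.
by exists Q; exists k; exact: (chain_strategic (erefl _) _ QS).
Qed.

Hypothesis absorbing_z : absorbing P0 z.

Lemma open_absorbing_state : open [set z].
Proof.
have [[_ [V zV]] + _ _] := absorbing_z; rewrite setIT => VE.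
by rewrite openE => _ ->; rewrite -VE.
Qed.

(** The state [z] is isolated and closed, so both pieces of the definition by cases are open. *)
Lemma transient_extension_continuous (g : X * A -> R) :
  {within transient z, continuous g} ->
  continuous (fun xa => if xa.1 == z then 0%R else g xa).
Proof.
have cfst : continuous (fst : X * A -> X) by move=> ?; exact: cvg_fst.
have oz : open (fst @^-1` [set z] : set (X * A)).
  by move/continuousP : cfst; apply; exact: open_absorbing_state.
have oD : open (transient z : set (X * A)).
  move/continuousP : cfst => /(_ (~` [set z])); apply.
  exact/closed_openC/closed_state.
rewrite continuous_open_subspace// => cg xa; set f := (fun _ => _).
have [xz|xz] := pselect (xa.1 = z).
  apply: (@cvg_trans _ ((fun=> f xa) @ xa)); last first.
    exact: (@cvg_cst R (f xa) (X * A)%type (nbhs xa) (nbhs_filter xa)).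
  apply: near_eq_cvg; have := open_nbhs_nbhs (conj oz xz); apply: filterS => y /= yz.
  by rewrite /f yz xz eqxx.
apply: (@cvg_trans _ (g @ xa)).
  apply: near_eq_cvg; have := open_nbhs_nbhs (conj oD xz); apply: filterS => y yz.
  by rewrite /f; case: eqP.
have gx : g xa = f xa by rewrite /f; case: eqP.
by have := cg xa (mem_set xz); rewrite /continuous_at gx.
Qed.

Lemma transient_probability_continuous (F : set_system strategic) (P : strategic) t :
  Filter F -> F --> P ->
  (fun Q : strategic => fine ((set_val Q : probability (borel Om) R) (transient_at z t))) @ F -->
  fine ((set_val P : probability (borel Om) R) (transient_at z t)).
Proof.
move=> FF FP.
pose h (w : Om) : R := if state_at t w == z then 0%R else 1%R.
have hE (Q : probability (borel Om) R) : fine (Q (transient_at z t)) = (\int[Q]_w h w)%R.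
  rewrite -Rintegral_pr; last exact: measurable_transient_at.
  apply: eq_Rintegral => w _; rewrite /h /transient_at; case: eqP => wz.
    by rewrite memNset//= => /(_ wz).
  by rewrite mem_set.
rewrite hE; under eq_fun do rewrite hE.
apply: ((strategic_cvgP _ _).1 FP).
  have c1 := @transient_extension_continuous (fun=> 1%R) (continuous_subspaceT (@cst_continuous _ R 1%R)).
  move=> w; apply: (@continuous_comp _ _ _ (@state_action R M t)
    (fun xa : X * A => (if xa.1 == z then 0%R else 1%R) : R)); last exact: c1.
  exact: continuous_state_action.
by exists 1%R => w; rewrite /h; case: eqP => _; rewrite ?normr0// normr1.
Qed.

Lemma projection_continuous : uniformly_absorbing P0 z -> continuous (projection absorbing_z).
Proof.
move=> [_ tail0] P.
apply: (@projection_cvgP _ _ _ _ absorbing_z (nbhs P) P (nbhs_filter P)).2 => g cg [K gK].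
pose h (xa : X * A) : R := if xa.1 == z then 0%R else g xa.
have ch : continuous h by exact: transient_extension_continuous.
have mh : measurable_fun [set: borel (X * A)%type] h.
  exact: (@continuous_measurable_features R (X * A)%type (fun=> h) (fun=> ch) 0%N).
(* [K] bounds [g] only on the transient set and may be negative if that set is empty; [L] is a
   positive bound everywhere. *)
pose L := (`|K| + 1)%R; have L0 : (0 < L)%R by rewrite ltr_pwDr.
have hL xa : (`|h xa| <= L)%R.
  rewrite /h; case: eqP => xz; first by rewrite normr0 ltW.
  by rewrite (le_trans (gK _ xz))// (le_trans (ler_norm K))// lerDl.
have h0 xa : ~ transient z xa -> h xa = 0%R by rewrite /h => /contrapT ->; rewrite eqxx.
have gh (Q : strategic) : (\int[occupation_measure absorbing_z Q]_(x in transient z) g x =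
    \int[occupation_measure absorbing_z Q]_(x in transient z) h x)%R.
  by apply: eq_Rintegral => x; rewrite inE /h => xz; case: eqP.
rewrite gh; under eq_fun do rewrite gh.
apply/cvgrPdist_lt => e e0.
(* The two remainders and the change of the finite sum each contribute [e / 3]. *)
pose d := (e / (3 * L))%R; have d0 : (0 < d)%R by rewrite divr_gt0// mulr_gt0.
have [n nd] : exists n, forall Q, strategic_measures P0 Q ->
    (fine (transient_tail z Q n) <= d)%R.
  apply: contrapT => /forallNP nt.
  suff : d%:E <= 0 by rewrite lee_fin leNgt d0.
  apply: (cvge_to_ge tail0); apply: nearW => n.
  have /existsNP[Q /not_implyP[sQ /negP]] := nt n; rewrite -ltNge => dQ.
  apply: le_ereal_sup_tmp; exists (transient_tail z Q n).
    by exists Q => //; exact: (hitting_tail absorbing_z n sQ).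
  by rewrite -[leRHS]fineK ?(transient_tail_fin absorbing_z)// lee_fin ltW.
pose J t (Q : strategic) := (\int[set_val Q : probability (borel Om) R]_w h (state_action t w))%R.
pose I Q := (\sum_(t < n) J t Q)%R.
have near_I Q : (`|\int[occupation_measure absorbing_z Q]_(x in transient z) h x - I Q| <= e / 3)%R.
  apply: (le_trans (occupation_integral_near absorbing_z Q n mh hL h0)).
  apply: (@le_trans _ _ (L * d)%R); first by rewrite ler_pM2l// nd//; exact: set_valP.
  by rewrite /d mulrCA invfM [(L * (_ / _))%R]mulrCA mulfV ?gt_eqF// mulr1.
have cI : I @ nbhs P --> I P.
  have FP := nbhs_filter P; apply: (@cvg_sum_ord R strategic (nbhs P) FP n J (J ^~ P)) => t.
  apply: ((@strategic_cvgP _ _ _ (nbhs P) P FP).1 _); first by [].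
    move=> w; apply: (@continuous_comp _ _ _ (@state_action R M t) h); last exact: ch.
    exact: continuous_state_action.
  by exists L.
have e3 : (0 < e / 3)%R by rewrite divr_gt0.
move/cvgrPdist_lt : cI => /(_ _ e3); apply: filterS => Q PQ.
have /ler_normlP[h1 h2] := near_I P; have /ler_normlP[h3 h4] := near_I Q.
move: PQ h1 h2 h3 h4; rewrite !ltr_norml.
move: (I P) (I Q) (Rintegral _ _ _) (Rintegral _ _ _) => a b c c' /andP[h5 h6] h1 h2 h3 h4.
by apply/andP; split; lra.
Qed.

Lemma continuous_uniformly_absorbing : semicontinuous M ->
  continuous (projection absorbing_z) -> uniformly_absorbing P0 z.
Proof.
move=> scM cpr; split => //.
set s := (fun n => ereal_sup _).
have tail_s Q n : strategic_measures P0 Q -> transient_tail z Q n <= s n.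
  by move=> sQ; apply: ereal_sup_ubound; exists Q => //; exact: (hitting_tail absorbing_z n sQ).
have s_ni : nonincreasing_seq s.
  move=> m n mn; apply: ge_ereal_sup => _ [Q sQ <-].
  rewrite (hitting_tail absorbing_z n sQ); apply: le_trans (tail_s Q m sQ).
  exact: transient_tail_le.
have s0 : 0 <= ereal_inf (range s).
  have [Q sQ] := strategic_measures_nonempty.
  apply: le_ereal_inf_tmp => _ [n _ <-]; apply: le_trans (tail_s Q n sQ).
  exact: transient_tail_ge0.
suff <- : ereal_inf (range s) = 0 by exact: ereal_nonincreasing_cvgn.
apply/eqP; rewrite eq_le s0 andbT leNgt; apply/negP => inf_gt0.
have [e e0 es] : exists2 e : R, (0 < e)%R & forall n, e%:E < s n.
  have [e e0 ei] : exists2 e : R, (0 < e)%R & e%:E < ereal_inf (range s).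
    case: (ereal_inf (range s)) inf_gt0 => [r| |]//.
      by rewrite lte_fin => r0; exists (r / 2)%R; rewrite ?divr_gt0// lte_fin ltr_pdivrMr//; lra.
    by move=> _; exists 1%R; rewrite ?ltry.
  by exists e => // n; apply: (lt_le_trans ei); apply: ereal_inf_lbound; exists n.
have /choice[P PP] : forall n, exists P : strategic,
    (e < fine (transient_tail z (set_val P) n))%R.
  move=> n; have [_ [Q sQ <-]] := ereal_sup_gt (es n).
  rewrite (hitting_tail absorbing_z n sQ) => eQ.
  exists (exist _ Q (mem_set sQ)); rewrite -lte_fin fineK//.
  exact: (transient_tail_fin absorbing_z).
(* The ultrafilter contains all tails of the integers, so inequalities valid from some index on pass
   to the limit. *)
have [U [UU Uoo]] := ultraFilterLemma eventually_filter.
have [Q sQ PQ] := @strategic_limit_exists R M P0 U UU (fun n => set_val (P n)) scM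
  (fun n => set_valP (P n)).
pose Q' : strategic := exist _ Q (mem_set sQ).
have FP : P @ U --> Q'.
  by apply/strategic_cvgP => g cg bg; exact: PQ.
(* Tested against the constant 1, continuity of the projection gives convergence of the total
   masses. *)
have total (P' : strategic) :
    (\int[occupation_measure absorbing_z P']_(x in transient z) 1 =
     fine (transient_tail z (set_val P') 0))%R.
  rewrite Rintegral_cst ?mul1r; last exact: measurable_transient.
  by rewrite /= /finite_occupation /occupation setIid.
have FU : Filter (P @ U) by exact: fmap_filter.
have ctotal : (fun n => fine (transient_tail z (set_val (P n)) 0)) @ U -->
    fine (transient_tail z Q 0).
  have := (@projection_cvgP _ _ _ _ absorbing_z (P @ U) Q' FU).1 _ (fun=> 1%R).
  rewrite total (_ : (fun P' : strategic => _) =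
      (fun P' => fine (transient_tail z (set_val P') 0))); last exact/funext/total.
  apply.
  - by move=> V nV; exact: (FP _ (cpr Q' V nV)).
  - exact: continuous_subspaceT (@cst_continuous _ R 1%R).
  - by exists 1%R => x _; rewrite normr1.
(* All tails are finite, so each one is the total mass minus finitely many weakly continuous
   terms. *)
have split_tail (P' : strategic) m : fine (transient_tail z (set_val P') m) =
    (fine (transient_tail z (set_val P') 0) -
     \sum_(t < m) fine ((set_val P' : probability (borel Om) R) (transient_at z t)))%R.
  rewrite (transient_tail_split z (set_val P') (leq0n m)) fineD; last 2 first.
  - by apply/sum_fin_numP => t _ _; apply: fin_num_measure; exact: measurable_transient_at.
  - by apply: (transient_tail_fin absorbing_z); exact: set_valP.
  rewrite -sum_fine; last first.
    by move=> t _; apply: fin_num_measure; exact: measurable_transient_at.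
  by rewrite big_mkord [X in (X - _)%R]addrC addrK.
have eQ m : (e <= fine (transient_tail z Q m))%R.
  have cm : (fun n => fine (transient_tail z (set_val (P n)) m)) @ U -->
      fine (transient_tail z Q m).
    rewrite (split_tail Q' m); under eq_fun do rewrite split_tail.
    apply: (cvgB ctotal); pose q t (P' : strategic) :=
      fine ((set_val P' : probability (borel Om) R) (transient_at z t)).
    apply: (@cvg_sum_ord R strategic (P @ U) FU m q (q ^~ Q')) => t.
    exact: transient_probability_continuous.
  apply: (ler_cvg_to (@cvg_cst _ e _ U _) cm).
  (* From the index [m] on, the tail of [P n] at [m] dominates its tail at [n], which exceeds
     [e]. *)
  apply: Uoo; exists m => // n /= mn; apply: (le_trans (ltW (PP n))).
  apply: fine_le; [exact: (transient_tail_fin absorbing_z n (set_valP _))|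
    exact: (transient_tail_fin absorbing_z m (set_valP _))|exact: transient_tail_le].
have := @nneseries_tail_cvg R (fun t => Q (transient_at z t)) xpredT.
have Qfin : \sum_(0 <= k <oo) Q (transient_at z k) < +oo.
  by rewrite -ge0_fin_numE; [exact: (transient_tail_fin absorbing_z 0 sQ)|
    exact: (transient_tail_ge0 z Q 0)].
move=> /(_ Qfin (fun _ _ => measure_ge0 _ _)) /cvge_to_ge h.
suff : e%:E <= 0 by rewrite lee_fin leNgt e0.
apply: h; apply: nearW => n; rewrite -[leRHS]fineK ?lee_fin; first exact: eQ.
exact: (transient_tail_fin absorbing_z n sQ).
Qed.

End continuity.

Theorem theorem2 (R : realType) (M : mdp R)
    (P0 : probability (borel (state M)) R) (z : state M)
    (semicontinuous_M : semicontinuous M)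
    (absorbing_M : absorbing P0 z) :
  continuous (projection absorbing_M) <-> uniformly_absorbing P0 z.
Proof.
split; first exact: continuous_uniformly_absorbing.
exact: projection_continuous.
Qed.
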